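(* Let $p$ be an odd prime, $r\geq1$, $m=2p^r$, and let $L$ be the standard choice of exponents for the Weil representation $\rho$ attached to the cyclic finite quadratic module $(\mathbb{Z}/m\mathbb{Z},\ q(x)=\frac{x^2}{2m})$, so that $\mathrm{Tr}(L)=\sum_{x=1}^{2p^r}\big\{-\frac{x^2}{4p^r}\big\}$. Then $$\mathrm{Tr}(L)=p^r-\Big\{\frac{p^r}{4}\Big\}p^{\lfloor r/2\rfloor}+\frac{p^{\lfloor (r+1)/2\rfloor}-1}{2(p-1)}\cdot\begin{cases}h_p & \text{if } p\equiv1\pmod 4,\\ 4h_p^\ast+1 & \text{if } p\equiv 3\pmod 8,\\ 2h_p+1&\text{if } p\equiv 7\pmod 8,\end{cases}$$ where $h_p$ is the class number of $\mathbb{Q}(\sqrt{-p})$, and $h_p^\ast=h_p$ except when $p=3$, in which case $h_p^\ast=\frac13$.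
   Context: For $x\in\mathbb{Q}$, $\{x\}\in[0,1)$ is the fractional part. The Weil representation of a finite quadratic module $(D,q)$ acts on $\mathbb{C}[D]$ with basis $\{\delta_x\}$, with the generator $T$ (lift of $\begin{pmatrix}1&1\\0&1\end{pmatrix}$ to the metaplectic group) acting by $\rho(T)\delta_x=e^{-2\pi i q(x)}\delta_x$. A choice of exponents is an operator $L$ with $\rho(T)=e^{2\pi i L}$; the standard choice is the one all of whose eigenvalues have real part in $[0,1)$, here the diagonal operator $L\delta_x=\{-q(x)\}\delta_x$. *)

(* Defs.v *)
From HB Require Import structures.
From mathcomp Require Import all_boot all_order all_algebra all_field.
From mathcomp Require Import complex finmap ring lra zify.
From mathcomp Require Import all_classical all_reals all_analysis.

Set Implicit Arguments.
Unset Strict Implicit.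
Unset Printing Implicit Defensive.

Import Order.TTheory GRing.Theory Num.Theory.
Import numFieldNormedType.Exports.

Local Open Scope classical_set_scope.
Local Open Scope ring_scope.

Definition frac_part (x : rat) : rat := x - (Num.floor x)%:~R.

(* The Q/Z-valued quadratic form is represented by a lift q : D -> rat. *)
Definition polar_form (D : finZmodType) (q : D -> rat) (x y : D) : rat :=
  q (x + y) - q x - q y.

Definition finite_quadratic_module (D : finZmodType) (q : D -> rat) : Prop :=
  [/\ forall x (n : int), q (x *~ n) - (n ^+ 2)%:~R * q x \is a Num.int,
      forall x y z, polar_form q (x + y) z - polar_form q x z
                      - polar_form q y z \is a Num.int
    & forall x, (forall y, polar_form q x y \is a Num.int) -> x = 0].

Definition cyclic_form (m : nat) (x : 'Z_m) : rat :=
  (x ^ 2)%N%:R / (2 * m)%N%:R.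

Definition expi (R : realType) (t : R) : R[i] := Complex (cos t) (sin t).

(* C[D] is identified with column vectors through enum_rank : D -> 'I_#|D|,
   delta_x being the basis vector of index enum_rank x. *)
Definition weil_T (R : realType) (D : finZmodType) (q : D -> rat) :
    'M[R[i]]_#|D| :=
  diag_mx (\row_(i < #|D|) expi (- (2 * pi * ratr (q (enum_val i))) : R)).

Definition is_expmx (C : numFieldType) (n : nat) (A B : 'M[C]_n) : Prop :=
  (fun N : nat => \sum_(k < N) (k`!%:R)^-1 *: A ^+ k) @ \oo --> B.

Definition choice_of_exponents (R : realType) (n : nat) (T L : 'M[R[i]]_n) :
    Prop :=
  is_expmx (Complex 0 (2 * pi : R) *: L) T.

Definition standard_choice_of_exponents (R : realType) (n : nat)
    (T L : 'M[R[i]]_n) : Prop :=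
  choice_of_exponents T L /\
  (forall a : R[i], eigenvalue L a -> 0 <= complex.Re a < 1).

(* Number fields are taken as subfields of the algebraic complex numbers. *)
Definition quadratic_field (d : int) : set algC :=
  [set z | exists a b : rat, z = ratr a + ratr b * sqrtC (d%:~R)].

Definition ring_of_integers (K : set algC) : set algC :=
  K `&` [set z | z \in Aint].

Definition nonzero_ideal (O I : set algC) : Prop :=
  [/\ I `<=` O,
      exists2 x, I x & x != 0,
      forall x y, I x -> I y -> I (x + y)
    & forall a x, O a -> I x -> I (a * x)].

Definition ideal_equiv (O I J : set algC) : Prop :=
  exists a b : algC,
    [/\ O a, a != 0, O b, b != 0 & *%R a @` I = *%R b @` J].

Definition ideal_class (O I : set algC) : set (set algC) :=
  [set J | nonzero_ideal O J /\ ideal_equiv O I J].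

Definition ideal_classes (O : set algC) : set (set (set algC)) :=
  [set ideal_class O I | I in nonzero_ideal O].

(* fset_set is the underlying finite set of a finite set (and empty on infinite
   ones, which does not occur for the integers of a number field). *)
Definition class_number (K : set algC) : nat :=
  #|` fset_set (ideal_classes (ring_of_integers K))|.

Definition class_number_sqrtN (p : nat) : nat :=
  class_number (quadratic_field (- p%:Z)).

Definition class_number_sqrtN_star (p : nat) : rat :=
  if p == 3%N then 3^-1 else (class_number_sqrtN p)%:R.

Unset Implicit Arguments.

Lemma Zp_intrP (m : nat) (a : int) : (1 < m)%N ->
  exists k : int, (val (a%:~R : 'Z_m))%:Z = a + k * m%:Z.
Proof.
move=> m1; have m0 : m%:Z != 0 by lia.
exists (- (a %/ m)%Z); rewrite mulNr.
have -> : a - (a %/ m)%Z * m = (a %% m)%Z.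
  by rewrite {1}(divz_eq a m) addrAC subrr add0r.
have -> : (a%:~R : 'Z_m) = (`|(a %% m)%Z|%N)%:R.
  rewrite [LHS](_ : _ = ((a %% m)%Z)%:~R).
    by rewrite -[in LHS](gez0_abs (modz_ge0 _ m0)).
  rewrite {1}(divz_eq a m) rmorphD rmorphM /=.
  by rewrite -[m%:~R]/(m%:R) pchar_Zp// mulr0 add0r.
rewrite /= val_Zp_nat// modn_small ?gez0_abs ?modz_ge0//.
by rewrite -ltz_nat gez0_abs ?modz_ge0// ltz_pmod// ltz_nat ltnW.
Qed.

Lemma cyclic_form_intr (m : nat) (a : int) : (0 < m)%N -> ~~ odd m ->
  exists k : int, @cyclic_form m a%:~R = (a ^+ 2)%:~R / (2 * m%:R) + k%:~R.
Proof.
move=> m0 me; have m1 : (1 < m)%N by case: m m0 me => [|[]].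
have [k ak] := Zp_intrP m a m1.
have [n mn] : exists n, m = n.*2 by exists m./2; rewrite even_halfK.
exists (a * k + k ^+ 2 * n%:Z).
have mR : (m%:R : rat) != 0 by rewrite pnatr_eq0 -lt0n.
rewrite /cyclic_form natrX natrM.
have -> : ((a%:~R : 'Z_m) : nat)%:R = a%:~R + k%:~R * m%:R :> rat.
  by rewrite -[LHS]/((val (a%:~R : 'Z_m))%:Z%:~R) ak rmorphD rmorphM.
rewrite !(rmorphD, rmorphM, rmorphXn) /= -[n%:~R]/(n%:R).
have mn' : m%:R = 2 * n%:R :> rat by rewrite mn -muln2 natrM mulrC.
rewrite mn' in mR *; field.
by apply: contra mR => /eqP->; rewrite mulr0.
Qed.

Lemma cyclic_formP (m : nat) : (0 < m)%N -> ~~ odd m ->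
  finite_quadratic_module (@cyclic_form m).
Proof.
move=> m0 me; have m1 : (1 < m)%N by case: m m0 me => [|[]].
have mR : (m%:R : rat) != 0 by rewrite pnatr_eq0 -lt0n.
have lift (x : 'Z_m) : exists a : int, x = a%:~R.
  by exists (val x)%:Z; rewrite -[RHS]/((val x)%:R) natr_Zp.
have polE (a b : int) : exists k : int,
    polar_form (@cyclic_form m) a%:~R b%:~R = (a * b)%:~R / m%:R + k%:~R.
  rewrite /polar_form -intrD.
  have [k1 ->] := cyclic_form_intr m (a + b) m0 me.
  have [k2 ->] := cyclic_form_intr m a m0 me.
  have [k3 ->] := cyclic_form_intr m b m0 me.
  exists (k1 - k2 - k3); rewrite !(rmorphD, rmorphM, rmorphXn, rmorphN)/=.
  by field.
have isint (x : rat) (k : int) : x = k%:~R -> x \is a Num.int.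
  by move=> ->; exact: intr_int.
split.
- move=> x n; have [a ->] := lift x; rewrite -mulrzA.
  have [k1 ->] := cyclic_form_intr m (a * n) m0 me.
  have [k2 ->] := cyclic_form_intr m a m0 me.
  apply: (isint _ (k1 - n ^+ 2 * k2)).
  rewrite !(rmorphD, rmorphM, rmorphXn, rmorphN)/=.
  by field.
- move=> x y z; have [a ->] := lift x; have [b ->] := lift y.
  have [c ->] := lift z.
  have [k1] := polE (a + b) c; rewrite intrD => ->.
  have [k2 ->] := polE a c.
  have [k3 ->] := polE b c.
  apply: (isint _ (k1 - k2 - k3)).
  rewrite !(rmorphD, rmorphM, rmorphXn, rmorphN)/=.
  by field.
- move=> x /(_ 1).
  have xE : x = (val x)%:Z%:~R by rewrite -[RHS]/((val x)%:R) natr_Zp.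
  rewrite {1}xE; have [k] := polE (val x)%:Z 1; rewrite mulr1 => ->.
  rewrite rpredDr ?intr_int// => /intrP[n /(congr1 ( *%R^~ m%:R))].
  rewrite divfK// => h.
  have {}h : (val x)%:Z = n * m%:Z.
    by apply/eqP; rewrite -(eqr_int rat) intrM; apply/eqP.
  have xm : (val x < m)%N by rewrite -[X in (_ < X)%N](Zp_cast m1) ltn_ord.
  apply/val_inj => /=; move: h xm => /=; move: (nat_of_ord x) => v h xm.
  have : (m %| v)%N by rewrite -[v]absz_nat h abszM dvdn_mull.
  by case/dvdnP => -[|c] E; [rewrite E mul0n | exfalso; nia].
Qed.

Local Open Scope complex_scope.

Lemma mx_cvgP (C : numFieldType) n (u : nat -> 'M[C]_n) (B : 'M[C]_n) :
  (forall i j, (fun N => u N i j) @ \oo --> B i j) -> u @ \oo --> B.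
Proof.
move=> h A [P hP sPA]; rewrite nbhs_simpl /=.
have : \forall N \near \oo, forall i j, P i j (u N i j).
  apply: filter_forall => i; apply: filter_forall => j; exact: (h i j _ (hP i j)).
by apply: filterS => N; exact: sPA.
Qed.

Lemma Re_sum (R : realType) n (f : nat -> R[i]) :
  \sum_(k < n) f k = Complex (\sum_(0 <= k < n) complex.Re (f k)) (\sum_(0 <= k < n) complex.Im (f k)).
Proof.
elim: n => [|n IH]; first by rewrite big_ord0 !big_geq.
rewrite big_ord_recr /= IH !big_nat_recr //=; case: (f n) => a b //=.
Qed.

Lemma expi_pow (R : realType) (t : R) k :
  (k`!%:R)^-1 * (Complex 0 t) ^+ k = Complex (cos_coeff t k) (sin_coeff t k).
Proof.
have P : (Complex 0 t) ^+ k = Complex ((~~ odd k)%:R * (-1) ^+ k./2 * t ^+ k)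
   ((odd k)%:R * (-1) ^+ k.-1./2 * t ^+ k).
  elim: k => [|k IH]; first by apply/eqP; rewrite eq_complex /= ?mulr1 ?mul0r !eqxx.
  rewrite exprSr IH.
  have -> : forall a b : R, Complex a b * Complex 0 t = Complex (- (b * t)) (a * t).
    by move=> a b; rewrite /GRing.mul /= mulr0 mulr0 add0r addr0.
  rewrite exprSr /=; congr Complex.
    rewrite negbK; case: (boolP (odd k)) => ok; last by rewrite !mul0r oppr0.
    case: k ok {IH} => // k /= ok.
    rewrite [(-1) ^+ k./2.+1]exprS; ring.
  by rewrite !mulrA.
rewrite P.
have -> : (k`!%:R : R[i])^-1 = ((k`!%:R : R)^-1)%:C.
  by rewrite fmorphV /= rmorph_nat.
have -> : forall c a b : R, c%:C * Complex a b = Complex (c * a) (c * b).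
  by move=> c a b; rewrite /GRing.mul /= !mul0r subr0 addr0.
by rewrite /cos_coeff /sin_coeff /= ![(k`!%:R)^-1 * _]mulrC.
Qed.

Lemma cvg_C (R : realType) (u v : nat -> R) a b :
  u @ \oo --> a -> v @ \oo --> b ->
  ((fun N => Complex (u N) (v N)) : nat -> (R[i] : numFieldType)) @ \oo --> (Complex a b : (R[i] : numFieldType)).
Proof.
move=> ua vb; apply/(@cvgrPdist_lt (R[i] : numFieldType) (R[i] : numFieldType)).
case=> e1 e2; rewrite ltcE /= => /andP[/eqP -> e0].
have e20 : 0 < e1 / 2 by rewrite divr_gt0.
move/cvgrPdist_lt : ua => /(_ _ e20) ua.
move/cvgrPdist_lt : vb => /(_ _ e20) vb.
near=> N.
have -> : Complex a b - Complex (u N) (v N) = (a - u N)%:C + 'i%C * (b - v N)%:C.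
  by apply/eqP; rewrite eq_complex /= !mul0r !mul1r; simpc.
apply: le_lt_trans (ler_normD _ _) _.
rewrite normrM complexiE normCi mul1r.
rewrite !normc_def /= expr0n /= !addr0 !sqrtr_sqr -rmorphD.
rewrite ltcE /= eqxx /= (splitr e1) ltrD //.
  by near: N.
by near: N.
Unshelve. all: by end_near. Qed.

Lemma expi_series (R : realType) (t : R) :
  ((fun N => \sum_(k < N) (k`!%:R)^-1 * (Complex 0 t) ^+ k) : nat -> (R[i] : numFieldType)) @ \oo --> (expi t : (R[i] : numFieldType)).
Proof.
rewrite (_ : (fun N => _) = (fun N => Complex (series (cos_coeff t) N) (series (sin_coeff t) N))).
  apply: cvg_C.
    by rewrite unlock; exact: is_cvg_series_cos_coeff.
  by rewrite unlock; exact: is_cvg_series_sin_coeff.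
apply/funext => N; rewrite (@Re_sum _ N (fun k => (k`!%:R)^-1 * (Complex 0 t) ^+ k)).
by congr Complex; rewrite /series /=; apply: eq_bigr => k _; rewrite expi_pow.
Qed.

Lemma expi_per (R : realType) (t : R) (n : int) : expi (t + 2 * pi * n%:~R) = expi t.
Proof.
have E : forall (k : nat) t, expi (t + 2 * pi * k%:R) = expi t :> R[i].
  elim=> [|k IH] {}t; first by rewrite mulr0 addr0.
  rewrite -[k.+1%:R]natr1. rewrite mulrDr mulr1 addrA /expi.
  have -> : 2 * pi = pi *+ 2 :> R by rewrite mulr_natl.
  by rewrite cosD2pi sinD2pi -[pi *+ 2]mulr_natl; exact: IH.
case: n => k; first exact: E.
rewrite -(E k.+1 (t + _)); congr expi.
by rewrite NegzE mulrNz -[(k.+1)%:~R]/(k.+1%:R) mulrN subrK.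
Qed.

Lemma diag_expmx (C : numFieldType) n (d e : 'rV[C]_n) :
  (forall i, (fun N : nat => \sum_(k < N) (k`!%:R)^-1 * d 0 i ^+ k) @ \oo --> e 0 i) ->
  is_expmx (diag_mx d) (diag_mx e).
Proof.
move=> h; apply: mx_cvgP => i j.
have pw k : diag_mx d ^+ k = diag_mx (\row_i d 0 i ^+ k).
  elim: k => [|k IH].
    by apply/matrixP => a b; rewrite !mxE expr0.
  rewrite exprS IH -[_ * _]/(_ *m _) mulmx_diag; congr diag_mx.
  by apply/rowP => a; rewrite !mxE exprS.
have [<-|ij] := eqVneq i j.
  rewrite (_ : (fun N => _) = (fun N : nat => \sum_(k < N) (k`!%:R)^-1 * d 0 i ^+ k)).
    by rewrite mxE eqxx mulr1n; exact: h.
  by apply/funext => N; rewrite summxE; apply: eq_bigr => k _; rewrite pw !mxE eqxx mulr1n.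
rewrite (_ : (fun N => _) = (fun N : nat => 0)).
  by rewrite mxE (negbTE ij) mulr0n; exact: cvg_cst.
by apply/funext => N; rewrite summxE big1 // => k _; rewrite pw !mxE (negbTE ij) mulr0n mulr0.
Qed.

(* Standard choices of exponents exist: the diagonal operator
   delta_x |-> {-q(x)} delta_x is one. *)
Lemma weil_T_std (R : realType) (D : finZmodType) (q : D -> rat) :
  standard_choice_of_exponents (weil_T R q)
    (diag_mx (\row_i ratr (frac_part (- q (enum_val i))))).
Proof.
have ratrC (x : rat) : ratr x = (ratr x : R)%:C :> R[i].
  by rewrite fmorph_rat.
split.
  rewrite /choice_of_exponents -linearZ /=; apply: diag_expmx => i.
  rewrite !mxE ratrC.
  have -> : Complex 0 (2 * pi) * (ratr (frac_part (- q (enum_val i))) : R)%:C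
     = Complex 0 (2 * pi * ratr (frac_part (- q (enum_val i)))) :> R[i].
    by rewrite /GRing.mul /= !mul0r !mulr0 subr0 add0r.
  rewrite -(@expi_per _ _ (- Num.floor (- q (enum_val i)))).
  have -> : (- (2 * pi * ratr (q (enum_val i))) +
          2 * pi * (- Num.floor (- q (enum_val i)))%:~R)
     = 2 * pi * ratr (frac_part (- q (enum_val i))) :> R.
    by rewrite /frac_part rmorphB rmorphN /= ratr_int ?mulrNz; ring.
  exact: expi_series.
move=> a /eigenvalueP[v va v0].
have [i vi] : exists i, v 0 i != 0.
  by apply/existsP; apply: contraNT v0 => /existsPn h; apply/eqP/rowP => i; rewrite mxE; apply/eqP; move: (h i); rewrite negbK.
move/rowP: va => /(_ i); rewrite mul_mx_diag !mxE mulrC => /(mulIf vi) <-.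
rewrite ratrC /= /frac_part.
have /andP[h1 h2] := floor_itv (- q (enum_val i)).
rewrite ler0q subr_ge0 h1 /= -[X in _ < X](rmorph1 (@ratr R)) ltr_rat ltrBlDl.
by rewrite intrD in h2.
Qed.

(* Main.v *)
(** The exponential of an upper triangular form of [L] has exponentials on its
    diagonal, so the eigenvalue condition forces the diagonal of that form to be
    the numbers [{-q(x)}]; this gives the trace as a sum of fractional parts.

    Square roots of units modulo [p^r] are lifted from square roots modulo [p];
    with the distribution relation for fractional parts, this makes the sum over
    [p^r] a recursion in steps of two, whose constant is a combination of sums of
    fractional parts weighted by the quadratic character of [p].

    These character sums are means of partial sums of the quadratic character
    of the field.  To identify such a mean with the class number, every ideal
    class is represented by a positive definite form [f], and the number of
    representations of [n] by all the forms together is [2 sum_(d | n) chi(d)]: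
    the count of ideals of norm [n] is reduced to primes, and reciprocity is
    proved with Gauss sums in finite fields.  Both sides are then summed against
    the weight [psi(n) = (N - n)_+^3].  The number of lattice points in an
    ellipse is not needed: in [sum psi(f) - 4 sum psi(4 f)] the main terms
    cancel, the remainder is controlled by third differences, and only the term
    [f = 0] is left, which yields [h] in the limit. *)

From mathcomp Require Import all_boot all_order all_algebra.
From mathcomp Require Import all_field all_fingroup all_solvable.
From mathcomp Require Import ring lra zify.

Set Implicit Arguments.
Unset Strict Implicit.
Unset Printing Implicit Defensive.

Import Order.TTheory GRing.Theory Num.Theory.
Local Open Scope ring_scope.

(** * Differences of truncated cubes *)

(** The cube is dictated by sizes. With [N = s ^ 2] and a k-th power as weight, the term [f = 0] has
    size [s ^ (2 * k)], while k-th differences along a row have size [s ^ k] and about [s ^ 2]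
    lattice points matter; [s ^ (k + 2)] is of smaller order first for k = 3. The factor 4 is the
    index of the even sublattice: as 4 f(x, y) = f(2 x, 2 y), the combination is minus the sum of
    the three lattice sums with signs (-1)^x, (-1)^y and (-1)^(x + y), to which differences apply.
    Each class contributes [N ^ 3 - 4 * N ^ 3] through [f = 0]. On the divisor side, psi(v) - 4
    psi(4 v) is (psi(v) - 2 psi(2 v)) + 2 (psi(2 v) - 2 psi(4 v)), so the sums over the cofactor
    alternate too; each is [N ^ 3 / 2] to first order whatever the divisor, and summing over the
    divisor turns this into [c * N ^ 3 / 2], with [c] the mean of the partial sums. Hence -3 h + 2
    (c / 2 + c) = 0. The factor 2 in the representation count comes from the units 1 and -1, which
    leaves out p = 3; there the mean is 1/3, the exceptional value in the theorem. *)

Definition cubp (F : realDomainType) (u : F) : F := Num.max 0 u ^+ 3.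

Section CubePositivePart.
Variable F : realFieldType.
Implicit Types u v : F.

Lemma cubp_ge0 u : 0 <= cubp u.
Proof. by rewrite exprn_ge0 // le_max lexx. Qed.

Lemma cubp_pos u : 0 <= u -> cubp u = u ^+ 3.
Proof. by move=> u0; rewrite /cubp max_r. Qed.

Lemma cubp_neg u : u <= 0 -> cubp u = 0.
Proof. by move=> u0; rewrite /cubp max_l // expr0n. Qed.

Lemma cubp_diff2 u v : 0 <= v -> 0 <= cubp u - 2 * cubp (u - v) + cubp (u - 2 * v).
Proof.
move=> v0; have [uv|vu] := leP (u - v) 0.
  by rewrite (cubp_neg uv) mulr0 subr0 addr_ge0 // cubp_ge0.
have [uv2|vu2] := leP (u - 2 * v) 0.
  rewrite (cubp_neg uv2) !cubp_pos; try lra.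
  have [w uE] : exists w, u = w + v by exists (u - v); ring.
  have w0 : 0 <= w by lra.
  rewrite uE addrK addr0.
  have -> : (w + v) ^+ 3 - 2 * w ^+ 3 =
    w ^+ 2 * (v - w) + 2 * (w ^+ 2 * v) + 3 * (w * v ^+ 2) + v ^+ 3 by ring.
  by rewrite !addr_ge0 ?mulr_ge0 ?exprn_ge0 //; lra.
rewrite !cubp_pos; try lra.
have -> : u ^+ 3 - 2 * (u - v) ^+ 3 + (u - 2 * v) ^+ 3 = 6 * (u - v) * (v * v) by ring.
by apply: mulr_ge0; nra.
Qed.

(** The second difference at [u - v] is at most the one at [u]; this monotonicity is what the
    Leibniz bound [alternating_decreasing] asks for. *)
Lemma cubp_diff3 u v : 0 <= v ->
  0 <= cubp u - 3 * cubp (u - v) + 3 * cubp (u - 2 * v) - cubp (u - 3 * v).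
Proof.
move=> v0; have [uv|vu] := leP (u - v) 0.
  rewrite (cubp_neg uv) (@cubp_neg (u - 2 * v)) ?(@cubp_neg (u - 3 * v)); try lra.
  by have := cubp_ge0 u; lra.
have [uv2|vu2] := leP (u - 2 * v) 0.
  rewrite (cubp_neg uv2) (@cubp_neg (u - 3 * v)) ?cubp_pos; try lra.
  have [w uE] : exists w, u = w + v by exists (u - v); ring.
  have w0 : 0 <= w by lra.
  rewrite uE addrK mulr0 subr0.
  have -> : (w + v) ^+ 3 - 3 * w ^+ 3 + 0 =
    2 * (w ^+ 2 * (v - w)) + w ^+ 2 * v + 3 * (w * v ^+ 2) + v ^+ 3 by ring.
  by rewrite !addr_ge0 ?mulr_ge0 ?exprn_ge0 //; lra.
have [w uE] : exists w, u = w + 2 * v by exists (u - 2 * v); ring.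
have w0 : 0 <= w by lra.
have v3 : 0 <= v ^+ 3 by exact: exprn_ge0.
have [uv3|vu3] := leP (u - 3 * v) 0.
  rewrite (cubp_neg uv3) !cubp_pos; try lra.
  have -> : u ^+ 3 - 3 * (u - v) ^+ 3 + 3 * (u - 2 * v) ^+ 3 - 0
     = w ^+ 3 + 3 * (w * v * (v - w)) + 5 * v ^+ 3 by rewrite uE; ring.
  have w3 : 0 <= w ^+ 3 by exact: exprn_ge0.
  by have : 0 <= w * v * (v - w); [apply: mulr_ge0; [exact: mulr_ge0|lra]|lra].
by rewrite !cubp_pos; lra.
Qed.

Lemma cubp_le_diff u v : 0 <= u -> 0 <= v -> cubp u - cubp (u - v) <= 3 * u ^+ 2 * v.
Proof.
move=> u0 v0; rewrite (cubp_pos u0); have [uv|vu] := leP (u - v) 0.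
  rewrite (cubp_neg uv) subr0.
  rewrite -subr_ge0.
  have -> : 3 * u ^+ 2 * v - u ^+ 3 = u ^+ 2 * (v - u) + 2 * (u ^+ 2 * v) by ring.
  by rewrite !addr_ge0 ?mulr_ge0 ?exprn_ge0 //; lra.
rewrite cubp_pos ; last lra.
rewrite -subr_ge0.
have -> : 3 * u ^+ 2 * v - (u ^+ 3 - (u - v) ^+ 3) = v ^+ 2 * (u - v) + 2 * (v ^+ 2 * u) by ring.
by rewrite !addr_ge0 ?mulr_ge0 ?exprn_ge0 //; lra.
Qed.

Lemma third_difference_bound (Q x0 x1 x2 x3 : F) :
  0 <= x0 <= Q -> 0 <= x1 <= Q -> 0 <= x2 <= Q -> 0 <= x3 <= Q ->
  `|x0 - 3 * x1 + 3 * x2 - x3| <= 8 * Q.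
Proof.
move=> /andP[? ?] /andP[? ?] /andP[? ?] /andP[? ?].
by rewrite ler_norml; apply/andP; split; lra.
Qed.

Lemma six_terms_bound (Q t1 t2 t3 t4 t5 t6 : F) :
  `|t1| <= Q -> `|t2| <= Q -> `|t3| <= Q -> `|t4| <= Q -> `|t5| <= Q -> `|t6| <= Q ->
  `|- (6 * t1 + 36 * t2 + 108 * t3 + 108 * t4 + 450 * t5 + 540 * t6)| <= 13824 * Q.
Proof.
rewrite !ler_norml.
move=> /andP[? ?] /andP[? ?] /andP[? ?] /andP[? ?] /andP[? ?] /andP[? ?].
by apply/andP; split; lra.
Qed.

(** The four arguments are the values at 0, 1, 2, 3 of one quadratic polynomial. If all are
    nonnegative, the truncation is inactive and the terms in [u ^ 3], [u ^ 2 * al], [u ^ 2 * be] and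
    [u * al ^ 2] cancel; every remaining monomial is at most [B ^ 3 * s ^ 3]. If one is negative,
    all four are at most [12 * (B * s)], and the cubes are small before any cancellation. *)
Lemma cubp_third_difference (al be u B s : F) :
  1 <= s -> 1 <= B -> `|al| <= B * s -> `|be| <= B -> u <= s ^+ 2 ->
  `|cubp u - 3 * cubp (u + al + be) + 3 * cubp (u + 2 * al + 4 * be)
    - cubp (u + 3 * al + 9 * be)| <= 13824 * B ^+ 3 * s ^+ 3.
Proof.
move=> s1 B1 hal hbe hu.
have s0 : 0 < s by lra.
have B0 : 0 < B by lra.
set u1 := u + al + be; set u2 := u + 2 * al + 4 * be; set u3 := u + 3 * al + 9 * be.
have BBs : B <= B * s by rewrite ler_peMr // ltW.
have Bs3 : 0 < B ^+ 3 * s ^+ 3 by rewrite mulr_gt0 // exprn_gt0.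
have [al1 al2] : - (B * s) <= al /\ al <= B * s by move: hal; rewrite ler_norml => /andP[].
have [be1 be2] : - B <= be /\ be <= B by move: hbe; rewrite ler_norml => /andP[].
(* 12 = 3 + 9 bounds the change of the quadratic polynomial between two of the four points; with the
   weights 1, 3, 3, 1 this gives 13824 = 8 * 12 ^ 3. *)
have small w : w <= 12 * (B * s) -> 0 <= cubp w <= 1728 * (B ^+ 3 * s ^+ 3).
  move=> hw; rewrite cubp_ge0 /=; have [w0|w0] := leP w 0.
    by rewrite cubp_neg // mulr_ge0 // ltW.
  rewrite (cubp_pos (ltW w0)).
  have -> : 1728 * (B ^+ 3 * s ^+ 3) = (12 * (B * s)) ^+ 3 by ring.
  by rewrite ler_pXn2r // nnegrE; lra.
have smallall : u <= 12 * (B * s) -> u1 <= 12 * (B * s) -> u2 <= 12 * (B * s) ->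
    u3 <= 12 * (B * s) ->
  `|cubp u - 3 * cubp u1 + 3 * cubp u2 - cubp u3| <= 13824 * B ^+ 3 * s ^+ 3.
  move=> /small h0 /small h1 /small h2 /small h3.
  by apply: le_trans (third_difference_bound h0 h1 h2 h3) _; rewrite le_eqVlt; apply/orP; left; apply/eqP; ring.
have lin (q : F) : B <= q -> - q <= al <= q -> [|| u < 0, u1 < 0, u2 < 0 | u3 < 0] ->
    [&& u <= 12 * q, u1 <= 12 * q, u2 <= 12 * q & u3 <= 12 * q].
  rewrite /u1 /u2 /u3 => Bq /andP[q1 q2].
  clear -be1 be2 Bq q1 q2 B0.
  by case/or4P => ?; apply/and4P; split; lra.
case: (boolP [|| u < 0, u1 < 0, u2 < 0 | u3 < 0]) => [neg|].
  have := lin _ BBs _ neg; rewrite al1 al2 => /(_ isT) /and4P[? ? ? ?].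
  exact: smallall.
rewrite !negb_or -!leNgt => /and4P[h0 h1 h2 h3].
rewrite !cubp_pos // /u1 /u2 /u3.
have -> : u ^+ 3 - 3 * (u + al + be) ^+ 3 + 3 * (u + 2 * al + 4 * be) ^+ 3 -
    (u + 3 * al + 9 * be) ^+ 3 =
  - (6 * al ^+ 3 + 36 * (u * al * be) + 108 * (u * be ^+ 2) + 108 * (al ^+ 2 * be)
     + 450 * (al * be ^+ 2) + 540 * be ^+ 3) by ring.
have B23 : B ^+ 2 <= B ^+ 3.
  by rewrite [leRHS]exprSr ler_peMr // exprn_ge0 // ltW.
have s13 : s <= s ^+ 3 by rewrite exprSr ler_peMl ?exprn_ege1 // ltW.
have s23 : s ^+ 2 <= s ^+ 3 by rewrite [leRHS]exprSr ler_peMr // exprn_ge0 // ltW.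
have s03 : 1 <= s ^+ 3 by exact: exprn_ege1.
have t1 : `|al ^+ 3| <= B ^+ 3 * s ^+ 3.
  by rewrite normrX -exprMn ler_pXn2r ?nnegrE // mulr_ge0 // ltW.
have t2 : `|u * al * be| <= B ^+ 3 * s ^+ 3.
  rewrite !normrM (ger0_norm h0).
  apply: (@le_trans _ _ (s ^+ 2 * (B * s) * B)).
    by rewrite ler_pM ?mulr_ge0 // ler_pM.
  have -> : s ^+ 2 * (B * s) * B = B ^+ 2 * s ^+ 3 by ring.
  by rewrite ler_pM2r // exprn_gt0.
have t3 : `|u * be ^+ 2| <= B ^+ 3 * s ^+ 3.
  rewrite normrM normrX (ger0_norm h0) mulrC ler_pM ?exprn_ge0 //.
    by apply: le_trans B23; rewrite ler_pXn2r ?nnegrE // ltW.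
  exact: le_trans hu s23.
have t4 : `|al ^+ 2 * be| <= B ^+ 3 * s ^+ 3.
  rewrite normrM normrX.
  apply: (@le_trans _ _ ((B * s) ^+ 2 * B)).
    by rewrite ler_pM ?exprn_ge0 // ler_pXn2r ?nnegrE // mulr_ge0 // ltW.
  have -> : (B * s) ^+ 2 * B = B ^+ 3 * s ^+ 2 by ring.
  by rewrite ler_pM2l // exprn_gt0.
have t5 : `|al * be ^+ 2| <= B ^+ 3 * s ^+ 3.
  rewrite normrM normrX.
  apply: (@le_trans _ _ ((B * s) * B ^+ 2)).
    by rewrite ler_pM ?exprn_ge0 // ler_pXn2r ?nnegrE // ltW.
  have -> : (B * s) * B ^+ 2 = B ^+ 3 * s by ring.
  by rewrite ler_pM2l // exprn_gt0.
have t6 : `|be ^+ 3| <= B ^+ 3 * s ^+ 3.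
  rewrite normrX; apply: (@le_trans _ _ (B ^+ 3)).
    by rewrite ler_pXn2r ?nnegrE // ltW.
  by rewrite ler_peMr // exprn_ge0 // ltW.
by rewrite -[leRHS]mulrA; exact: six_terms_bound.
Qed.

End CubePositivePart.

Lemma alternating_abel (F : comNzRingType) (n : nat) (phi : nat -> F) :
  \sum_(i < n) (-1) ^+ i * (phi i - phi i.+1) =
  2 * (\sum_(i < n) (-1) ^+ i * phi i) - phi 0%N + (-1) ^+ n * phi n.
Proof.
elim: n => [|n IH]; first by rewrite !big_ord0 expr0; ring.
by rewrite !big_ord_recr /= IH exprS; ring.
Qed.

(** Each alternating summation by parts replaces twice the sum by the sum of differences plus
    boundary terms. Three of them give the factor 8, and the six hypotheses kill the boundary. *)
Lemma alternating_third_difference (F : comNzRingType) (n : nat) (phi : nat -> F) :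
  phi 0%N = 0 -> phi 1%N = 0 -> phi 2%N = 0 ->
  phi n = 0 -> phi n.+1 = 0 -> phi n.+2 = 0 ->
  8 * (\sum_(i < n) (-1) ^+ i * phi i) =
  \sum_(i < n) (-1) ^+ i * (phi i - 3 * phi i.+1 + 3 * phi i.+2 - phi i.+3).
Proof.
move=> p0 p1 p2 q0 q1 q2.
pose d1 i := phi i - phi i.+1; pose d2 i := d1 i - d1 i.+1.
have E1 := alternating_abel n phi; have E2 := alternating_abel n d1.
have E3 := alternating_abel n d2.
rewrite /d2 /d1 p0 p1 p2 q0 q1 q2 in E1 E2 E3.
transitivity (\sum_(i < n) (-1) ^+ i * (d2 i - d2 i.+1)).
  rewrite E3 E2 E1; ring.
by apply: eq_bigr => i _; rewrite /d2 /d1; ring.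
Qed.

(** Leibniz's bound: peeling off the first term flips the sign of the rest. *)
Lemma alternating_decreasing (F : realFieldType) (n : nat) (d : nat -> F) :
  (forall k, 0 <= d k) -> (forall k, d k.+1 <= d k) ->
  0 <= \sum_(k < n) (-1) ^+ k * d k <= d 0%N.
Proof.
elim: n d => [|n IH] d d0 dd; first by rewrite big_ord0 lexx d0.
rewrite big_ord_recl /= expr0 mul1r.
have /andP[h1 h2] := IH (fun k => d k.+1) (fun k => d0 _) (fun k => dd _).
rewrite [\sum_(i < n) _ * d (bump 0 i)](_ : _ = - \sum_(k < n) (-1) ^+ k * d k.+1).
  by have := dd 0%N; move: h1 h2 => /= h1 h2 h3; apply/andP; split; lra.
by rewrite -sumrN; apply: eq_bigr => i _; rewrite /bump /= add1n exprS; ring.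
Qed.

(** * Alternating sums over the lattice points of an ellipse *)

(** Stands for a sum over all integers: for a finitely supported [phi] the value no longer depends
    on [X] once [X] is large ([symsum_widen]). *)
Definition symsum (F : nmodType) (X : nat) (phi : int -> F) : F :=
  \sum_(i < X.*2.+1) phi (i%:Z - X%:Z).

Section SymmetricSums.
Variable F : nmodType.
Implicit Types (phi psi : int -> F) (X Y : nat).

Lemma symsum0 phi : symsum 0 phi = phi 0.
Proof. by rewrite /symsum big_ord1. Qed.

Lemma symsumS X phi :
  symsum X.+1 phi = symsum X phi + phi X.+1%:Z + phi (- X.+1%:Z).
Proof.
rewrite /symsum doubleS big_ord_recl big_ord_recr /= addrC.
congr (_ + _ + _); last by congr phi; lia.
  by apply: eq_bigr => i _; congr phi; rewrite /bump; lia.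
by congr phi; rewrite /bump; lia.
Qed.

Lemma eq_symsum X phi psi : phi =1 psi -> symsum X phi = symsum X psi.
Proof. by move=> e; apply: eq_bigr => i _; rewrite e. Qed.

Lemma symsum_widen X Y phi : (X <= Y)%N -> (forall x : int, X%:Z < `|x| -> phi x = 0) ->
  symsum Y phi = symsum X phi.
Proof.
move=> XY h; elim: Y XY => [|Y IH]; first by rewrite leqn0 => /eqP->.
rewrite leq_eqVlt => /orP[/eqP-> //|XY].
by rewrite symsumS IH // !h ?addr0 //; lia.
Qed.

Lemma symsum_double X phi :
  symsum X (fun x => phi (2 * x)) =
  symsum X.*2 (fun x => if (2 %| x)%Z then phi x else 0).
Proof.
elim: X => [|X IH]; first by rewrite !symsum0.
rewrite doubleS !symsumS -IH.
have -> : (2 %| (X.*2.+1)%:Z)%Z = false by lia.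
have -> : (2 %| - (X.*2.+1)%:Z)%Z = false by lia.
have -> : (2 %| (X.*2.+2)%:Z)%Z by lia.
have -> : (2 %| - (X.*2.+2)%:Z)%Z by lia.
rewrite !addr0 -doubleS; congr (_ + phi _ + phi _); lia.
Qed.

Lemma symsumD X phi psi :
  symsum X (fun x => phi x + psi x) = symsum X phi + symsum X psi.
Proof. exact: big_split. Qed.

Lemma exchange_symsum X Y (G : int -> int -> F) :
  symsum X (fun x => symsum Y (G x)) = symsum Y (fun y => symsum X (G^~ y)).
Proof. exact: exchange_big. Qed.

End SymmetricSums.

Lemma symsum_mulr (F : pzRingType) X (c : F) (phi : int -> F) :
  symsum X (fun x => c * phi x) = c * symsum X phi.
Proof. by rewrite /symsum mulr_sumr. Qed.

Lemma norm_symsum (F : realFieldType) X (B : F) (phi : int -> F) :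
  (forall x : int, `|x| <= X%:Z -> `|phi x| <= B) ->
  `|symsum X phi| <= X.*2.+1%:R * B.
Proof.
move=> h; apply: le_trans (ler_norm_sum _ _ _) _.
apply: (@le_trans _ _ (\sum_(i < X.*2.+1) B)).
  by apply: ler_sum => i _; apply: h; have := ltn_ord i; lia.
by rewrite sumr_const card_ord mulr_natl.
Qed.

(** (-1)^x, by cases because [x] may be negative. *)
Definition isign (x : int) : int := if (2 %| x)%Z then 1 else -1.

Lemma isignE (X i : nat) : isign (i%:Z - X%:Z) = (-1) ^+ X * (-1) ^+ i.
Proof.
rewrite -exprD -signr_odd oddD /isign.
by case: ifP => h; case oX: (odd X); case oi: (odd i) => //=; lia.
Qed.

Definition bqf (f : int * int * int) (x y : int) : int :=
  f.1.1 * x ^+ 2 + f.1.2 * x * y + f.2 * y ^+ 2.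

Section Lattice.
Variable F : realFieldType.

(** On a row, N - f(x + i) is (N - f(x)) - i (2 a x + b y) - i ^ 2 a, the shape required by
    [cubp_third_difference]; 1728 is 13824 / 8. The radius [X - 3] leaves three zero weights at each
    end, so that no boundary terms occur. *)
Lemma alternating_row (X : nat) (a b c y s N : int) (B : F) :
  1 <= s -> N = s ^+ 2 -> 1 <= B ->
  (forall x : int, (X%:Z - 3 < `|x|) -> N <= bqf (a, b, c) x y) ->
  (forall x, 0 <= bqf (a, b, c) x y) ->
  (forall x : int, `|x| <= X%:Z -> `|(2 * a * x + b * y)%:~R| <= B * s%:~R) ->
  `|a%:~R| <= B ->
  `|symsum X (fun x => (isign x)%:~R * cubp ((N - bqf (a, b, c) x y)%:~R : F))|
     <= X.*2.+1%:R * (1728 * B ^+ 3 * s%:~R ^+ 3).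
Proof.
move=> s1 NE B1 out pos al be.
pose phi (i : nat) : F := cubp ((N - bqf (a, b, c) (i%:Z - X%:Z) y)%:~R : F).
have phi0 i : X%:Z - 3 < `|i%:Z - X%:Z| -> phi i = 0.
  by move=> h; rewrite /phi cubp_neg // lerz0 subr_le0 out.
have third := @alternating_third_difference F X.*2.+1 phi.
rewrite !phi0 in third; try lia.
have {}third := third erefl erefl erefl erefl erefl erefl.
rewrite [symsum _ _](_ : _ = (-1) ^+ X * (\sum_(i < X.*2.+1) (-1) ^+ i * phi i)).
  rewrite normrM normrX normrN1 expr1n mul1r.
  rewrite -(@ler_pM2l _ (8 : F)) // -[X in X * `|_|](@ger0_norm F) // -normrM third.
  apply: le_trans (ler_norm_sum _ _ _) _.
  apply: (@le_trans _ _ (\sum_(i < X.*2.+1) (13824 * B ^+ 3 * s%:~R ^+ 3))); last first.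
    by rewrite sumr_const card_ord -mulr_natl le_eqVlt; apply/orP; left; apply/eqP; ring.
  apply: ler_sum => i _.
  rewrite normrM normrX normrN1 expr1n mul1r.
  have hx : `|i%:Z - X%:Z| <= X%:Z by have := ltn_ord i; lia.
  have := @cubp_third_difference F (- (2 * a * (i%:Z - X%:Z) + b * y)%:~R) (- a%:~R)
     ((N - bqf (a, b, c) (i%:Z - X%:Z) y)%:~R) B s%:~R.
  rewrite !normrN ler1z => /(_ s1 B1 (al _ hx) be).
  rewrite -[s%:~R ^+ 2]rmorphXn /= ler_int NE gerBl => /(_ (pos _)).
  congr (`|_| <= _).
  have e1 : i.+1%:Z = i%:Z + 1 by lia.
  have e2 : i.+2%:Z = i%:Z + 2 by lia.
  have e3 : i.+3%:Z = i%:Z + 3 by lia.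
  rewrite /phi -NE e1 e2 e3.
  by congr (_ - 3 * cubp _ + 3 * cubp _ - cubp _);
    rewrite /bqf /= !(rmorphD, rmorphN, rmorphM, rmorphXn) /=; ring.
rewrite /symsum mulr_sumr; apply: eq_bigr => i _.
by rewrite isignE rmorphM /= !rmorphXn /= rmorphN1 mulrA.
Qed.

End Lattice.

Definition posdef (f : int * int * int) : Prop :=
  [/\ 0 < f.1.1, 0 < f.2 & f.1.2 ^+ 2 < 4 * f.1.1 * f.2].

Lemma bqf_swap a b c x y : bqf (a, b, c) x y = bqf (c, b, a) y x.
Proof. by rewrite /bqf /=; ring. Qed.

Lemma posdef_swap a b c : posdef (a, b, c) -> posdef (c, b, a).
Proof. by move=> [/= h1 h2 h3]; split => //=; lia. Qed.

Lemma bqf_ge0 f x y : posdef f -> 0 <= bqf f x y.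
Proof.
move: f => [[a b] c] [/= a0 c0 d0].
rewrite -(@pmulr_rge0 _ (4 * a)); last by lia.
have -> : 4 * a * bqf (a, b, c) x y = (2 * a * x + b * y) ^+ 2 + (4 * a * c - b ^+ 2) * y ^+ 2.
  by rewrite /bqf /=; ring.
by rewrite addr_ge0 ?sqr_ge0 // mulr_ge0 ?sqr_ge0 // subr_ge0 ltW.
Qed.

(** Completing the square gives 4 c f >= (4 a c - b ^ 2) x ^ 2 >= x ^ 2, since a positive integer is
    at least 1. Hence the ellipse f < s ^ 2 lies in a box of side proportional to [s]. *)
Lemma bqf_outside a b c x y (s X : int) : posdef (a, b, c) ->
  1 <= s -> 2 * (a + c) * s <= X -> X <= `|x| -> s ^+ 2 <= bqf (a, b, c) x y.
Proof.
move=> [/= a0 c0 d0] s1 X1 X2.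
rewrite -(@ler_pM2l _ (4 * c)); last by lia.
have -> : 4 * c * bqf (a, b, c) x y = (2 * c * y + b * x) ^+ 2 + (4 * a * c - b ^+ 2) * x ^+ 2.
  by rewrite /bqf /=; ring.
have h1 : (2 * c * s) ^+ 2 <= x ^+ 2.
  rewrite -[x ^+ 2]real_normK ?num_real // ler_pXn2r ?nnegrE //.
    apply: le_trans X2; apply: le_trans X1; nia.
  by rewrite mulr_ge0 // ?mulr_ge0; lia.
have h2 : x ^+ 2 <= (4 * a * c - b ^+ 2) * x ^+ 2.
  rewrite ler_peMl ?sqr_ge0 //; move: d0; rewrite -subr_gt0.
  by move: (4 * a * c - b ^+ 2) => t; lia.
have h3 : 0 <= (2 * c * y + b * x) ^+ 2 by exact: sqr_ge0.
have h4 : 4 * c * s ^+ 2 <= (2 * c * s) ^+ 2.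
  have -> : (2 * c * s) ^+ 2 = c * (4 * c * s ^+ 2) by ring.
  by apply: ler_peMl; [apply: mulr_ge0; [lia|exact: sqr_ge0]|lia].
by apply: le_trans h4 (le_trans h1 (le_trans h2 _)); rewrite lerDr.
Qed.

Section Lattice2.
Variable F : realFieldType.

Definition latsum (X : nat) (G : int -> int -> F) : F :=
  symsum X (fun x => symsum X (G x)).

Lemma latsumD X G H : latsum X (fun x y => G x y + H x y) = latsum X G + latsum X H.
Proof. by rewrite /latsum -symsumD; apply: eq_symsum => x; rewrite symsumD. Qed.

Lemma latsum_mulr X c G : latsum X (fun x y => c * G x y) = c * latsum X G.
Proof. by rewrite /latsum -symsum_mulr; apply: eq_symsum => x; rewrite symsum_mulr. Qed.

Lemma eq_latsum X G H : (forall x y, G x y = H x y) -> latsum X G = latsum X H.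
Proof. by move=> e; apply: eq_symsum => x; apply: eq_symsum => y. Qed.

Lemma latsum_row_bound (a b c : int) (k s : nat) : posdef (a, b, c) ->
  (1 <= s)%N -> 2 * (a + c) + 3 <= k%:Z ->
  let X := (k * s)%N in
  let B : F := ((2 * (a + c) + `|b|) * k%:Z)%:~R in
  forall y, `|y| <= X%:Z ->
  `|symsum X (fun x => (isign x)%:~R * cubp ((s%:Z ^+ 2 - bqf (a, b, c) x y)%:~R : F))|
     <= X.*2.+1%:R * (1728 * B ^+ 3 * s%:R ^+ 3).
Proof.
move=> pd s1 hk X B y hy; have [/= a0 c0 d0] := pd.
have b0 : 0 <= `|b| by [].
have B1 : 1 <= (2 * (a + c) + `|b|) * k%:Z by nia.
have s1' : 1 <= s%:Z by lia.
apply: (@alternating_row F X a b c y s%:Z (s%:Z ^+ 2) B) => //.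
- by rewrite ler1z.
- move=> x hx; apply: (@bqf_outside a b c x y s%:Z (2 * (a + c) * s%:Z)) => //.
  have : (2 * (a + c) + 3) * s%:Z <= X%:Z by rewrite /X PoszM ler_pM2r //; lia.
  lia.
- by move=> x; exact: bqf_ge0.
- move=> x hx; rewrite /B -intrM -intr_norm ler_int.
  apply: le_trans (ler_normD _ _) _; rewrite !normrM.
  have -> : `|2 : int| * `|a| = 2 * a by lia.
  have XE : X%:Z = k%:Z * s%:Z by rewrite /X PoszM.
  have h1 : 2 * a * `|x| <= 2 * (a + c) * X%:Z by apply: ler_pM => //; lia.
  have h2 : `|b| * `|y| <= `|b| * X%:Z by rewrite ler_wpM2l.
  have -> : (2 * (a + c) + `|b|) * k%:Z * s%:Z = 2 * (a + c) * X%:Z + `|b| * X%:Z.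
    by rewrite XE; ring.
  lia.
- rewrite /B -intr_norm ler_int; nia.
Qed.

(** 4 f(x, y) = f(2 x, 2 y), and the even points that fall outside the box have weight zero. *)
Lemma latsum_double (a b c : int) (X : nat) (N : int) :
  (forall x y, X%:Z < `|x| -> N <= bqf (a, b, c) x y) ->
  (forall x y, X%:Z < `|y| -> N <= bqf (a, b, c) x y) ->
  latsum X (fun x y => cubp ((N - 4 * bqf (a, b, c) x y)%:~R : F)) =
  latsum X (fun x y => if (2 %| x)%Z && (2 %| y)%Z then cubp ((N - bqf (a, b, c) x y)%:~R : F) else 0).
Proof.
move=> hx hy; pose G x y : F := cubp ((N - bqf (a, b, c) x y)%:~R : F).
have Gx x y : X%:Z < `|x| -> G x y = 0.
  by move=> h; rewrite /G cubp_neg // lerz0 subr_le0 hx.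
have Gy x y : X%:Z < `|y| -> G x y = 0.
  by move=> h; rewrite /G cubp_neg // lerz0 subr_le0 hy.
have X2 : (X <= X.*2)%N by lia.
rewrite /latsum.
transitivity (symsum X (fun x => symsum X (fun y => if (2 %| y)%Z then G (2 * x) y else 0))).
  apply: eq_symsum => x.
  transitivity (symsum X.*2 (fun y => if (2 %| y)%Z then G (2 * x) y else 0)).
    rewrite -symsum_double; apply: eq_symsum => y.
    by rewrite /G; congr (cubp _%:~R); rewrite /bqf /=; ring.
  by apply: symsum_widen => // y h; case: ifP => // _; exact: Gy.
rewrite (@symsum_double _ X (fun x => symsum X (fun y => if (2 %| y)%Z then G x y else 0))).
rewrite (@symsum_widen _ X) //; last first.
  move=> x h; case: ifP => // _; rewrite /symsum big1 // => i _.
  by case: ifP => // _; exact: Gx.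
apply: eq_symsum => x; case: ifP => // _.
by rewrite /symsum big1.
Qed.

(** The bound is [s ^ 3] for a third difference, times the number of points in a row, times the
    number of rows. It is stated for all large [k], so that finitely many forms can share one
    box. *)
Lemma lattice_sum_bound (f : int * int * int) : posdef f ->
  exists k0 : nat, forall k : nat, (k0 <= k)%N ->
  exists2 K : F, 0 <= K & forall s : nat, (1 <= s)%N ->
    (forall x y, (k * s)%:Z < `|x| \/ (k * s)%:Z < `|y| -> s%:Z ^+ 2 <= bqf f x y) /\
    `|latsum (k * s) (fun x y => cubp ((s%:Z ^+ 2 - bqf f x y)%:~R : F)
         - 4 * cubp ((s%:Z ^+ 2 - 4 * bqf f x y)%:~R : F))| <= K * s%:R ^+ 5.
Proof.
move: f => [[a b] c] pd; have [/= a0 c0 d0] := pd.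
(* [2 * (a + c)] clears the ellipse and 3 makes room for the zero weights that [alternating_row]
   needs at both ends. *)
exists (absz (2 * (a + c) + 3)) => k hk.
have {}hk : 2 * (a + c) + 3 <= k%:Z by lia.
pose B : F := ((2 * (a + c) + `|b|) * k%:Z)%:~R.
have B0 : 0 <= B by rewrite ler0z mulr_ge0 // addr_ge0 //; lia.
exists (3 * (9 * k%:R ^+ 2 * (1728 * B ^+ 3))).
  by rewrite !mulr_ge0 ?exprn_ge0.
move=> s s1; set X := (k * s)%N; set N := s%:Z ^+ 2.
have XE : X%:Z = k%:Z * s%:Z by rewrite /X PoszM.
have Xbig : (2 * (a + c) + 3) * s%:Z <= X%:Z by rewrite XE ler_pM2r; lia.
have outx x y : X%:Z < `|x| -> N <= bqf (a, b, c) x y.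
  move=> hx; apply: (@bqf_outside a b c x y s%:Z (2 * (a + c) * s%:Z)) => //; lia.
have outy x y : X%:Z < `|y| -> N <= bqf (a, b, c) x y.
  move=> hy; rewrite bqf_swap.
  apply: (@bqf_outside c b a y x s%:Z (2 * (c + a) * s%:Z)); try lia.
  exact: posdef_swap.
split; first by move=> x y [h|h]; [exact: outx|exact: outy].
pose G x y : F := cubp ((N - bqf (a, b, c) x y)%:~R : F).
pose T1 := latsum X (fun x y => (isign x)%:~R * G x y).
pose T2 := latsum X (fun x y => (isign y)%:~R * G x y).
pose T3 := latsum X (fun x y => (isign y)%:~R * ((isign x)%:~R * G x y)).
(* With e for the sign, (1 + e(x)) (1 + e(y)) / 4 is the indicator of the even points; so 1 minus 4
   times this indicator is -(e(x) + e(y) + e(x) e(y)). Each of the three sums is then bounded row by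
   row, in a direction along which its sign alternates. *)
have -> : latsum X (fun x y => cubp ((N - bqf (a, b, c) x y)%:~R : F)
         - 4 * cubp ((N - 4 * bqf (a, b, c) x y)%:~R : F)) = - (T1 + T2 + T3).
  transitivity (latsum X G + - 4 * latsum X (fun x y => cubp ((N - 4 * bqf (a, b, c) x y)%:~R : F))).
    by rewrite -latsum_mulr -latsumD; apply: eq_latsum => x y; rewrite mulNr.
  rewrite latsum_double // -latsum_mulr -latsumD /T1 /T2 /T3 -[RHS]mulN1r.
  rewrite -[in RHS]latsumD -[in RHS]latsumD -[in RHS]latsum_mulr.
  apply: eq_latsum => x y.
  rewrite -/(G x y) /isign.
  case: (2 %| x)%Z; case: (2 %| y)%Z => /=; rewrite ?rmorphN ?rmorph1; ring.
pose R := X.*2.+1%:R * (1728 * B ^+ 3 * s%:R ^+ 3) : F.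
have b1 : `|T1| <= X.*2.+1%:R * R.
  rewrite /T1 /latsum exchange_symsum; apply: norm_symsum => y hy.
  exact: latsum_row_bound.
have b2 : `|T2| <= X.*2.+1%:R * R.
  apply: norm_symsum => x hx.
  rewrite /R /B (addrC a c).
  rewrite (_ : symsum _ _ = symsum X (fun y => (isign y)%:~R * cubp ((s%:Z ^+ 2 - bqf (c, b, a) y x)%:~R : F))).
    by apply: latsum_row_bound => //; [exact: posdef_swap|lia].
  by apply: eq_symsum => y; rewrite /G bqf_swap.
have b3 : `|T3| <= X.*2.+1%:R * R.
  rewrite /T3 /latsum exchange_symsum; apply: norm_symsum => y hy.
  rewrite symsum_mulr normrM.
  have -> : `|(isign y)%:~R : F| = 1 by rewrite /isign; case: ifP; rewrite ?normrN1 ?normr1.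
  by rewrite mul1r; exact: latsum_row_bound.
rewrite normrN.
apply: (@le_trans _ _ (3 * (X.*2.+1%:R * R))).
  have := ler_normD (T1 + T2) T3; have := ler_normD T1 T2; lra.
have h3 : (X.*2.+1%:R : F) <= 3 * (k%:R * s%:R).
  by rewrite -!natrM ler_nat; nia.
have s0 : 0 <= (s%:R : F) by [].
have -> : 3 * (9 * k%:R ^+ 2 * (1728 * B ^+ 3)) * s%:R ^+ 5 =
   3 * ((3 * (k%:R * s%:R)) * ((3 * (k%:R * s%:R)) * (1728 * B ^+ 3 * s%:R ^+ 3))) :> F by ring.
have q0 : 0 <= 1728 * B ^+ 3 * s%:R ^+ 3 by rewrite !mulr_ge0 ?exprn_ge0.
rewrite ler_pM2l // /R; apply: ler_pM => //; first by rewrite mulr_ge0.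
exact: ler_wpM2r.
Qed.

End Lattice2.

(** * Summation by parts and periodic sequences of sum zero *)

Lemma abel_summation (F : pzRingType) (n : nat) (g phi : nat -> F) :
  \sum_(i < n) g i * phi i =
  \sum_(i < n) (\sum_(j < i.+1) g j) * (phi i - phi i.+1) + (\sum_(j < n) g j) * phi n.
Proof.
elim: n => [|n IH]; first by rewrite !big_ord0 mul0r addr0.
rewrite big_ord_recr /= IH [in RHS]big_ord_recr /= -!addrA; congr (_ + _).
by rewrite -mulrDr subrK big_ord_recr /= mulrDl.
Qed.

Lemma telescope_ord (F : zmodType) (n : nat) (phi : nat -> F) :
  \sum_(i < n) (phi i - phi i.+1) = phi 0%N - phi n.
Proof.
elim: n => [|n IH]; first by rewrite big_ord0 subrr.
by rewrite big_ord_recr /= IH addrA subrK.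
Qed.

Lemma big_ord_cut (F : nmodType) (a n : nat) (f : nat -> F) : (a <= n)%N ->
  \sum_(i < n) f i = \sum_(i < a) f i + \sum_(i < n - a) f (a + i)%N.
Proof.
move=> an; have [b ->] : exists b, n = (a + b)%N by exists (n - a)%N; rewrite subnKC.
by rewrite addKn big_split_ord.
Qed.

Section Periodic.
Variables (F : realFieldType) (P : nat) (g : nat -> F) (b : F).
Hypothesis P0 : (0 < P)%N.
Hypothesis gper : forall d, g (d + P)%N = g d.
Hypothesis gb : forall d, `|g d| <= b.
Hypothesis gsum : \sum_(i < P) g i = 0.

Lemma periodic_mul m d : g (m * P + d)%N = g d.
Proof. by elim: m d => [|m IH] d //; rewrite mulSn -addnA addnC gper IH. Qed.

Lemma partial_sum_mul m d : \sum_(i < m * P + d) g i = \sum_(i < d) g i.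
Proof.
elim: m => [|m IH]; first by rewrite mul0n.
rewrite mulSn -addnA big_split_ord /= gsum add0r -[RHS]IH.
by apply: eq_bigr => i _; rewrite addnC gper.
Qed.

Lemma partial_sum_bound d : `|\sum_(i < d) g i| <= P%:R * b.
Proof.
rewrite (divn_eq d P) partial_sum_mul.
apply: le_trans (ler_norm_sum _ _ _) _.
apply: (@le_trans _ _ (\sum_(i < d %% P) b)); first exact: ler_sum.
rewrite sumr_const card_ord -[leLHS]mulr_natl ler_wpM2r //.
  by apply: le_trans (gb 0%N).
by rewrite ler_nat ltnW // ltn_pmod.
Qed.

End Periodic.

(** * Character sums against the truncated cube *)

Section CharacterSum.
Variables (F : realFieldType) (chi : nat -> F) (P : nat).
Hypothesis P0 : (0 < P)%N.
Hypothesis chi_per : forall d, chi (d + P)%N = chi d.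
Hypothesis chi_le1 : forall d, `|chi d| <= 1.
Hypothesis chi_sum : \sum_(i < P) chi i.+1 = 0.

Let C d := \sum_(i < d) chi i.+1.
(** This is the value of L(0, chi): by [char_mean_linear] it equals -(1/P) times the sum of i chi(i)
    over a period. *)
Definition char_mean : F := (\sum_(j < P) \sum_(i < j.+1) chi i.+1) / P%:R.
Let c := char_mean.

Let chiS_per d : chi (d + P).+1 = chi d.+1.
Proof. by rewrite -addSn chi_per. Qed.

Lemma partial_char_bound d : `|\sum_(i < d) chi i.+1| <= P%:R.
Proof.
rewrite -[leRHS]mulr1.
exact: (@partial_sum_bound F P (fun i => chi i.+1) 1).
Qed.

Lemma partial_char_per d : \sum_(i < d + P) chi i.+1 = \sum_(i < d) chi i.+1.
Proof.
have -> : (d + P = 1 * P + d)%N by rewrite mul1n addnC.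
by rewrite (@partial_sum_mul F P (fun i => chi i.+1)).
Qed.

Lemma partial_char_mul m : \sum_(i < m * P) chi i.+1 = 0.
Proof.
by rewrite -[(m * P)%N]addn0 (@partial_sum_mul F P (fun i => chi i.+1)) // big_ord0.
Qed.

Lemma char_mean_bound : `|char_mean| <= P%:R.
Proof.
have PF : 0 < (P%:R : F) by rewrite ltr0n.
rewrite /char_mean normrM normfV normr_nat ler_pdivrMr //.
apply: le_trans (ler_norm_sum _ _ _) _.
apply: (@le_trans _ _ (\sum_(i < P) P%:R)).
  by apply: ler_sum => i _; exact: partial_char_bound.
by rewrite sumr_const card_ord mulr_natl.
Qed.

(** A first summation by parts produces the partial sums of [chi]. Once their mean is subtracted
    they are again periodic with sum zero, so a second summation by parts applies; by convexity the
    differences it involves are nonnegative and telescope to [phi 0 - phi 1]. *)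
Lemma char_sum_convex (n : nat) (phi : nat -> F) :
  (forall i, 0 <= phi i - 2 * phi i.+1 + phi i.+2) -> phi n = 0 -> phi n.+1 = 0 ->
  `|\sum_(i < n) chi i.+1 * phi i - c * phi 0%N|
     <= P%:R * (2 * P%:R) * (phi 0%N - phi 1%N).
Proof.
move=> conv pn pn1.
pose e i := C i.+1 - c.
have PF : (P%:R : F) != 0 by rewrite pnatr_eq0 -lt0n.
rewrite (@abel_summation F n (fun i => chi i.+1)) pn mulr0 addr0.
have -> : \sum_(i < n) (\sum_(j < i.+1) chi j.+1) * (phi i - phi i.+1) - c * phi 0%N =
   \sum_(i < n) e i * (phi i - phi i.+1).
  have <- : c * (\sum_(i < n) (phi i - phi i.+1)) = c * phi 0%N.
    by rewrite telescope_ord pn subr0.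
  rewrite mulr_sumr -sumrB; apply: eq_bigr => i _.
  by rewrite /e /C mulrBl.
pose d i := phi i - phi i.+1.
have dd i : 0 <= d i - d i.+1 by have := conv i; rewrite /d; lra.
have Eb k : `|\sum_(j < k) e j| <= P%:R * (2 * P%:R).
  apply: (@partial_sum_bound F P e) => //.
  - by move=> i; rewrite /e /C -addSn partial_char_per.
  - move=> i; apply: le_trans (ler_normB _ _) _.
    by have := partial_char_bound i.+1; have := char_mean_bound; rewrite -/c -/(C _); lra.
  - rewrite sumrB sumr_const card_ord /c /char_mean -[_ *+ P]mulr_natl mulrC divfK //.
    by rewrite subrr.
have dn : d n = 0 by rewrite /d pn pn1 subrr.
rewrite (@abel_summation F n e d) dn mulr0 addr0.
apply: le_trans (ler_norm_sum _ _ _) _.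
apply: (@le_trans _ _ (\sum_(i < n) P%:R * (2 * P%:R) * (d i - d i.+1))).
  by apply: ler_sum => i _; rewrite normrM (ger0_norm (dd i)) ler_wpM2r.
by rewrite -mulr_sumr telescope_ord dn subr0.
Qed.

Lemma char_sum_linear m :
  `|\sum_(i < m * P) chi i.+1 * i.+1%:R| <= (m * P)%:R * P%:R.
Proof.
rewrite (@abel_summation F _ (fun i => chi i.+1) (fun i => i.+1%:R)) partial_char_mul mul0r addr0.
apply: le_trans (ler_norm_sum _ _ _) _.
apply: (@le_trans _ _ (\sum_(i < m * P) P%:R)).
  apply: ler_sum => i _; rewrite normrM -[i.+2%:R]natr1 opprD addrA subrr sub0r normrN1 mulr1.
  exact: partial_char_bound.
by rewrite sumr_const card_ord mulr_natl.
Qed.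

Variable N : nat.
Let psi (n : nat) : F := cubp (N%:R - n%:R).

(** The sum over all multiples of [v] from [v] on, starting with a plus sign; [N] terms suffice
    because [psi] vanishes from [N] on. *)
Definition alt_psi_sum (v : nat) : F := \sum_(k < N) (-1) ^+ k * psi (v * k.+1).

Let psi0 n : (N <= n)%N -> psi n = 0.
Proof. by move=> h; rewrite /psi cubp_neg // subr_le0 ler_nat. Qed.

(** Two alternating summations by parts produce the terms in [N ^ 3] and [N ^ 2 * v] and leave an
    alternating sum of second differences. These are nonnegative and decreasing, so what is left
    lies between 0 and the first of them, which is of order [N * v ^ 2]. *)
Lemma alt_psi_sum_expansion (v : nat) : (0 < v)%N -> (2 * v <= N)%N ->
  `|4 * alt_psi_sum v - 2 * N%:R ^+ 3 + 3 * N%:R ^+ 2 * v%:R| <= 9 * N%:R * v%:R ^+ 2.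
Proof.
move=> v0 vN.
pose phi k := psi (v * k); pose d1 k := phi k - phi k.+1; pose d2 k := d1 k - d1 k.+1.
have big k : (N <= k)%N -> phi k = 0 by move=> h; apply: psi0; nia.
have phiE k i : phi (i + k)%N = cubp ((N%:R - (v * i)%:R) - k%:R * v%:R).
  by rewrite /phi /psi; congr cubp; rewrite mulnDr natrD !natrM; ring.
have q1 k : phi k.+1 = cubp (N%:R - (v * k)%:R - v%:R) by rewrite -addn1 phiE mul1r.
have q2 k : phi k.+2 = cubp (N%:R - (v * k)%:R - 2 * v%:R) by rewrite -addn2 phiE.
have q3 k : phi k.+3 = cubp (N%:R - (v * k)%:R - 3 * v%:R) by rewrite -addn3 phiE.
have vF : 0 <= (v%:R : F) by [].
have /andP[h1 h2] : 0 <= \sum_(k < N.+1) (-1) ^+ k * d2 k <= d2 0%N.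
  apply: alternating_decreasing => k.
    have := @cubp_diff2 F (N%:R - (v * k)%:R) v%:R vF.
    by rewrite /d2 /d1 (q2 k) (q1 k) /phi /psi; lra.
  have := @cubp_diff3 F (N%:R - (v * k)%:R) v%:R vF.
  by rewrite /d2 /d1 (q3 k) (q2 k) (q1 k) /phi /psi; lra.
have AE : \sum_(i < N.+1) (-1) ^+ i * phi i = N%:R ^+ 3 - alt_psi_sum v.
  rewrite big_ord_recl /= expr0 mul1r {1}/phi muln0 /psi subr0 cubp_pos // /alt_psi_sum.
  congr (_ + _); rewrite -sumrN; apply: eq_bigr => i _.
  by rewrite /bump /= add1n exprS mulN1r mulNr.
have pN : phi N.+1 = 0 by apply: big; lia.
have dN : d1 N.+1 = 0 by rewrite /d1 !big ?subrr //; lia.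
have E2 : \sum_(i < N.+1) (-1) ^+ i * d2 i = 2 * (\sum_(i < N.+1) (-1) ^+ i * d1 i) - d1 0%N.
  by rewrite /d2 alternating_abel dN mulr0 addr0.
have E1 : \sum_(i < N.+1) (-1) ^+ i * d1 i = 2 * (N%:R ^+ 3 - alt_psi_sum v) - phi 0%N.
  by rewrite /d1 alternating_abel AE pN mulr0 addr0.
have p0 : phi 0%N = N%:R ^+ 3 by rewrite /phi muln0 /psi subr0 cubp_pos.
have vN' : 2 * (v%:R : F) <= N%:R by rewrite -natrM ler_nat.
have p1 : phi 1%N = (N%:R - v%:R) ^+ 3 by rewrite /phi muln1 /psi cubp_pos // subr_ge0; lra.
have p2 : phi 2%N = (N%:R - 2 * v%:R) ^+ 3.
  by rewrite /phi mulnC /psi natrM cubp_pos // subr_ge0.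
have {}E2 : \sum_(i < N.+1) (-1) ^+ i * d2 i =
   2 * N%:R ^+ 3 - 4 * alt_psi_sum v - (N%:R ^+ 3 - (N%:R - v%:R) ^+ 3).
  by rewrite E2 E1 /d1 p0 p1; ring.
rewrite E2 in h1 h2.
rewrite /d2 /d1 p0 p1 p2 in h2.
move: h1 h2; set S := alt_psi_sum v; move: (N%:R : F) (v%:R : F) S vN' vF => n w S nw w0 h1 h2.
have w2n : 0 <= w ^+ 2 * (n - 2 * w) by rewrite mulr_ge0 ?sqr_ge0 //; lra.
have w3 : 0 <= w ^+ 3 by exact: exprn_ge0.
by rewrite ler_norml; apply/andP; split; lra.
Qed.

Definition double_char_sum (j : nat) : F :=
  \sum_(d < N) \sum_(k < N) chi d.+1 * ((-1) ^+ k * psi (j * d.+1 * k.+1)).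

(** For small divisors the inner alternating sum is expanded. Over whole periods the term in [N ^ 3]
    disappears with the sum of [chi], and the linear term is controlled by [char_sum_linear];
    nothing of order [N ^ 3] survives. *)
Lemma near_bound (j m : nat) : (0 < j)%N -> (2 * (j * (m * P)) <= N)%N ->
  `|4 * (\sum_(d < m * P) chi d.+1 * alt_psi_sum (j * d.+1))| <=
    9 * N%:R * j%:R ^+ 2 * (m * P)%:R ^+ 3 + 3 * N%:R ^+ 2 * j%:R * ((m * P)%:R * P%:R).
Proof.
move=> j0 jN; set D0 := (m * P)%N.
have -> : 4 * (\sum_(d < D0) chi d.+1 * alt_psi_sum (j * d.+1)) =
  \sum_(d < D0) chi d.+1 * (4 * alt_psi_sum (j * d.+1) - 2 * N%:R ^+ 3 + 3 * N%:R ^+ 2 * (j * d.+1)%:R)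
  - (3 * N%:R ^+ 2 * j%:R) * (\sum_(d < D0) chi d.+1 * d.+1%:R)
  + 2 * N%:R ^+ 3 * (\sum_(d < D0) chi d.+1).
  rewrite !mulr_sumr -sumrB -big_split /=; apply: eq_bigr => i _.
  by rewrite natrM; ring.
rewrite partial_char_mul mulr0 addr0.
apply: le_trans (ler_normB _ _) _; apply: lerD; last first.
  rewrite normrM ger0_norm; last by rewrite !mulr_ge0 ?exprn_ge0.
  by apply: ler_wpM2l; [rewrite !mulr_ge0 ?exprn_ge0|exact: char_sum_linear].
apply: le_trans (ler_norm_sum _ _ _) _.
apply: (@le_trans _ _ (\sum_(i < D0) (9 * N%:R * j%:R ^+ 2 * D0%:R ^+ 2))); last first.
  by rewrite sumr_const card_ord -mulr_natl le_eqVlt; apply/orP; left; apply/eqP; ring.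
apply: ler_sum => i _; rewrite normrM -[leRHS]mul1r.
apply: ler_pM => //.
have iD : (i.+1 <= D0)%N by exact: ltn_ord.
apply: le_trans (alt_psi_sum_expansion _ _) _; first by rewrite muln_gt0 j0.
  by apply: leq_trans jN; rewrite leq_mul2l /= leq_mul2l iD orbT.
rewrite natrM exprMn mulrA ler_wpM2l ?mulr_ge0 ?exprn_ge0 //.
by rewrite ler_pXn2r ?nnegrE // ler_nat.
Qed.

(** For large divisors the order of summation is exchanged: at fixed [k] the weight is convex in the
    divisor, so [char_sum_convex] replaces the sum by [c] times its first term. Collected over [k],
    these first terms form one alternating sum, which carries the main term. *)
Lemma far_bound (j m ka : nat) : (0 < j)%N -> (0 < m)%N -> N = (ka * (m * P))%N ->
  (m * P <= N)%N ->
  `|\sum_(k < N) (-1) ^+ k * (\sum_(i < N - m * P) chi i.+1 * psi (j * (m * P + i).+1 * k.+1))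
     - c * alt_psi_sum (j * (m * P).+1)| <=
    6 * P%:R ^+ 2 * N%:R ^+ 2 * j%:R * ka%:R ^+ 2.
Proof.
move=> j0 m0 NE D0N; set D0 := (m * P)%N in NE D0N *.
have D00 : (0 < D0)%N by rewrite muln_gt0 m0.
have NE2 : (N <= ka * D0)%N by rewrite -NE.
rewrite /alt_psi_sum mulr_sumr -sumrB.
apply: le_trans (ler_norm_sum _ _ _) _.
(* From [ka] on, the argument of [psi] exceeds [ka * D0 = N] already at the first divisor, so the
   whole summand vanishes. *)
pose bd k : F := if (k < ka)%N then 6 * P%:R ^+ 2 * N%:R ^+ 2 * j%:R * ka%:R else 0.
apply: (@le_trans _ _ (\sum_(k < N) bd k)); last first.
  have kaN : (ka <= N)%N by rewrite NE; nia.
  rewrite /bd -big_mkcond /=.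
  rewrite -(big_ord_widen N (fun=> 6 * P%:R ^+ 2 * N%:R ^+ 2 * j%:R * ka%:R) kaN).
  by rewrite sumr_const card_ord -mulr_natl le_eqVlt; apply/orP; left; apply/eqP; ring.
apply: ler_sum => k _.
have -> : (-1) ^+ k * (\sum_(i < N - D0) chi i.+1 * psi (j * (D0 + i).+1 * k.+1)) -
    c * ((-1) ^+ k * psi (j * D0.+1 * k.+1)) =
  (-1) ^+ k * ((\sum_(i < N - D0) chi i.+1 * psi (j * (D0 + i).+1 * k.+1)) -
    c * psi (j * D0.+1 * k.+1)) by ring.
rewrite normrM normrX normrN1 expr1n mul1r.
pose phi i := psi (j * (D0 + i).+1 * k.+1).
pose w : F := (j * k.+1)%:R.
have w0 : 0 <= w by [].
have phiE i l : phi (i + l)%N = cubp (N%:R - (j * (D0 + i).+1 * k.+1)%:R - l%:R * w).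
  rewrite /phi /psi /w -natrM -addrA -opprD -natrD; congr (cubp (_ - _%:R)).
  by rewrite addnA -addSn; ring.
have q1 l : phi l.+1 = cubp (N%:R - (j * (D0 + l).+1 * k.+1)%:R - w) by rewrite -addn1 phiE mul1r.
have q2 l : phi l.+2 = cubp (N%:R - (j * (D0 + l).+1 * k.+1)%:R - 2 * w) by rewrite -addn2 phiE.
have zero i : (N <= D0 + i)%N -> phi i = 0.
  by move=> h; apply: psi0; apply: leq_trans h _; nia.
have H := @char_sum_convex (N - D0) phi.
have phi00 : phi 0%N = psi (j * D0.+1 * k.+1) by rewrite /phi addn0.
rewrite -phi00.
apply: le_trans (H _ _ _) _; try (by apply: zero; lia).
  move=> i; have := @cubp_diff2 F (N%:R - (j * (D0 + i).+1 * k.+1)%:R) w w0.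
  by rewrite (q2 i) (q1 i).
rewrite /bd; case: ifP => kka; last first.
  have -> : phi 0%N = 0.
    by apply: psi0; rewrite addn0; apply: leq_trans NE2 _; nia.
  have -> : phi 1%N = 0 by apply: psi0; apply: leq_trans NE2 _; nia.
  by rewrite subrr mulr0.
have -> : 6 * P%:R ^+ 2 * N%:R ^+ 2 * j%:R * ka%:R = P%:R * (2 * P%:R) * (3 * N%:R ^+ 2 * (j * ka)%:R) :> F.
  by rewrite natrM; ring.
rewrite ler_wpM2l ?mulr_ge0 //.
have -> : phi 1%N = cubp (N%:R - (j * (D0 + 0).+1 * k.+1)%:R - w) by rewrite (phiE 0%N 1%N) mul1r.
rewrite /phi /psi; set u := N%:R - _.
have wka : w <= (j * ka)%:R by rewrite ler_nat leq_mul2l kka orbT.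
have [u0|u0] := leP u 0.
  rewrite !cubp_neg ?subrr ?mulr_ge0 ?exprn_ge0 //.
  lra.
apply: le_trans (cubp_le_diff (ltW u0) w0) _.
apply: ler_pM => //; first by rewrite mulr_ge0 ?exprn_ge0 // ltW.
rewrite ler_wpM2l // ler_pXn2r ?nnegrE //; last exact: ltW.
by rewrite /u gerBl.
Qed.

(** Dirichlet's hyperbola method, cut after a whole number of periods. The main term [c * N ^ 3 / 2]
    is that of [alt_psi_sum] at [j * D0.+1]. *)
Lemma double_char_sum_bound (j m ka : nat) : (0 < j)%N -> (0 < m)%N ->
  N = (ka * (m * P))%N -> (2 * (j * (m * P).+1) <= N)%N ->
  `|4 * double_char_sum j - 2 * c * N%:R ^+ 3| <=
    9 * N%:R * j%:R ^+ 2 * (m * P)%:R ^+ 3 + 3 * N%:R ^+ 2 * j%:R * ((m * P)%:R * P%:R)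
    + 4 * (6 * P%:R ^+ 2 * N%:R ^+ 2 * j%:R * ka%:R ^+ 2)
    + P%:R * (9 * N%:R * (j * (m * P).+1)%:R ^+ 2 + 3 * N%:R ^+ 2 * (j * (m * P).+1)%:R).
Proof.
move=> j0 m0 NE jN; set D0 := (m * P)%N in NE jN *.
have D0N : (D0 <= N)%N by nia.
have D00 : (0 < D0)%N by rewrite muln_gt0 m0.
have near := @near_bound j m j0; rewrite -/D0 in near.
have {}near := near ltac:(nia).
have far := @far_bound j m ka j0 m0 NE D0N; rewrite -/D0 in far.
have ex := @alt_psi_sum_expansion (j * D0.+1) ltac:(nia) jN.
set S1 := \sum_(d < D0) _ in near; set S2 := \sum_(k < N) _ in far.
have -> : double_char_sum j = S1 + S2.
  rewrite /double_char_sum (big_ord_cut (fun d => \sum_(k < N) chi d.+1 * ((-1) ^+ k * psi (j * d.+1 * k.+1))) D0N) /=; congr (_ + _).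
    by apply: eq_bigr => d _; rewrite /alt_psi_sum mulr_sumr.
  rewrite exchange_big /=; apply: eq_bigr => k _; rewrite mulr_sumr; apply: eq_bigr => i _.
  have -> : chi (D0 + i).+1 = chi i.+1 by rewrite -addnS (@periodic_mul F P chi).
  by rewrite mulrCA.
have cb := char_mean_bound; rewrite -/c in cb.
set A := alt_psi_sum _ in far ex.
have -> : 4 * (S1 + S2) - 2 * c * N%:R ^+ 3 = 4 * S1 + 4 * (S2 - c * A)
  + c * ((4 * A - 2 * N%:R ^+ 3 + 3 * N%:R ^+ 2 * (j * D0.+1)%:R) - 3 * N%:R ^+ 2 * (j * D0.+1)%:R).
  by ring.
apply: le_trans (ler_normD _ _) _; apply: lerD.
  apply: le_trans (ler_normD _ _) _; apply: lerD => //.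
  by rewrite normrM ger0_norm // ler_wpM2l.
rewrite normrM; apply: ler_pM => //.
apply: le_trans (ler_normB _ _) _; apply: lerD => //.
by rewrite ger0_norm // !mulr_ge0 ?exprn_ge0.
Qed.

End CharacterSum.

(** * Representation numbers and the limit *)

Definition rep_number (X : nat) (f : int * int * int) (n : nat) : nat :=
  symsum X (fun x => symsum X (fun y => ((bqf f x y == n%:Z) : nat))).

Lemma big_ord_shift (F : nmodType) (N : nat) (f : nat -> F) : (0 < N)%N -> f N = 0 ->
  \sum_(n < N) f n = f 0%N + \sum_(n < N) f n.+1.
Proof.
by case: N => // N _ fN; rewrite big_ord_recl [in RHS]big_ord_recr /= fN addr0.
Qed.

Lemma alternating_sum_even (F : comNzRingType) (N : nat) (phi : nat -> F) :
  (forall n, (N <= n)%N -> phi n = 0) ->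
  \sum_(k < N) (-1) ^+ k * phi k.+1 =
  \sum_(k < N) phi k.+1 - 2 * \sum_(k < N) phi (2 * k.+1)%N.
Proof.
move=> phi0.
have E n : \sum_(k < n.*2) (-1) ^+ k * phi k.+1 =
  \sum_(k < n.*2) phi k.+1 - 2 * \sum_(k < n) phi (2 * k.+1)%N.
  elim: n => [|n IH]; first by rewrite !big_ord0; ring.
  rewrite doubleS !big_ord_recr /= IH exprS -signr_odd odd_double.
  by rewrite mul2n doubleS; ring.
have NN : (N <= N.*2)%N by rewrite -addnn leq_addr.
have cut (g : nat -> F) : (forall n, (N <= n)%N -> g n = 0) ->
    \sum_(k < N) g k = \sum_(k < N.*2) g k.
  move=> g0; rewrite (big_ord_cut g NN) [X in _ + X]big1 ?addr0 // => i _.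
  by rewrite g0 // leq_addr.
rewrite (cut (fun k => (-1) ^+ k * phi k.+1)).
  by rewrite E (cut (fun k => phi k.+1)) // => n h; apply: phi0; exact: ltnW.
by move=> n h; rewrite phi0 ?mulr0 // ltnW.
Qed.

Lemma sum_divisors (F : nmodType) (N n : nat) (g : nat -> F) : (0 < n <= N)%N ->
  \sum_(d <- divisors n) g d = \sum_(d < N) (if (d.+1 %| n)%N then g d.+1 else 0).
Proof.
case/andP=> n0 nN.
rewrite -(big_mkord xpredT (fun d => if (d.+1 %| n)%N then g d.+1 else 0)).
have -> : \sum_(0 <= d < N) (if (d.+1 %| n)%N then g d.+1 else 0) =
          \sum_(1 <= d < N.+1) (if (d %| n)%N then g d else 0).
  by rewrite [RHS]big_add1.
rewrite -big_mkcond -big_filter; apply: perm_big; apply: uniq_perm.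
- exact: divisors_uniq.
- by rewrite filter_uniq // iota_uniq.
move=> d; rewrite -dvdn_divisors // mem_filter mem_index_iota andbC.
case: (boolP (d %| n)%N) => [dn|]; rewrite ?andbF // andbT.
by rewrite (dvdn_gt0 n0 dn) ltnS (leq_trans (dvdn_leq n0 dn) nN).
Qed.

Lemma sum_dirichlet (F : comNzRingType) (N : nat) (chi g : nat -> F) :
  (forall n, (N <= n)%N -> g n = 0) ->
  \sum_(n < N) (\sum_(d <- divisors n.+1) chi d) * g n.+1 =
  \sum_(d < N) \sum_(k < N) chi d.+1 * g (d.+1 * k.+1)%N.
Proof.
move=> g0.
transitivity (\sum_(n < N) \sum_(d < N) \sum_(k < N)
   (if (d.+1 * k.+1 == n.+1)%N then chi d.+1 * g (d.+1 * k.+1)%N else 0)).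
  apply: eq_bigr => n _; rewrite (@sum_divisors _ N) ?ltn_ord // mulr_suml.
  apply: eq_bigr => d _; case: ifP => [/dvdnP[q qE]|ndv].
    have q0 : (0 < q)%N by case: q qE => // /eqP; rewrite mul0n.
    have qN : (q.-1 < N)%N.
      by rewrite prednK //; apply: leq_trans (ltn_ord n); rewrite qE leq_pmulr.
    rewrite (bigD1 (Ordinal qN)) //= prednK // mulnC -qE eqxx big1 ?addr0 //.
    move=> k kq; case: ifP => // /eqP e; case/negP: kq; apply/eqP/val_inj => /=.
    by have := e; rewrite qE mulnC => /eqP; rewrite eqn_pmul2r // => /eqP <-.
  rewrite mul0r big1 // => k _; case: ifP => // /eqP e.
  by rewrite -e dvdn_mulr in ndv.
rewrite exchange_big /=; apply: eq_bigr => d _.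
rewrite exchange_big /=; apply: eq_bigr => k _.
have : (0 < d.+1 * k.+1)%N by [].
move: (d.+1 * k.+1)%N => [//|m] _; have [le|gt] := ltnP m N.
  rewrite (bigD1 (Ordinal le)) //= eqxx big1 ?addr0 //.
  move=> n nk; case: ifP => // /eqP [e]; case/negP: nk; apply/eqP/val_inj => /=.
  by rewrite e.
rewrite g0; last by lia.
by rewrite mulr0 big1 // => n _; case: ifP.
Qed.

Lemma sum_rep_number (F : pzRingType) (X N : nat) (f : int * int * int) (g : int -> F) :
  (forall x y, 0 <= bqf f x y) -> (forall n, N%:Z <= n -> g n = 0) ->
  symsum X (fun x => symsum X (fun y => g (bqf f x y))) =
  \sum_(n < N) (rep_number X f n)%:R * g n%:Z.
Proof.
move=> f0 g0; rewrite /rep_number /symsum.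
transitivity (\sum_(i < X.*2.+1) \sum_(i' < X.*2.+1) \sum_(n < N)
   ((bqf f (i%:Z - X%:Z) (i'%:Z - X%:Z) == n%:Z) : nat)%:R * g n%:Z).
  apply: eq_bigr => i _; apply: eq_bigr => i' _.
  set b := bqf _ _ _; have b0 : 0 <= b by exact: f0.
  have [bN|Nb] := ltP b N%:Z.
    have bN' : (`|b| < N)%N by lia.
    rewrite (bigD1 (Ordinal bN')) //= gez0_abs // eqxx mul1r big1 ?addr0 //.
    move=> n nb; have -> : (b == n%:Z) = false; last by rewrite mul0r.
    by apply/negP => /eqP bn; case/negP: nb; apply/eqP/val_inj => /=; lia.
  rewrite g0 // big1 // => n _; have -> : (b == n%:Z) = false; last by rewrite mul0r.
  by have := ltn_ord n; lia.
rewrite [RHS](eq_bigr (fun n : 'I_N => \sum_(i < X.*2.+1) \sum_(i' < X.*2.+1)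
   ((bqf f (i%:Z - X%:Z) (i'%:Z - X%:Z) == n%:Z) : nat)%:R * g n%:Z)).
  by rewrite [RHS]exchange_big /=; apply: eq_bigr => i _; rewrite [RHS]exchange_big.
move=> n _; rewrite natr_sum mulr_suml; apply: eq_bigr => i _.
by rewrite natr_sum mulr_suml.
Qed.

Lemma bqf_eq0 f x y : posdef f -> (bqf f x y == 0) = (x == 0) && (y == 0).
Proof.
move: f => [[a b] c] pd; have [/= a0 c0 d0] := pd.
apply/idP/andP => [/eqP h|[/eqP-> /eqP->]]; last by rewrite /bqf /= expr0n /= !mulr0.
have e : (2 * a * x + b * y) ^+ 2 + (4 * a * c - b ^+ 2) * y ^+ 2 = 0.
  by rewrite -[RHS](mulr0 (4 * a)) -h /bqf /=; ring.
have y0 : y = 0.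
  move/eqP: e; rewrite paddr_eq0 ?sqr_ge0 //; last by rewrite mulr_ge0 ?sqr_ge0 // subr_ge0 ltW.
  case/andP=> _; rewrite mulf_eq0 subr_eq0 [_ == b ^+ 2]eq_sym (lt_eqF d0) /=.
  by rewrite sqrf_eq0 => /eqP.
move: h; rewrite /bqf /= y0 expr0n /= !mulr0 !addr0 => /eqP.
by rewrite mulf_eq0 (gt_eqF a0) /= sqrf_eq0 eqxx => ->.
Qed.

Lemma rep_number0 X f : posdef f -> rep_number X f 0 = 1%N.
Proof.
move=> pd; rewrite /rep_number.
rewrite (@symsum_widen _ 0) // ?symsum0; last first.
  move=> x x0; rewrite /symsum big1 // => i _; rewrite bqf_eq0 //.
  by have -> : (x == 0) = false by lia.
rewrite (@symsum_widen _ 0) // ?symsum0 ?bqf_eq0 // => y y0.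
by rewrite bqf_eq0 //; have -> : (y == 0) = false by lia; rewrite andbF.
Qed.

Section MeanOfRepresentations.
Variable F : archiRealFieldType.

Lemma tail_term_mono (q n a a' b b' : F) : 0 <= q -> 0 <= n -> a <= a' -> b <= b' ->
  q * (9 * n * a + 3 * n ^+ 2 * b) <= q * (9 * n * a' + 3 * n ^+ 2 * b').
Proof.
move=> q0 n0 aa bb; apply: ler_wpM2l => //; apply: lerD; apply: ler_wpM2l => //.
  exact: mulr_ge0.
by apply: mulr_ge0 => //; exact: exprn_ge0.
Qed.

Lemma five_terms_mono (c1 c2 c3 c4 c5 y z w : F) :
  0 <= c2 -> 0 <= c4 -> 0 <= c5 -> z <= y -> w <= y ->
  c1 * y + c2 * z + c3 * y + c4 * w + c5 * z <= (c1 + c2 + c3 + c4 + c5) * y.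
Proof.
move=> h2 h4 h5 zy wy.
have := ler_wpM2l h2 zy; have := ler_wpM2l h4 wy; have := ler_wpM2l h5 zy; lra.
Qed.

(** Cutting the divisors at [D = M ^ 6 * P] balances [N * D ^ 3] from the divisors below against
    [N ^ 2 * (N / D) ^ 2] from those above, so D grows like the power 3/5 of [N]. Both are of order
    [M ^ 28], against [M ^ 30] for [N ^ 3]. Moreover [N] is the square of [P * M ^ 5], as the
    lattice side requires. *)
Lemma double_char_sum_order (chi : nat -> F) (P j : nat) : (2 < P)%N -> (0 < j <= 2)%N ->
  (forall d, chi (d + P)%N = chi d) -> (forall d, `|chi d| <= 1) ->
  \sum_(i < P) chi i.+1 = 0 ->
  exists K : F, forall M : nat, (1 < M)%N ->
  `|4 * double_char_sum chi (P ^ 2 * M ^ 10) j - 2 * char_mean chi P * (P ^ 2 * M ^ 10)%:R ^+ 3|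
    <= K * M%:R ^+ 28.
Proof.
move=> P2 /andP[j0 j2] per le1 sum0.
have PF : 1 <= (P%:R : F) by rewrite ler1n; lia.
exists (45 * j%:R ^+ 2 * P%:R ^+ 5 + 9 * j%:R * P%:R ^+ 6 + 24 * j%:R * P%:R ^+ 8) => M M1.
have M6 : (1 <= M ^ 6)%N by rewrite expn_gt0; lia.
have M4 : (16 <= M ^ 4)%N by apply: (@leq_trans (2 ^ 4)) => //; rewrite leq_exp2r.
have NE : (P ^ 2 * M ^ 10 = (P * M ^ 4) * (M ^ 6 * P))%N.
  by rewrite (_ : 10 = 4 + 6)%N // expnD; ring.
have vN : (2 * (j * (M ^ 6 * P).+1) <= P ^ 2 * M ^ 10)%N.
  rewrite NE; set m := (M ^ 6 * P)%N; have m1 : (1 <= m)%N by rewrite /m; nia.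
  apply: (@leq_trans (8 * m)); first by nia.
  by rewrite leq_mul2r; apply/orP; right; nia.
have := @double_char_sum_bound F chi P (ltac:(lia)) per le1 sum0 (P ^ 2 * M ^ 10) j (M ^ 6) (P * M ^ 4) j0 M6 NE vN.
move=> h; apply: le_trans h _.
have MF : 1 <= (M%:R : F) by rewrite ler1n; lia.
have vle : (j * (M ^ 6 * P).+1)%:R <= 2 * j%:R * P%:R * M%:R ^+ 6 :> F.
  rewrite -natrX -!natrM ler_nat.
  by have m1 : (1 <= M ^ 6 * P)%N; nia.
have v0 : 0 <= (j * (M ^ 6 * P).+1)%:R :> F by [].
move: vle v0; move: ((j * (M ^ 6 * P).+1)%:R : F) => v vle v0.
have nE : (P ^ 2 * M ^ 10)%:R = P%:R ^+ 2 * M%:R ^+ 10 :> F by rewrite natrM !natrX.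
have mE : (M ^ 6 * P)%:R = M%:R ^+ 6 * P%:R :> F by rewrite natrM !natrX.
have kE : (P * M ^ 4)%:R = P%:R * M%:R ^+ 4 :> F by rewrite natrM !natrX.
rewrite nE mE kE.
move: PF MF vle; move: (P%:R : F) (M%:R : F) => q x q1 x1 vle.
have jF : 0 <= (j%:R : F) by [].
move: (j%:R : F) jF vle => t t0 vle.
have q0 : 0 <= q by lra.
have x0 : 0 <= x by lra.
have e26 : x ^+ 26 <= x ^+ 28 by rewrite ler_weXn2l.
have e22 : x ^+ 22 <= x ^+ 28 by rewrite ler_weXn2l.
have v2 : v ^+ 2 <= (2 * t * q * x ^+ 6) ^+ 2.
  by rewrite ler_pXn2r ?nnegrE // (le_trans v0 vle).
have n0 : 0 <= q ^+ 2 * x ^+ 10 by rewrite mulr_ge0 ?exprn_ge0.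
apply: (@le_trans _ _ (9 * (q ^+ 2 * x ^+ 10) * t ^+ 2 * (x ^+ 6 * q) ^+ 3 +
   3 * (q ^+ 2 * x ^+ 10) ^+ 2 * t * (x ^+ 6 * q * q) +
   4 * (6 * q ^+ 2 * (q ^+ 2 * x ^+ 10) ^+ 2 * t * (q * x ^+ 4) ^+ 2) +
   q * (9 * (q ^+ 2 * x ^+ 10) * (2 * t * q * x ^+ 6) ^+ 2 +
     3 * (q ^+ 2 * x ^+ 10) ^+ 2 * (2 * t * q * x ^+ 6)))).
  by rewrite lerD2l; apply: tail_term_mono.
have -> : 9 * (q ^+ 2 * x ^+ 10) * t ^+ 2 * (x ^+ 6 * q) ^+ 3 +
   3 * (q ^+ 2 * x ^+ 10) ^+ 2 * t * (x ^+ 6 * q * q) +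
   4 * (6 * q ^+ 2 * (q ^+ 2 * x ^+ 10) ^+ 2 * t * (q * x ^+ 4) ^+ 2) +
   q * (9 * (q ^+ 2 * x ^+ 10) * (2 * t * q * x ^+ 6) ^+ 2 +
     3 * (q ^+ 2 * x ^+ 10) ^+ 2 * (2 * t * q * x ^+ 6)) =
  (9 * t ^+ 2 * q ^+ 5) * x ^+ 28 + (3 * t * q ^+ 6) * x ^+ 26 + (24 * t * q ^+ 8) * x ^+ 28
   + (36 * t ^+ 2 * q ^+ 5) * x ^+ 22 + (6 * t * q ^+ 6) * x ^+ 26 by ring.
have -> : 45 * t ^+ 2 * q ^+ 5 + 9 * t * q ^+ 6 + 24 * t * q ^+ 8 =
  9 * t ^+ 2 * q ^+ 5 + 3 * t * q ^+ 6 + 24 * t * q ^+ 8 + 36 * t ^+ 2 * q ^+ 5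
  + 6 * t * q ^+ 6 by ring.
have q5 : 0 <= q ^+ 5 by exact: exprn_ge0.
have q6 : 0 <= q ^+ 6 by exact: exprn_ge0.
have t2 : 0 <= t ^+ 2 by exact: exprn_ge0.
by apply: five_terms_mono => //; apply: mulr_ge0 => //; apply: mulr_ge0.
Qed.

Lemma archimedean_zero (x K : F) : 0 <= x ->
  (forall M : nat, (1 < M)%N -> x * M%:R <= K) -> x = 0.
Proof.
move=> x0 h; apply/eqP; rewrite eq_le x0 andbT leNgt; apply/negP => xp.
have K0 : 0 <= K by apply: le_trans (h 2%N isT); rewrite mulr_ge0.
have := archi_boundP (divr_ge0 K0 x0); set m := Num.bound _ => hm.
have := h m.+2 isT; rewrite leNgt => /negP; apply.
rewrite mulrC -ltr_pdivrMr //; apply: lt_le_trans hm _.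
by rewrite ler_nat; lia.
Qed.

(** [rep_number] searches a box only, so the divisor formula is assumed for those boxes that contain
    all representations of [n]. *)
Theorem mean_of_representations (forms : seq (int * int * int)) (chi : nat -> int) (P : nat) :
  (2 < P)%N -> (forall d, chi (d + P)%N = chi d) -> (forall d, `|chi d| <= 1) ->
  \sum_(i < P) chi i.+1 = 0 ->
  (forall f, f \in forms -> posdef f) ->
  (forall n X : nat, (0 < n)%N ->
     (forall f x y, f \in forms -> bqf f x y = n%:Z -> `|x| <= X%:Z /\ `|y| <= X%:Z) ->
     (\sum_(f <- forms) rep_number X f n)%:Z = 2 * \sum_(d <- divisors n) chi d) ->
  (size forms)%:R = char_mean (fun d => (chi d)%:~R : F) P.
Proof.
move=> P2 per le1 sum0 pd rep.
pose ch d : F := (chi d)%:~R.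
have per' d : ch (d + P)%N = ch d by rewrite /ch per.
have le1' d : `|ch d| <= 1 by rewrite /ch -intr_norm lerz1.
have sum0' : \sum_(i < P) ch i.+1 = 0 by rewrite -rmorph_sum sum0.
have [K1 h1] := @double_char_sum_order ch P 1 P2 isT per' le1' sum0'.
have [K2 h2] := @double_char_sum_order ch P 2 P2 isT per' le1' sum0'.
pose L k s f : F := latsum (k * s) (fun x y => cubp ((s%:Z ^+ 2 - bqf f x y)%:~R : F)
         - 4 * cubp ((s%:Z ^+ 2 - 4 * bqf f x y)%:~R : F)).
have [k [K [K0 lat]]] : exists k : nat, exists K : F, 0 <= K /\
    forall s : nat, (1 <= s)%N ->
    (forall f x y, f \in forms -> (k * s)%:Z < `|x| \/ (k * s)%:Z < `|y| -> s%:Z ^+ 2 <= bqf f x y) /\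
    `|\sum_(f <- forms) L k s f| <= K * s%:R ^+ 5.
  (* The induction over the forms needs every large [k]: a new form may require a larger box for the
     previous ones too. *)
  suff [k0 H] : exists k0 : nat, forall k, (k0 <= k)%N -> exists K : F, 0 <= K /\
     forall s : nat, (1 <= s)%N ->
    (forall f x y, f \in forms -> (k * s)%:Z < `|x| \/ (k * s)%:Z < `|y| -> s%:Z ^+ 2 <= bqf f x y) /\
    `|\sum_(f <- forms) L k s f| <= K * s%:R ^+ 5.
    by exists k0; exact: H.
  elim: forms pd {rep} => [|f fs IH] pd.
    by exists 0%N => k _; exists 0; split=> // s _; split=> //; rewrite big_nil normr0 mul0r.
  have [k1 {}IH] := IH (fun g gin => pd g (mem_behead (s := f :: fs) gin)).
  have [k2 hf] := @lattice_sum_bound F f (pd f (mem_head _ _)).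
  exists (maxn k1 k2) => k; rewrite geq_max => /andP[kk1 kk2].
  have [K [K0 HK]] := IH k kk1; have [K' K0' HK'] := hf k kk2.
  exists (K + K'); split; first exact: addr_ge0.
  move=> s s1; have [A1 A2] := HK s s1; have [B1 B2] := HK' s s1; split.
    by move=> g x y; rewrite inE => /orP[/eqP->|gin] h; [exact: B1|exact: (A1 g)].
  rewrite big_cons mulrDl addrC; apply: le_trans (ler_normD _ _) _; exact: lerD.
pose h : F := (size forms)%:R; pose c := char_mean ch P.
suff : `|h - c| * P%:R ^+ 6 = 0.
  move/eqP; rewrite mulf_eq0 expf_eq0 /= pnatr_eq0 normr_eq0 subr_eq0.
  have -> : (P == 0%N) = false by lia.
  by rewrite orbF => /eqP.
apply: (@archimedean_zero _ (2 * K * P%:R ^+ 5 + K1 + 2 * K2)).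
  by rewrite mulr_ge0 // exprn_ge0.
move=> M M1; pose s := (P * M ^ 5)%N; pose N := (P ^ 2 * M ^ 10)%N.
have sN : s%:Z ^+ 2 = N%:Z.
  rewrite expr2 -PoszM /s /N; congr Posz.
  by rewrite (_ : 10 = 5 + 5)%N // expnD; ring.
have s1 : (1 <= s)%N by rewrite /s muln_gt0 expn_gt0; lia.
have [out bnd] := lat s s1.
set X := (k * s)%N in out bnd.
pose psi (n : nat) : F := cubp (N%:R - n%:R).
pose g (n : int) : F := cubp ((N%:Z - n)%:~R : F) - 4 * cubp ((N%:Z - 4 * n)%:~R : F).
have gn (n : nat) : g n%:Z = psi n - 4 * psi (4 * n)%N.
  have cst (m : nat) : (N%:Z - m%:Z)%:~R = N%:R - m%:R :> F by rewrite rmorphB.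
  by rewrite /g /psi -!cst; congr (_ - 4 * cubp _%:~R); lia.
have g0 n : N%:Z <= n -> g n = 0.
  by move=> h0; rewrite /g !cubp_neg ?mulr0 ?subr0 // lerz0; lia.
have psi0 n : (N <= n)%N -> psi n = 0.
  by move=> h0; rewrite /psi cubp_neg // subr_le0 ler_nat.
have N0 : (0 < N)%N by rewrite /N; rewrite muln_gt0 !expn_gt0; lia.
have lats f : f \in forms -> L k s f = \sum_(n < N) (rep_number X f n)%:R * g n%:Z.
  move=> fin; rewrite -(@sum_rep_number _ X N f g); last exact: g0.
    by rewrite /L sN.
  by move=> x y; apply: bqf_ge0; exact: pd.
(* Summed over the cofactor, psi(v) - 2 psi(2 v) is an alternating sum; the splitting (psi(v) - 2
   psi(2 v)) + 2 (psi(2 v) - 2 psi(4 v)) accounts for the two values of [j] and the coefficient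
   2. *)
pose W := double_char_sum ch N 1 + 2 * double_char_sum ch N 2.
have main : \sum_(f <- forms) L k s f = - 3 * N%:R ^+ 3 * h + 2 * W.
  rewrite big_seq (eq_bigr _ lats) -big_seq exchange_big /=.
  have sw n : \sum_(f <- forms) (rep_number X f n)%:R * g n%:Z =
     (\sum_(f <- forms) rep_number X f n)%:R * g n%:Z by rewrite natr_sum mulr_suml.
  rewrite (eq_bigr _ (fun (n : 'I_N) _ => sw n)).
  rewrite (big_ord_shift (f := fun n => (\sum_(f <- forms) rep_number X f n)%:R * g n%:Z) N0); last first.
    by rewrite g0 ?mulr0.
  congr (_ + _).
    rewrite gn /psi muln0 !subr0 cubp_pos //.
    rewrite (_ : \sum_(f <- forms) _ = size forms).
      by rewrite /h; ring.
    rewrite big_seq (eq_bigr (fun=> 1%N)); last by move=> f fin; exact: rep_number0 (pd f fin).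
    by rewrite -big_seq sum1_size.
  transitivity (2 * \sum_(n < N) (\sum_(d <- divisors n.+1) ch d) * g n.+1%:Z).
    rewrite mulr_sumr; apply: eq_bigr => n _; rewrite mulrA.
    have [nN|Nn] := ltnP n.+1 N; last by rewrite g0 ?mulr0 //; lia.
    congr (_ * _).
    rewrite -[LHS]/((\sum_(f <- forms) rep_number X f n.+1)%:Z%:~R) rep //.
      by rewrite rmorphM /= rmorph_sum.
    move=> f x y fin fxy; split; rewrite leNgt; apply/negP => xX.
      by have := out f x y fin (or_introl xX); rewrite fxy sN; lia.
    by have := out f x y fin (or_intror xX); rewrite fxy sN; lia.
  congr (2 * _); rewrite (@sum_dirichlet _ N ch (fun n => g n%:Z)); last first.
    by move=> n h0; apply: g0; lia.
  rewrite /W /double_char_sum mulr_sumr -big_split /=; apply: eq_bigr => d _.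
  rewrite -!mulr_sumr mulrCA -mulrDr; congr (_ * _).
  have a1 := @alternating_sum_even _ N (fun n => psi (1 * d.+1 * n)%N).
  have a2 := @alternating_sum_even _ N (fun n => psi (2 * d.+1 * n)%N).
  rewrite -/(psi _) a1; last by move=> n h0; apply: psi0; nia.
  rewrite a2; last by move=> n h0; apply: psi0; nia.
  have -> : \sum_(k1 < N) psi (1 * d.+1 * (2 * k1.+1)) = \sum_(k1 < N) psi (2 * d.+1 * k1.+1).
    by apply: eq_bigr => i _; congr psi; ring.
  transitivity (\sum_(k1 < N) psi (1 * d.+1 * k1.+1) - 4 * \sum_(k1 < N) psi (2 * d.+1 * (2 * k1.+1))).
    rewrite mulr_sumr -sumrB; apply: eq_bigr => i _.
    by rewrite gn; congr (psi _ - _ * psi _); ring.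
  ring.
have {h1} b1 := h1 M M1; have {h2} b2 := h2 M M1.
rewrite -/N -/c in b1 b2.
have M0 : 0 < (M%:R : F) by rewrite ltr0n; lia.
have M28 : 0 < (M%:R : F) ^+ 28 by exact: exprn_gt0.
rewrite -(ler_pM2r M28).
have NM : (N%:R : F) ^+ 3 = P%:R ^+ 6 * M%:R ^+ 30.
  by rewrite /N natrM !natrX exprMn -!exprM.
have sM : (s%:R : F) ^+ 5 = P%:R ^+ 5 * M%:R ^+ 25.
  by rewrite /s natrM !natrX exprMn -!exprM.
rewrite main sM in bnd.
have M2528 : (M%:R : F) ^+ 25 <= M%:R ^+ 28 by rewrite ler_weXn2l // ler1n; lia.
have M2930 : (M%:R : F) ^+ 29 <= M%:R ^+ 30 by rewrite ler_weXn2l // ler1n; lia.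
(* The combination that eliminates [W] between the lattice sum and the two character sums; what
   remains has order [M ^ 28] at most, against [M ^ 30] for [N ^ 3]. *)
have key : `|6 * ((h - c) * N%:R ^+ 3)| <= 2 * K * P%:R ^+ 5 * M%:R ^+ 28 + K1 * M%:R ^+ 28 + 2 * (K2 * M%:R ^+ 28).
  have -> : 6 * ((h - c) * N%:R ^+ 3) =
     - (2 * (- 3 * N%:R ^+ 3 * h + 2 * W)) +
     (4 * double_char_sum ch N 1 - 2 * c * N%:R ^+ 3)
     + 2 * (4 * double_char_sum ch N 2 - 2 * c * N%:R ^+ 3) by rewrite /W; ring.
  apply: le_trans (ler_normD _ _) _; apply: lerD; last first.
    by rewrite normrM ger0_norm // ler_wpM2l.
  apply: le_trans (ler_normD _ _) _; apply: lerD => //.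
  rewrite normrN normrM ger0_norm // -[leRHS]mulrA -[leRHS]mulrA; apply: ler_wpM2l => //.
  apply: le_trans bnd _; apply: ler_wpM2l => //; apply: ler_wpM2l => //.
  by rewrite exprn_ge0.
move: key; rewrite NM normrM ger0_norm // normrM (ger0_norm (x := _ * _)); last first.
  by rewrite mulr_ge0 ?exprn_ge0 // ltW.
have := mulr_ge0 (normr_ge0 (h - c)) (mulr_ge0 (exprn_ge0 6 (ler0n F P)) (exprn_ge0 30 (ltW M0))).
have : `|h - c| * P%:R ^+ 6 * M%:R * M%:R ^+ 28 <= `|h - c| * (P%:R ^+ 6 * M%:R ^+ 30).
  have -> : `|h - c| * P%:R ^+ 6 * M%:R * M%:R ^+ 28 = `|h - c| * (P%:R ^+ 6 * M%:R ^+ 29).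
    by rewrite exprS !mulrA.
  apply: ler_wpM2l => //; apply: ler_wpM2l => //.
  by apply: exprn_ge0.
move: (`|h - c| * (P%:R ^+ 6 * M%:R ^+ 30)) (`|h - c| * P%:R ^+ 6 * M%:R * M%:R ^+ 28) => A B.
by move: (M%:R ^+ 28) => C; lra.
Qed.

End MeanOfRepresentations.

(** * Ideals of given norm in a quadratic order *)

Section RootCount.
Variables t m : nat.

Definition qpoly (b : nat) : nat := (b ^ 2 + t * b + m)%N.

(** [qpoly b] is the norm of b + om for a root om of X ^ 2 - t X + m. Its roots modulo [a]
    parametrize the primitive ideals Z a + Z (b + om), which have norm [a]. *)
Definition rho (a : nat) : nat := #|[set b : 'I_a | (a %| qpoly b)%N]|.

(** [k] is the content: every ideal is an integer [k] times a primitive ideal, of norm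
    [n / k ^ 2]. *)
Definition nideal (n : nat) : nat :=
  (\sum_(k <- [seq k <- iota 1 n | (k ^ 2 %| n)%N]) rho (n %/ k ^ 2))%N.

Lemma qpoly_mod (a d b : nat) : (d %| a)%N -> (d %| qpoly (b %% a))%N = (d %| qpoly b)%N.
Proof.
move=> da; rewrite /dvdn /qpoly.
have e : (b %% a = b %[mod d])%N by rewrite modn_dvdm.
congr (_ == _).
rewrite -!addnA -modnDm -[in RHS]modnDm -modnXm e modnXm; congr ((_ + _) %% _)%N.
by rewrite -[LHS]modnDml -[RHS]modnDml -[in LHS]modnMmr e modnMmr.
Qed.

Lemma add_double_sub (x y : nat) : (x <= y)%N -> (x + y + t = 2 * x + t + (y - x))%N.
Proof. by lia. Qed.

Lemma qpoly_sub (x y : nat) : (x <= y)%N -> (qpoly y - qpoly x = (y - x) * (x + y + t))%N.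
Proof.
move=> /subnKC; move: (y - x)%N => d <-.
have -> : qpoly (x + d) = (qpoly x + d * (x + (x + d) + t))%N by rewrite /qpoly; ring.
by rewrite addKn.
Qed.

Lemma rho1 : rho 1 = 1%N.
Proof.
rewrite /rho (_ : [set b | _] = setT) ?cardsT ?card_ord //.
by apply/setP => x; rewrite !inE dvd1n.
Qed.

Lemma rhoM (a b : nat) : coprime a b -> (0 < a)%N -> (0 < b)%N -> rho (a * b) = (rho a * rho b)%N.
Proof.
move=> cab a0 b0.
pose f (x : 'I_(a * b)) : 'I_a * 'I_b := (Ordinal (ltn_pmod x a0), Ordinal (ltn_pmod x b0)).
have finj : injective f.
  move=> x y [ea eb]; apply/val_inj => /=.
  have : (x = y %[mod a * b])%N.
    by apply/eqP; rewrite chinese_remainder //; apply/andP; split; apply/eqP.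
  by rewrite !modn_small.
have fbij : bijective f.
  by apply: inj_card_bij finj _; rewrite card_prod !card_ord.
rewrite /rho -cardsX.
rewrite -(on_card_preimset (f := f)); last exact: onW_bij.
congr #|pred_of_set _|; apply/setP => x; rewrite !inE /= Gauss_dvd //.
by rewrite !qpoly_mod.
Qed.

Variables (q : nat).
Hypothesis pq : prime q.

Lemma solve_linear (c u : nat) : coprime q u -> exists j, (q %| c + j * u)%N.
Proof.
move=> cu; have q0 := prime_gt0 pq.
case: (egcdnP u q0) => kq ku e _.
have g1 : gcdn q u = 1%N by apply/eqP.
rewrite g1 in e.
exists (c * ku)%N.
have -> : (c + c * ku * u = c * (kq * q))%N by rewrite e; ring.
by rewrite mulnA dvdn_mull.
Qed.

(** The hypothesis says that the roots modulo [q] are simple, [2 * b + t] being the derivative.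
    Reduction is injective on roots because [qpoly y - qpoly x = (y - x) * (x + y + t)] has a second
    factor prime to [q], and surjective by a Newton step. *)
Lemma rho_hensel (e : nat) : (0 < e)%N ->
  (forall b, (q %| qpoly b)%N -> ~~ (q %| 2 * b + t)%N) ->
  rho (q ^ e.+1) = rho (q ^ e).
Proof.
move=> e0 simple; have q0 := prime_gt0 pq.
have qe : (0 < q ^ e)%N by rewrite expn_gt0 q0.
have qdv : (q ^ e %| q ^ e.+1)%N by rewrite dvdn_exp2l.
have qq : (q %| q ^ e)%N by rewrite -{1}[q]expn1 dvdn_exp2l.
pose f (x : 'I_(q ^ e.+1)) : 'I_(q ^ e) := Ordinal (ltn_pmod x qe).
rewrite /rho; set A := [set b : 'I_(q ^ e.+1) | _].
have finj : {in A &, injective f}.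
  move=> x y; rewrite !inE => hx hy [exy]; apply/val_inj => /=.
  wlog xy : x y hx hy exy / (x <= y)%N.
    by move=> H; case: (leqP x y) => h; [|symmetry]; apply: H => //; exact: ltnW.
  have cop : coprime (q ^ e.+1) (x + y + t).
    rewrite coprimeXl // prime_coprime //; apply: contra (simple x _); last first.
      by apply: dvdn_trans hx; apply: dvdn_trans qdv.
    have : (q %| y - x)%N.
      by rewrite -eqn_mod_dvd // -(modn_dvdm y qq) -exy modn_dvdm.
    move=> qyx; rewrite add_double_sub //.
        by rewrite dvdn_addl.
  have : (q ^ e.+1 %| (y - x) * (x + y + t))%N.
    by rewrite -qpoly_sub // dvdn_sub.
  rewrite Gauss_dvdl // => /dvdnP[[|z] zE].
    by apply/eqP; rewrite eqn_leq xy -subn_eq0 zE.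
  have : (q ^ e.+1 <= y)%N by apply: leq_trans (leq_subr x y); rewrite zE leq_pmull.
  by rewrite leqNgt ltn_ord.
rewrite -(card_in_imset finj); congr #|pred_of_set _|; apply/setP => x.
rewrite inE; apply/imsetP/idP => [[y]|hx].
  rewrite inE => hy ->; rewrite /= qpoly_mod //; exact: dvdn_trans hy.
have /dvdnP[c cE] := hx.
have cop : coprime q (2 * x + t).
  by rewrite prime_coprime // simple //; exact: dvdn_trans hx.
have [j jq] := solve_linear c cop.
pose y := ((x + q ^ e * j) %% q ^ e.+1)%N.
have yl : (y < q ^ e.+1)%N by rewrite ltn_pmod // expn_gt0 q0.
exists (Ordinal yl); last first.
  by apply/val_inj; rewrite /= /y modn_dvdm // addnC mulnC modnMDl modn_small.
rewrite inE /= /y qpoly_mod //.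
have -> : (qpoly (x + q ^ e * j) = q ^ e * (c + j * (2 * x + t)) + q ^ e * (q ^ e * j ^ 2))%N.
  have -> : (qpoly (x + q ^ e * j) = qpoly x + q ^ e * (j * (2 * x + t)) + q ^ e * (q ^ e * j ^ 2))%N.
    by rewrite /qpoly; ring.
  by rewrite cE; ring.
rewrite expnSr dvdn_add // dvdn_pmul2l //.
by rewrite dvdn_mulr.
Qed.

Lemma rho_pow (e : nat) :
  (forall b, (q %| qpoly b)%N -> ~~ (q %| 2 * b + t)%N) -> rho (q ^ e.+1) = rho q.
Proof.
by move=> simple; elim: e => [|e IH]; rewrite ?expn1 // rho_hensel.
Qed.

Definition nideal_loc (e : nat) : nat := (\sum_(j < (e./2).+1) rho (q ^ (e - j.*2)))%N.

(** The cases c = 0, 1, -1 are the ramified, split and inert primes. In all three [rho (q ^ i.+2)]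
    is [c ^+ i.+1 + c ^+ i.+2], so passing from [e] to [e + 2] adds exactly two terms of the
    geometric sum. *)
Lemma nideal_loc_char (e : nat) (c : int) :
  (c = 0 \/ c = 1 \/ c = -1) -> (rho q)%:Z = 1 + c ->
  (c = 0 -> forall b, ~~ (q ^ 2 %| qpoly b)%N) ->
  (c <> 0 -> forall b, (q %| qpoly b)%N -> ~~ (q %| 2 * b + t)%N) ->
  (nideal_loc e)%:Z = \sum_(i < e.+1) c ^+ i.
Proof.
move=> cv rq ram simple.
have step i : (rho (q ^ i.+2))%:Z = c ^+ i.+1 + c ^+ i.+2.
  have [c0|c0] := eqVneq c 0.
    rewrite c0 !exprS !mul0r addr0 /rho (_ : [set b | _] = set0) ?cards0 //.
    apply/setP => b; rewrite !inE; apply/negbTE; apply: contra (ram c0 b).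
    by apply: dvdn_trans; rewrite dvdn_exp2l.
  rewrite rho_pow; last by apply: simple; apply/eqP.
  rewrite rq; case: cv c0 => [->//|[->|->]] _; first by rewrite !expr1n.
  by rewrite [(-1) ^+ i.+2]exprS; ring.
elim/ltn_ind: e => -[|[|e]] IH; rewrite /nideal_loc.
- by rewrite !big_ord1 expn0 rho1.
- by rewrite big_ord1 /= expn1 rq !big_ord_recr big_ord0 /= expr0 expr1 add0r.
rewrite /= big_ord_recl /= subn0 PoszD step [RHS]big_ord_recr [in RHS]big_ord_recr /=.
by rewrite -addrA [RHS]addrC; congr (_ + _); rewrite -(IH e).
Qed.

Variable n : nat.
Hypothesis n0 : (0 < n)%N.
Hypothesis qn : ~~ (q %| n)%N.

Lemma qpow_split (k : nat) : (0 < k)%N ->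
  exists j k' : nat, [/\ k = (q ^ j * k')%N, (0 < k')%N & ~~ (q %| k')%N].
Proof.
move=> k0; exists (logn q k), (k`_(q^'))%N; split => //.
  by rewrite -p_part partnC.
rewrite -prime_coprime // -[q]expn1; apply: (pnat_coprime (pi := q)) (part_pnat _ _).
by rewrite expn1 pnat_id.
Qed.

Lemma qpow_inj (j j' k k' : nat) : (0 < k)%N -> (0 < k')%N -> ~~ (q %| k)%N -> ~~ (q %| k')%N ->
  (q ^ j * k = q ^ j' * k')%N -> j = j' /\ k = k'.
Proof.
move=> k0 k0' qk qk' e.
have l (i l : nat) : (0 < l)%N -> ~~ (q %| l)%N -> logn q (q ^ i * l) = i.
  move=> l0 ql; have qi : (0 < q ^ i)%N by rewrite expn_gt0 prime_gt0.
  rewrite lognM // pfactorK //.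
  by rewrite logn_coprime ?addn0 // prime_coprime.
have jj : j = j' by rewrite -(l j k) // e l.
split=> //; move: e; rewrite jj => /eqP; rewrite eqn_pmul2l ?expn_gt0 ?prime_gt0 //.
by move=> /eqP.
Qed.

Lemma dvdn_qpow (i e k : nat) : ~~ (q %| k)%N -> (q ^ i * k %| q ^ e * n)%N = (i <= e)%N && (k %| n)%N.
Proof.
move=> qk; have cop x y : ~~ (q %| y)%N -> coprime (q ^ x) y.
  by move=> h; rewrite coprimeXl // prime_coprime.
rewrite Gauss_dvd ?cop // Gauss_dvdl ?cop // Gauss_dvdr 1?coprime_sym ?cop //.
by rewrite dvdn_Pexp2l // prime_gt1.
Qed.

Lemma sum_sqdiv (T : nmodType) (e : nat) (F : nat -> T) :
  \sum_(k <- [seq k <- iota 1 (q ^ e * n) | (k ^ 2 %| q ^ e * n)%N]) F k =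
  \sum_(j < (e./2).+1) \sum_(k <- [seq k <- iota 1 n | (k ^ 2 %| n)%N]) F (q ^ j * k)%N.
Proof.
rewrite -(big_mkord xpredT (fun j => \sum_(k <- [seq k <- iota 1 n | (k ^ 2 %| n)%N]) F (q ^ j * k)%N)).
transitivity (\sum_(k <- [seq (q ^ j * k)%N | j <- index_iota 0 (e./2).+1,
    k <- [seq k <- iota 1 n | (k ^ 2 %| n)%N]]) F k); last by rewrite big_allpairs_dep.
apply: perm_big; apply: uniq_perm.
- by rewrite filter_uniq // iota_uniq.
- apply: allpairs_uniq; rewrite ?iota_uniq ?filter_uniq ?iota_uniq //.
  move=> [j k] [j' k'] /allpairsP[[a b] [_ h1 E1]] /allpairsP[[a' b'] [_ h2 E2]].
  move: h1 h2; case: E1 => _ <-; case: E2 => _ <- /=.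
  rewrite !mem_filter !mem_iota => /andP[kn /andP[k0 _]] /andP[kn' /andP[k0' _]] e'.
  have nq x : (x ^ 2 %| n)%N -> ~~ (q %| x)%N.
    move=> xn; apply: contra qn => h; apply: dvdn_trans xn; exact: dvdn_exp.
  by have [-> ->] := qpow_inj k0 k0' (nq _ kn) (nq _ kn') e'.
move=> k; rewrite mem_filter mem_iota; apply/idP/allpairsP.
  case/andP=> kd /andP[k0 _]; have [j [k' [kE k0' qk']]] := qpow_split k0.
  have qk2 : ~~ (q %| k' ^ 2)%N by rewrite Euclid_dvdX // andbT.
  exists (j, k'); split=> //=; move: kd; rewrite kE expnMn -expnM dvdn_qpow //.
    by case/andP=> je _; rewrite mem_index_iota /=; lia.
  case/andP=> _ kn; rewrite mem_filter kn mem_iota k0' /= add1n ltnS.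
  by apply: leq_trans (dvdn_leq n0 kn); rewrite expnS leq_pmulr // expn_gt0 k0'.
case=> [[j k']] /= [+ + ->]; rewrite mem_index_iota mem_filter mem_iota /=.
move=> je /andP[kn /andP[k0 _]].
have qk : ~~ (q %| k')%N.
  by apply: contra qn => h; apply: dvdn_trans kn; exact: dvdn_exp.
have qk2 : ~~ (q %| k' ^ 2)%N by rewrite Euclid_dvdX // andbT.
rewrite expnMn -expnM dvdn_qpow // kn andbT muln_gt0 expn_gt0 prime_gt0 // k0 /=.
have j2 : (j * 2 <= e)%N by lia.
rewrite j2 /= add1n ltnS leq_mul //.
  by rewrite leq_pexp2l ?prime_gt0 //; lia.
by apply: leq_trans (dvdn_leq n0 kn); rewrite expnS leq_pmulr // expn_gt0 k0.
Qed.

Lemma sum_div (T : nmodType) (e : nat) (F : nat -> T) :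
  \sum_(d <- divisors (q ^ e * n)) F d =
  \sum_(j < e.+1) \sum_(d <- divisors n) F (q ^ j * d)%N.
Proof.
rewrite -(big_mkord xpredT (fun j => \sum_(k <- divisors n) F (q ^ j * k)%N)).
transitivity (\sum_(k <- [seq (q ^ j * k)%N | j <- index_iota 0 e.+1, k <- divisors n]) F k);
  last by rewrite big_allpairs_dep.
have N0 : (0 < q ^ e * n)%N by rewrite muln_gt0 expn_gt0 prime_gt0.
have nq x : (x %| n)%N -> ~~ (q %| x)%N by move=> xn; apply: contra qn => h; exact: dvdn_trans xn.
apply: perm_big; apply: uniq_perm.
- exact: divisors_uniq.
- apply: allpairs_uniq; rewrite ?iota_uniq ?divisors_uniq //.
  move=> [j k] [j' k'] /allpairsP[[a b] [_ h1 E1]] /allpairsP[[a' b'] [_ h2 E2]].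
  move: h1 h2; case: E1 => _ <-; case: E2 => _ <- /=.
  rewrite -!dvdn_divisors // => kn kn' e'.
  by have [-> ->] := qpow_inj (dvdn_gt0 n0 kn) (dvdn_gt0 n0 kn') (nq _ kn) (nq _ kn') e'.
move=> k; rewrite -dvdn_divisors //; apply/idP/allpairsP.
  move=> kd; have [j [k' [kE k0' qk']]] := qpow_split (dvdn_gt0 N0 kd).
  exists (j, k'); move: kd; rewrite kE dvdn_qpow // => /andP[je kn].
  by split=> //=; rewrite -?dvdn_divisors // mem_index_iota.
case=> [[j k']] /= [+ + ->]; rewrite mem_index_iota -dvdn_divisors //= => je kn.
by rewrite dvdn_qpow ?nq // kn andbT.
Qed.

Lemma nideal_split (e : nat) : nideal (q ^ e * n) = (nideal_loc e * nideal n)%N.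
Proof.
rewrite /nideal sum_sqdiv /nideal_loc big_distrl /=; apply: eq_bigr => j _.
rewrite big_distrr /= big_seq [RHS]big_seq; apply: eq_bigr => k.
rewrite mem_filter mem_iota => /andP[kn /andP[k0 _]].
have qk : ~~ (q %| n %/ k ^ 2)%N.
  by apply: contra qn => h; apply: (dvdn_trans h); exact: dvdn_div.
have j2 : (j.*2 <= e)%N by have := ltn_ord j; lia.
have q0 : (0 < q)%N by exact: prime_gt0.
have -> : (q ^ e * n %/ (q ^ j * k) ^ 2 = q ^ (e - j.*2) * (n %/ k ^ 2))%N.
  rewrite -{1}(subnK j2) expnD -{1}(divnK kn) expnMn -expnM muln2.
  rewrite (_ : _ * _ * _ = (q ^ (e - j.*2) * (n %/ k ^ 2)) * (q ^ j.*2 * k ^ 2))%N; last by ring.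
  by rewrite mulnK // muln_gt0 !expn_gt0 q0 k0.
have [e0|e0] := posnP (e - j.*2).
  by rewrite e0 expn0 mul1n rho1 mul1n.
rewrite rhoM ?expn_gt0 ?q0 // ?coprimeXl ?prime_coprime //.
by rewrite divn_gt0 ?expn_gt0 ?k0 // dvdn_leq.
Qed.

End RootCount.

(** Both sides are multiplicative, so the power of the smallest prime factor is split off and
    conditions at the primes suffice. *)
Lemma nideal_charE (t m : nat) (chi : nat -> int) :
  chi 1%N = 1 -> (forall a b, chi (a * b)%N = chi a * chi b) ->
  (forall d, `|chi d| <= 1) ->
  (forall q, prime q -> (rho t m q)%:Z = 1 + chi q) ->
  (forall q, prime q -> chi q = 0 -> forall b, ~~ (q ^ 2 %| qpoly t m b)%N) ->
  (forall q, prime q -> chi q <> 0 ->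
     forall b, (q %| qpoly t m b)%N -> ~~ (q %| 2 * b + t)%N) ->
  forall n, (0 < n)%N -> (nideal t m n)%:Z = \sum_(d <- divisors n) chi d.
Proof.
move=> chi1 chiM chile rq ram simple.
have chiX q j : chi (q ^ j)%N = chi q ^+ j.
  by elim: j => [|j IH]; rewrite ?expn0 // expnS chiM IH exprS.
elim/ltn_ind => n IH n0.
have [n1|n1] := leqP n 1.
  have -> : n = 1%N by lia.
  by rewrite /nideal /= big_cons big_nil divn1 rho1 addn0 /= big_cons big_nil chi1 addr0.
have pq := pdiv_prime n1; set q := pdiv n in pq.
have [j [k [kE k0 qk]]] := qpow_split pq n0.
have j0 : (0 < j)%N.
  by case: j kE => // kE; move: qk; rewrite -[k]mul1n -[1%N](expn0 q) -kE pdiv_dvd.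
have kn : (k < n)%N.
  rewrite kE ltn_Pmull // -(expn0 q) ltn_exp2l ?prime_gt1 //.
rewrite kE nideal_split // sum_div // PoszM (IH k kn k0).
rewrite (@nideal_loc_char t m q pq j (chi q)) //; [| |exact: rq|exact: ram|exact: simple].
  rewrite mulr_suml; apply: eq_bigr => i _; rewrite mulr_sumr; apply: eq_bigr => d _.
  by rewrite chiM chiX.
by have := chile q; lia.
Qed.

(** * The quadratic character of a finite field *)

(** The Legendre symbol as a count of square roots, the form in which it enters the numbers of roots
    of quadratic polynomials. *)
Definition qchar (F : finFieldType) (a : F) : int := #|[set x : F | x ^+ 2 == a]|%:Z - 1.

(** Two integers among -1, 0, 1 differ by at most 2, so they can be compared in a field where 2 is
    invertible. *)
Lemma qchar_inj (F : fieldType) (two0 : (2 : F) != 0) (x y : int) : `|x| <= 1 -> `|y| <= 1 -> x%:~R = y%:~R :> F -> x = y.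
Proof.
move=> hx hy e.
have /eqP : (x - y)%:~R = 0 :> F by rewrite rmorphB /= e subrr.
have /or4P[|||/eqP] : [|| x - y == 0, x - y == 1, x - y == -1 | `|x - y| == 2] by lia.
- by rewrite subr_eq0 => /eqP.
- by move=> /eqP ->; rewrite oner_eq0.
- by move=> /eqP ->; rewrite rmorphN oppr_eq0 oner_eq0.
move=> h; have [->|->] : x - y = 2 \/ x - y = -2 by lia.
  by rewrite (negbTE two0).
by rewrite rmorphN oppr_eq0 (negbTE two0).
Qed.

Section QuadraticCharacter.
Variable F : finFieldType.
Hypothesis two0 : (2 : F) != 0.
Hypothesis oddF : odd #|F|.
Implicit Types a b : F.

Lemma sqr_eqE (x b : F) : (x ^+ 2 == b ^+ 2) = (x == b) || (x == - b).
Proof. by rewrite -subr_eq0 subr_sqr mulf_eq0 subr_eq0 addr_eq0. Qed.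

Lemma qchar0 : qchar (0 : F) = 0.
Proof.
rewrite /qchar (_ : [set x | _] = [set 0]) ?cards1 //.
by apply/setP => x; rewrite !inE sqrf_eq0.
Qed.

Lemma qchar_sqr b : b != 0 -> qchar (b ^+ 2) = 1.
Proof.
move=> b0; rewrite /qchar (_ : [set x | _] = [set b; - b]).
  rewrite cards2 (_ : b != - b) //; apply: contra b0.
  by rewrite -addr_eq0 -mulr2n -mulr_natl mulf_eq0 (negbTE two0).
by apply/setP => x; rewrite !inE sqr_eqE.
Qed.

Lemma qchar_nonsquare a : (forall b, b ^+ 2 != a) -> qchar a = -1.
Proof.
move=> h; rewrite /qchar (_ : [set x | _] = set0) ?cards0 //.
by apply/setP => x; rewrite !inE (negbTE (h x)).
Qed.

Lemma qcharP a : [\/ a = 0 /\ qchar a = 0, a != 0 /\ qchar a = 1 | a != 0 /\ qchar a = -1].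
Proof.
have [->|a0] := eqVneq a 0; first by constructor 1; rewrite qchar0.
case: (boolP [exists b, b ^+ 2 == a]) => [/existsP[b /eqP bE]|/existsPn h].
  constructor 2; split=> //; rewrite -bE; apply: qchar_sqr.
  by apply: contra a0 => /eqP b0; rewrite -bE b0 expr0n.
by constructor 3; split=> //; exact: qchar_nonsquare.
Qed.

Lemma qchar_le1 a : `|qchar a| <= 1.
Proof. by case: (qcharP a) => [[_ ->]|[_ ->]|[_ ->]]. Qed.

Lemma qchar_sum : \sum_(a : F) qchar a = 0 :> int.
Proof.
rewrite /qchar sumrB sumr_const natz.
apply/eqP; rewrite subr_eq0; apply/eqP.
rewrite -(big_morph Posz PoszD (erefl 0%:Z)); congr Posz.
under eq_bigr => a _ do rewrite -sum1dep_card big_mkcond.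
rewrite exchange_big /= -sum1_card; apply: eq_bigr => x _.
by rewrite (bigD1 (x ^+ 2)) //= eqxx big1 // => a; rewrite eq_sym => /negbTE ->.
Qed.

Let k := (#|F|.-1)./2.

Let cardFE : #|F| = (k.*2).+1.
Proof.
have c0 : (0 < #|F|)%N by apply/card_gt0P; exists 0.
rewrite /k -[LHS]prednK //; congr _.+1; rewrite even_halfK //.
by move: oddF; rewrite -{1}(prednK c0) /=.
Qed.

Let k0 : (0 < k)%N.
Proof.
have : (1 < #|F|)%N by exact: card_finRing_gt1.
by rewrite cardFE; case: k.
Qed.

(** The values of the character sum to zero, so there are exactly [k] nonzero squares, all roots of
    X^k - 1. A nonsquare with [a ^+ k = 1] would be one root too many. *)
Lemma qchar_euler a : (qchar a)%:~R = a ^+ (#|F|.-1)./2 :> F.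
Proof.
rewrite -/k.
have fermat b : b != 0 -> b ^+ k.*2 = 1.
  move=> b0; apply: (mulIf b0); rewrite -exprSr -cardFE expf_card mul1r //.
case: (qcharP a) => [[-> ->]|[a0 ch1]|[a0 ch1]].
- by rewrite expr0n; case: k k0.
- rewrite ch1.
  case: (boolP [exists b, b ^+ 2 == a]) => [/existsP[b /eqP bE]|/existsPn h].
    rewrite -bE -exprM mul2n fermat //.
    by apply: contra a0 => /eqP b0; rewrite -bE b0 expr0n.
  by rewrite (qchar_nonsquare h) in ch1.
- rewrite ch1.
  have : (a ^+ k) ^+ 2 == 1 ^+ 2 by rewrite -exprM muln2 fermat // expr1n.
  rewrite sqr_eqE => /orP[/eqP ak|/eqP -> //]; exfalso.
  pose S := [set x : F | (x != 0) && (qchar x == 1)].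
  have cS : #|S| = k.
    have := qchar_sum; rewrite (bigID (fun x => x \in S)) /=.
    rewrite (eq_bigr (fun=> 1)); last by move=> x; rewrite inE => /andP[_ /eqP].
    rewrite [X in _ + X](bigD1 0) /=; last by rewrite !inE eqxx.
    rewrite qchar0 add0r [X in _ + X](eq_bigr (fun=> -1)); last first.
      move=> x /andP[]; rewrite inE negb_and negbK.
      by case: (qcharP x) => [[-> _]|[_ ->]|[_ ->]] //; rewrite eqxx // orbF => ->.
    rewrite !sumr_const mulNrn => /eqP; rewrite subr_eq0 !natz eqz_nat => /eqP e.
    have := cardFE; rewrite -(cardC (mem S)) (cardD1 0 [predC S]) !inE eqxx /= e.
    have -> : #|[predD1 [predC S] & 0]| = #|[pred x | x \notin S & x != 0]|.
      by apply: eq_card => x; rewrite !inE andbC.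
    rewrite -(@eq_card _ (fun i => (i \notin S) && (i != 0))) //.
    lia.
  have aS : a \notin S by rewrite inE ch1 andbF.
  have Sroot : all (root ('X^k - 1%:P)) (a :: enum S).
    rewrite /= rootE !hornerE ak subrr eqxx /=; apply/allP => x; rewrite mem_enum inE.
    case/andP=> x0 /eqP x1; rewrite rootE !hornerE.
    case: (boolP [exists b, b ^+ 2 == x]) => [/existsP[b /eqP bE]|/existsPn h].
      rewrite -bE -exprM mul2n fermat ?subrr //.
      by apply: contra x0 => /eqP b0; rewrite -bE b0 expr0n.
    by rewrite (qchar_nonsquare h) in x1.
  have nz : 'X^k - 1%:P != 0 :> {poly F} by rewrite -size_poly_eq0 size_XnsubC.
  have := max_poly_roots nz Sroot; rewrite /= mem_enum aS enum_uniq => /(_ isT).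
  by rewrite size_XnsubC // -cardE cS ltnn.
Qed.

Lemma qcharM a b : qchar (a * b) = qchar a * qchar b.
Proof.
apply: (qchar_inj two0); first exact: qchar_le1.
  by rewrite normrM mulr_ile1 // qchar_le1.
by rewrite rmorphM /= !qchar_euler exprMn.
Qed.

Lemma qchar1 : qchar (1 : F) = 1.
Proof. by rewrite -[1](expr1n _ 2) qchar_sqr // oner_eq0. Qed.

Lemma qcharN1 : qchar (-1 : F) = (-1) ^+ (#|F|.-1)./2.
Proof.
apply: (qchar_inj two0); first exact: qchar_le1.
  by rewrite normrX normrN1 expr1n.
by rewrite qchar_euler rmorphXn /= rmorphN1.
Qed.

End QuadraticCharacter.

Lemma sum_shift_period (T : zmodType) (n : nat) (f : nat -> T) : f n = f 0%N ->
  \sum_(i < n) f i.+1 = \sum_(i < n) f i.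
Proof.
case: n => [|n] fn; first by rewrite !big_ord0.
by rewrite big_ord_recr /= fn [RHS]big_ord_recl addrC.
Qed.

Section PrimeField.
Variable p : nat.
Hypotheses (pp : prime p) (op : odd p).

Lemma Fp_two_neq0 : (2 : 'F_p) != 0.
Proof.
rewrite -(dvdn_pcharf (pchar_Fp pp)); apply/negP => /dvdn_leq - /(_ isT).
by case: p pp op => [|[|[|[]]]].
Qed.

Lemma odd_card_Fp : odd #|'F_p|.
Proof. by rewrite card_Fp. Qed.

Lemma Fp_nat_eq0 n : (n%:R == 0 :> 'F_p) = (p %| n)%N.
Proof. by rewrite -(dvdn_pcharf (pchar_Fp pp)). Qed.

Definition qcharn (n : nat) : int := qchar (n%:R : 'F_p).

Lemma qcharn_per d : qcharn (d + p) = qcharn d.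
Proof. by rewrite /qcharn natrD pchar_Fp_0 // addr0. Qed.

Lemma qcharnM a b : qcharn (a * b) = qcharn a * qcharn b.
Proof. by rewrite /qcharn natrM qcharM ?odd_card_Fp ?Fp_two_neq0. Qed.

Lemma qcharn1 : qcharn 1 = 1.
Proof. exact: qchar1 Fp_two_neq0. Qed.

Lemma qcharn_le1 d : `|qcharn d| <= 1.
Proof. exact: qchar_le1 Fp_two_neq0 _. Qed.

Lemma qcharn_eq0 d : (qcharn d == 0) = (p %| d)%N.
Proof.
rewrite -Fp_nat_eq0 /qcharn.
by case: (qcharP Fp_two_neq0 (d%:R : 'F_p)) => [[-> ->]|[/negbTE -> ->]|[/negbTE -> ->]]; rewrite ?eqxx.
Qed.

Lemma sum_Fp (T : nmodType) (f : 'F_p -> T) : \sum_x f x = \sum_(i < p) f i%:R.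
Proof.
have pE : (Zp_trunc (pdiv p)).+2 = p by rewrite Fp_cast.
rewrite (reindex (fun i : 'I_p => (i%:R : 'F_p))) //=.
exists (fun x => cast_ord pE x) => [i _|x _].
  by apply/val_inj; rewrite /= val_Fp_nat // modn_small.
by rewrite /= natr_Zp.
Qed.

Lemma qcharn_sum : \sum_(i < p) qcharn i.+1 = 0.
Proof.
by rewrite sum_shift_period ?(qcharn_per 0) // /qcharn -sum_Fp qchar_sum // Fp_two_neq0.
Qed.

End PrimeField.

(** * Gauss sums and quadratic reciprocity *)

Lemma intr_eq0_pchar (K : nzRingType) (q : nat) (n : int) : q \in [pchar K] ->
  (n%:~R == 0 :> K) = (q %| `|n|)%N.
Proof.
move=> ch; case: n => n; first by rewrite -[n%:~R]/(n%:R) -(dvdn_pcharf ch).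
by rewrite NegzE mulrNz oppr_eq0 -[n.+1%:~R]/(n.+1%:R) -(dvdn_pcharf ch) abszN.
Qed.

(** A field with [l ^ totient n] elements works: by Euler's theorem [n] divides the order of its
    unit group, which is cyclic. *)
Lemma prim_root_field (l n : nat) : prime l -> (0 < n)%N -> coprime l n ->
  exists (K : finFieldType) (z : K), l \in [pchar K] /\ n.-primitive_root z.
Proof.
move=> pl n0 cln; pose k := totient n.
have k0 : (0 < k)%N by rewrite totient_gt0.
have [K chK cardK] := pPrimePowerField pl k0.
have nd : (n %| (l ^ k).-1)%N.
  rewrite -subn1 -eqn_mod_dvd ?expn_gt0 ?prime_gt0 //; apply/eqP.
  exact: Euler_exp_totient.
have /cyclicP[g gE] := field_unit_group_cyclic [set: {unit K}]%G.
have og : #[g]%g = (l ^ k).-1 by rewrite orderE -gE /= card_finField_unit cardK.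
pose u := (g ^+ ((l ^ k).-1 %/ n))%g.
have l1 : (0 < (l ^ k).-1)%N.
  by rewrite -subn1 subn_gt0 -(expn0 l) ltn_exp2l ?prime_gt1.
have ou : #[u]%g = n.
  rewrite /u orderXdiv og ?dvdn_div // divnA ?mulKn //.
exists K, (val u); split=> //.
rewrite /primitive_root_of_unity n0 /=; apply/forallP => i; apply/eqP.
rewrite unity_rootE -FinRing.val_unitX.
have -> : (val (u ^+ i.+1)%g == 1 :> K) = (u ^+ i.+1 == 1)%g by [].
rewrite -order_dvdn ou; apply/idP/eqP => [/dvdn_leq h|-> //].
by apply/eqP; rewrite eqn_leq ltn_ord h.
Qed.

Section GaussSum.
Variables (p : nat) (K : fieldType) (z : K).
Hypotheses (pp : prime p) (op : odd p) (zp : p.-primitive_root z).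

Let e (x : 'F_p) : K := z ^+ x.
Let chi (x : 'F_p) : K := (qchar x)%:~R.
Let two0 := Fp_two_neq0 pp op.
Let oddF := odd_card_Fp pp op.

Let e_nat n : e n%:R = z ^+ n.
Proof. by rewrite /e val_Fp_nat // prim_expr_mod. Qed.

Let eD x y : e (x + y) = e x * e y.
Proof. by rewrite -[x in LHS]natr_Zp -[y in LHS]natr_Zp -natrD e_nat exprD. Qed.

Let eX x n : e x ^+ n = e (x * n%:R).
Proof. by rewrite -[x in RHS]natr_Zp -natrM e_nat exprM. Qed.

Let chiM x y : chi (x * y) = chi x * chi y.
Proof. by rewrite /chi qcharM // rmorphM. Qed.

Let chi_sqr x : x != 0 -> chi x * chi x = 1.
Proof.
by move=> x0; rewrite -chiM -expr2 /chi qchar_sqr.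
Qed.

Let sum_chi : \sum_x chi x = 0.
Proof. by rewrite /chi -rmorph_sum /= qchar_sum. Qed.

Let e_sum0 d : d != 0 -> \sum_x e (x * d) = 0.
Proof.
move=> d0; rewrite -(reindex_inj (mulIf d0) (P := xpredT) (F := e)) /=.
have /eqP : (\sum_x e x) * (e 1 - 1) = 0.
  rewrite mulrBr mulr1 mulr_suml.
  under eq_bigr do rewrite -eD.
  by rewrite -(reindex_inj (addIr 1) (P := xpredT) (F := e)) subrr.
rewrite mulf_eq0 => /orP[/eqP //|].
have e1 : e 1 = z ^+ 1 := e_nat 1.
rewrite e1 subr_eq0 -(prim_order_dvd zp) dvdn1.
by move=> /eqP p1; exfalso; move: pp; rewrite p1.
Qed.

Let e_sum d : \sum_x e (x * d) = if d == 0 then p%:R else 0.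
Proof.
case: ifP => [/eqP ->|/negbT]; last exact: e_sum0.
rewrite (eq_bigr (fun=> 1)) ?sumr_const ?card_Fp //.
by move=> x _; rewrite mulr0 -[0]/(0%:R) e_nat expr0.
Qed.

Definition gauss_sum : K := \sum_x chi x * e x.

Lemma gauss_sum_sqr : gauss_sum ^+ 2 = (qchar (-1 : 'F_p))%:~R * p%:R.
Proof.
rewrite expr2 {1}/gauss_sum mulr_suml.
(* For [x != 0] the variable of the inner Gauss sum is replaced by [x * c]. At [x = 0] the left side
   vanishes and the subtracted sum restores equality; that sum is zero by [sum_chi]. *)
have term x : chi x * e x * gauss_sum =
    \sum_c chi c * e (x * (1 + c)) - (if x == 0 then \sum_c chi c else 0).
  case: ifP => [/eqP->|/negbT x0].
    rewrite {1}/chi qchar0 mul0r mul0r.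
    apply/esym/eqP; rewrite subr_eq0; apply/eqP; apply: eq_bigr => c _.
    by rewrite mul0r -[0]/(0%:R) e_nat expr0 mulr1.
  rewrite subr0 /gauss_sum (reindex_inj (mulfI x0)) mulr_sumr /=.
  apply: eq_bigr => c _; rewrite mulrDr mulr1 eD chiM.
  rewrite (_ : chi x * e x * (chi x * chi c * e (x * c)) =
     (chi x * chi x) * (chi c * (e x * e (x * c)))); last by ring.
  by rewrite chi_sqr // mul1r.
under eq_bigr do rewrite term sum_chi.
rewrite (eq_bigr (fun x => \sum_c chi c * e (x * (1 + c)))); last first.
  by move=> x _; case: ifP; rewrite subr0.
rewrite exchange_big /=.
under eq_bigr do rewrite -mulr_sumr e_sum.
rewrite (bigD1 (-1)) //= subrr eqxx big1 ?addr0 // => c cN1.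
by rewrite addrC addr_eq0 (negbTE cN1) mulr0.
Qed.

Lemma gauss_sum_frobenius (q : nat) : q \in [pchar K] -> ~~ (p %| q)%N ->
  gauss_sum ^+ q = (qcharn p q)%:~R * gauss_sum.
Proof.
move=> chK pq.
have q0 : (q%:R : 'F_p) != 0 by rewrite Fp_nat_eq0.
rewrite -(pFrobenius_autE chK) /gauss_sum rmorph_sum /=.
transitivity (\sum_x chi x * e (x * q%:R)).
  apply: eq_bigr => x _; rewrite rmorphM /=; congr (_ * _); first by rewrite /chi rmorph_int.
  by rewrite pFrobenius_autE eX.
rewrite [in RHS](reindex_inj (mulIf q0)) mulr_sumr; apply: eq_bigr => x _ /=.
rewrite chiM -/(chi q%:R) (_ : chi q%:R * (chi x * chi q%:R * e (x * q%:R)) =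
   (chi q%:R * chi q%:R) * (chi x * e (x * q%:R))); last by ring.
by rewrite chi_sqr // mul1r.
Qed.

End GaussSum.

Lemma half_pred_odd (q : nat) : odd q -> q = ((q.-1)./2.*2).+1.
Proof. by move=> oq; lia. Qed.

Lemma pchar_two_neq0 (K : fieldType) (q : nat) : prime q -> odd q -> q \in [pchar K] -> (2 : K) != 0.
Proof.
move=> pq oq ch; rewrite -[2]/(2%:R) -(dvdn_pcharf ch); apply/negP => /dvdn_leq - /(_ isT).
by case: q pq oq {ch} => [|[|[|[]]]].
Qed.

(** Euler's criterion in ['F_q] is a congruence of integers modulo [q], so it can be read in any
    field of characteristic [q], in particular in one that contains the required roots of unity. *)
Lemma euler_transfer (q : nat) (K : finFieldType) (s : int) (c : int) :
  prime q -> odd q -> q \in [pchar K] -> `|c| <= 1 ->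
  s%:~R ^+ (q.-1)./2 = c%:~R :> K -> qchar (s%:~R : 'F_q) = c.
Proof.
move=> pq oq ch c1 sc.
have t0 := Fp_two_neq0 pq oq.
have le := qchar_le1 t0 (s%:~R : 'F_q).
apply: (@qchar_inj K (pchar_two_neq0 pq oq ch) _ _ le c1).
rewrite -sc; apply/eqP; rewrite eq_sym -subr_eq0 -rmorphXn /= -rmorphB /=.
rewrite (intr_eq0_pchar _ ch) -(intr_eq0_pchar _ (pchar_Fp pq)) rmorphB /= rmorphXn /=.
by rewrite qchar_euler ?odd_card_Fp // card_Fp // subrr.
Qed.

(** The prime with the sign (-1)^((p - 1) / 2), that is, the square of the Gauss sum. *)
Definition pstar (p : nat) : int := if (p %% 4 == 1)%N then p%:Z else - p%:Z.

Lemma qcharN1_mod4 (p : nat) : prime p -> odd p ->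
  qchar (-1 : 'F_p) = if (p %% 4 == 1)%N then 1 else -1.
Proof.
move=> pp op; rewrite (qcharN1 (Fp_two_neq0 pp op) (odd_card_Fp pp op)) card_Fp //.
have e : odd (p.-1)./2 = (p %% 4 != 1)%N by lia.
by rewrite -signr_odd e; case: ifP.
Qed.

(** With G the Gauss sum in characteristic [q], G ^ 2 is [pstar p] and Frobenius gives G ^ q =
    chi(q) G. Cancelling G turns [pstar p] to the power (q - 1) / 2 into chi(q). *)
Lemma quadratic_reciprocity (p q : nat) : prime p -> odd p -> prime q -> odd q -> p != q ->
  qchar ((pstar p)%:~R : 'F_q) = qcharn p q.
Proof.
move=> pp op pq oq npq.
have cop : coprime q p by rewrite prime_coprime // dvdn_prime2 // eq_sym.
have [K [z [chK zp]]] := prim_root_field pq (prime_gt0 pp) cop.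
apply: (euler_transfer pq oq chK); first exact: qcharn_le1.
have sq := gauss_sum_sqr pp op zp.
have qp : ~~ (p %| q)%N by rewrite dvdn_prime2.
have fr := gauss_sum_frobenius pp op zp chK qp.
set G := gauss_sum p z in sq fr.
have ps : (qchar (-1 : 'F_p))%:~R * p%:R = (pstar p)%:~R :> K.
  by rewrite qcharN1_mod4 // /pstar; case: ifP => _; rewrite ?mul1r // rmorphN mulN1r rmorphN.
have G0 : G != 0.
  rewrite -sqrf_eq0 sq ps (intr_eq0_pchar _ chK) /pstar.
  have -> : `|if (p %% 4 == 1)%N then p%:Z else - p%:Z|%N = p by case: ifP; lia.
  by rewrite dvdn_prime2 // eq_sym.
apply: (mulIf G0); rewrite -fr -ps -sq -exprM mul2n -exprSr -half_pred_odd //.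
Qed.

(** For a primitive 8th root of unity [z], [z - z ^ 3] is z + 1/z. It is a square root of 2, and
    Frobenius fixes or negates it according to [p] modulo 8. *)
Lemma qchar_two (p : nat) : prime p -> odd p -> (p %% 4 == 3)%N ->
  qcharn p 2 = if (p %% 8 == 3)%N then -1 else 1.
Proof.
move=> pp op p3.
have cop : coprime p 8 by rewrite (_ : 8 = 2 ^ 3)%N // coprimeXr // coprime_sym coprime2n.
have [K [z [chK z8]]] := prim_root_field pp (isT : (0 < 8)%N) cop.
have z4 : z ^+ 4 = -1.
  have /eqP : (z ^+ 4) ^+ 2 = 1 ^+ 2 by rewrite -exprM (prim_expr_order z8) expr1n.
  rewrite -subr_eq0 subr_sqr mulf_eq0 subr_eq0 addr_eq0 => /orP[|/eqP //].
  by rewrite -(prim_order_dvd z8).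
pose tau := z - z ^+ 3.
have tau2 : tau ^+ 2 = 2.
  have -> : tau ^+ 2 = z ^+ 2 - 2 * z ^+ 4 + z ^+ 4 * z ^+ 2 by rewrite /tau; ring.
  by rewrite z4; ring.
have two0 := pchar_two_neq0 pp op chK.
have tau0 : tau != 0 by rewrite -sqrf_eq0 tau2.
have taup : tau ^+ p = (if (p %% 8 == 3)%N then -1 else 1) * tau.
  rewrite -(pFrobenius_autE chK) /tau rmorphB /= !pFrobenius_autE -exprM mulnC exprM.
  rewrite -(prim_expr_mod z8 p).
  case: ifP => [/eqP ->|p83].
    have -> : (z ^+ 3) ^+ 3 = z ^+ 4 * z ^+ 4 * z by ring.
    by rewrite z4; ring.
  have -> : (p %% 8 = 7)%N by lia.
  have -> : (z ^+ 7) ^+ 3 = z ^+ 4 * z ^+ 4 * z ^+ 4 * z ^+ 4 * z ^+ 4 * z by ring.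
  have -> : z ^+ 7 = z ^+ 4 * z ^+ 3 by ring.
  by rewrite z4; ring.
rewrite /qcharn -[2%:R]/(2%:Z%:~R); apply: (euler_transfer pp op chK).
  by case: ifP.
rewrite -[2%:~R]/(2%:R) -tau2; apply: (mulIf tau0).
rewrite -exprM mul2n -exprSr -half_pred_odd // taup.
by case: ifP; rewrite ?rmorphN.
Qed.

(** * Root counts for the discriminants -p and -4 p *)

Lemma rho_Fp (t m q : nat) : prime q ->
  rho t m q = #|[set x : 'F_q | x ^+ 2 + t%:R * x + m%:R == 0]|.
Proof.
move=> pq; rewrite /rho -!sum1dep_card big_mkcond [RHS]big_mkcond /= (sum_Fp pq).
apply: eq_bigr => b _.
by rewrite -natrX -!natrM -!natrD Fp_nat_eq0.
Qed.

(** Completing the square: [x] is a root if and only if [2 * x + t] is a square root of the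
    discriminant, and this substitution is bijective for odd [q]. *)
Lemma rho_qchar (t m q : nat) : prime q -> odd q ->
  (rho t m q)%:Z = 1 + qchar ((t%:Z ^+ 2 - 4 * m%:Z)%:~R : 'F_q).
Proof.
move=> pq oq; rewrite rho_Fp // /qchar addrC subrK; congr Posz.
have two0 := Fp_two_neq0 pq oq.
pose f (x : 'F_q) : 'F_q := 2 * x + t%:R.
have finj : injective f by move=> x y /addIr /(mulfI two0).
have fbij : bijective f by apply: injF_bij.
rewrite -[in RHS](on_card_preimset (f := f)); last exact: onW_bij.
congr #|pred_of_set _|; apply/setP => x; rewrite !inE /f.
have -> : (t%:Z ^+ 2 - 4 * m%:Z)%:~R = t%:R ^+ 2 - 4 * m%:R :> 'F_q.
  by rewrite rmorphB /= rmorphXn /= rmorphM /=.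
rewrite -[RHS]subr_eq0.
have -> : (2 * x + t%:R) ^+ 2 - (t%:R ^+ 2 - 4 * m%:R) = 2 * 2 * (x ^+ 2 + t%:R * x + m%:R) by ring.
by rewrite !mulf_eq0 !(negbTE two0).
Qed.

Lemma rho_two (t m : nat) : rho t m 2 = ((~~ odd m) + (odd t == odd m.+1.+1.+1))%N.
Proof.
rewrite /rho -sum1dep_card big_mkcond /= !big_ord_recl big_ord0 /= /bump /= /qpoly addn0.
rewrite !dvdn2 !oddD /= muln0 muln1 /=.
by case: (odd t); case: (odd m).
Qed.

Section CaseThree.
Variable p : nat.
Hypotheses (pp : prime p) (p3 : (p %% 4 == 3)%N).
Let op : odd p. Proof. lia. Qed.
Let m := ((p + 1) %/ 4)%N.
Let mE : (4 * m = p + 1)%N. Proof. by rewrite /m; lia. Qed.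

Lemma qpoly_disc3 b : (4 * qpoly 1 m b = (2 * b + 1) ^ 2 + p)%N.
Proof.
have -> : (4 * qpoly 1 m b = 4 * b ^ 2 + 4 * b + 4 * m)%N by rewrite /qpoly; ring.
by rewrite mE; ring.
Qed.

(** Odd [q] is reciprocity. At [q = 2] the polynomial has two roots or none as [m] is even or odd,
    that is, as [p] is 7 or 3 modulo 8. *)
Lemma rho_case3 q : prime q -> (rho 1 m q)%:Z = 1 + qcharn p q.
Proof.
move=> pq; case: (even_prime pq) => [->|oq].
  rewrite rho_two qchar_two //=.
  by case: ifP => h; case: (boolP (odd m)) => //; lia.
rewrite rho_qchar //; congr (_ + _).
have -> : 1%:Z ^+ 2 - 4 * m%:Z = pstar p by rewrite /pstar; case: ifP; lia.
have [<-|npq] := eqVneq p q; last exact: quadratic_reciprocity.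
rewrite /qcharn; congr qchar; apply/eqP.
by rewrite pchar_Fp_0 // (intr_eq0_pchar _ (pchar_Fp pp)) /pstar; case: ifP; rewrite ?abszN /= dvdnn.
Qed.

Lemma nideal_case3 n : (0 < n)%N -> (nideal 1 m n)%:Z = \sum_(d <- divisors n) qcharn p d.
Proof.
apply: nideal_charE.
- exact: qcharn1.
- exact: qcharnM.
- exact: qcharn_le1.
- exact: rho_case3.
- move=> q pq /eqP; rewrite qcharn_eq0 // dvdn_prime2 // => /eqP <- b; apply/negP => h.
  have h4 : (p ^ 2 %| (2 * b + 1) ^ 2 + p)%N by rewrite -qpoly_disc3 dvdn_mull.
  have p2 : (p %| p ^ 2)%N by rewrite expnS dvdn_mulr.
  have pb : (p %| (2 * b + 1) ^ 2)%N by rewrite -(dvdn_addl _ (dvdnn p)) (dvdn_trans p2).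
  have {}pb : (p %| 2 * b + 1)%N by rewrite Euclid_dvdX // in pb; case/andP: pb.
  have : (p ^ 2 %| p)%N by rewrite -(dvdn_addr _ (dvdn_exp2r 2 pb)).
  move/(dvdn_leq (prime_gt0 pp)).
  by rewrite leqNgt -{1}(expn1 p) ltn_exp2l ?prime_gt1.
move=> q pq /eqP; rewrite qcharn_eq0 // dvdn_prime2 // => /negP nq b qb; apply/negP => h.
apply: nq; have : (q %| (2 * b + 1) ^ 2 + p)%N by rewrite -qpoly_disc3 dvdn_mull.
rewrite dvdn_addr; last exact: dvdn_exp.
by rewrite dvdn_prime2 // eq_sym.
Qed.

End CaseThree.

Definition chi4 (d : nat) : int :=
  if odd d then (if (d %% 4 == 1)%N then 1 else -1) else 0.

Lemma chi4M a b : chi4 (a * b) = chi4 a * chi4 b.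
Proof.
rewrite /chi4 oddM; case oa: (odd a); case ob: (odd b); rewrite ?mulr0 ?mul0r //=.
have ha : ((a %% 4 = 1) \/ (a %% 4 = 3))%N by lia.
have hb : ((b %% 4 = 1) \/ (b %% 4 = 3))%N by lia.
by rewrite -modnMm; case: ha => ->; case: hb => ->.
Qed.

Section CaseOne.
Variable p : nat.
Hypotheses (pp : prime p) (p1 : (p %% 4 == 1)%N).
Let op : odd p. Proof. lia. Qed.

(** For [p] = 1 modulo 4 the field discriminant is -4 p, and this is its Kronecker symbol. *)
Definition chi_four (d : nat) : int := chi4 d * qcharn p d.

Lemma chi_four_per d : chi_four (d + 4 * p) = chi_four d.
Proof.
rewrite /chi_four /qcharn natrD natrM pchar_Fp_0 // mulr0 addr0; congr (_ * _).
rewrite /chi4 oddD oddM addbF [(4 * p)%N]mulnC addnC modnMDl. done.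
Qed.

Lemma chi4_le1 d : `|chi4 d| <= 1.
Proof. by rewrite /chi4; case: ifP => // _; case: ifP. Qed.

Lemma chi_four_le1 d : `|chi_four d| <= 1.
Proof. by rewrite /chi_four normrM mulr_ile1 // ?chi4_le1 // qcharn_le1. Qed.

Lemma chi_fourM a b : chi_four (a * b) = chi_four a * chi_four b.
Proof. by rewrite /chi_four chi4M qcharnM // mulrACA. Qed.

Lemma chi_four1 : chi_four 1 = 1.
Proof. by rewrite /chi_four qcharn1. Qed.

(** Since 2 p is 2 modulo 4, the shift changes the factor modulo 4 only. The antisymmetry makes the
    two halves of a period cancel. *)
Lemma chi_four_half d : chi_four (d + 2 * p) = - chi_four d.
Proof.
rewrite /chi_four /qcharn natrD natrM pchar_Fp_0 // mulr0 addr0 -mulNr; congr (_ * _).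
have e : odd (d + 2 * p) = odd d by rewrite oddD oddM addbF.
rewrite /chi4 e; case od: (odd d); last by rewrite oppr0.
have -> : ((d + 2 * p) %% 4 == 1)%N = (d %% 4 != 1)%N by lia.
by case: (_ == _); rewrite ?opprK.
Qed.

Lemma chi_four_sum : \sum_(i < 4 * p) chi_four i.+1 = 0.
Proof.
have -> : (4 * p = 2 * p + 2 * p)%N by rewrite -mulnDl.
rewrite big_split_ord /= -big_split /= big1 // => i _.
by rewrite -addnS addnC chi_four_half subrr.
Qed.

Lemma rho_case1 q : prime q -> (rho 0 p q)%:Z = 1 + chi_four q.
Proof.
move=> pq; case: (even_prime pq) => [->|oq].
  by rewrite rho_two /chi_four /chi4 /= mul0r op.
rewrite rho_qchar // expr0n /= sub0r; congr (_ + _).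
have two0 := Fp_two_neq0 pq oq; have oF := odd_card_Fp pq oq.
have -> : (- (4 * p%:Z))%:~R = 2 ^+ 2 * (-1 * (pstar p)%:~R) :> 'F_q.
  rewrite /pstar p1 rmorphN rmorphM /= -[4%:~R]/(4%:R); ring.
rewrite qcharM // qchar_sqr // mul1r qcharM // qcharN1_mod4 // /chi_four /chi4 oq.
congr (_ * _); have [<-|npq] := eqVneq p q; last exact: quadratic_reciprocity.
rewrite /qcharn; congr qchar; apply/eqP.
by rewrite pchar_Fp_0 // (intr_eq0_pchar _ (pchar_Fp pp)) /pstar p1 dvdnn.
Qed.

Lemma nideal_case1 n : (0 < n)%N -> (nideal 0 p n)%:Z = \sum_(d <- divisors n) chi_four d.
Proof.
have bad q : prime q -> (chi_four q == 0) = (q == 2%N) || (q == p).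
  move=> pq; rewrite /chi_four mulf_eq0 qcharn_eq0 // dvdn_prime2 // [p == q]eq_sym.
  congr (_ || _); rewrite /chi4; case: (even_prime pq) => [-> //|oq].
  rewrite oq; have -> : (q == 2%N) = false by lia.
  by case: ifP.
apply: nideal_charE.
- exact: chi_four1.
- exact: chi_fourM.
- exact: chi_four_le1.
- exact: rho_case1.
- move=> q pq /eqP; rewrite bad // => /orP[] /eqP -> b; apply/negP => h.
    (* The ramified prime 2: as [p] is 1 modulo 4, [b ^ 2 + p] is 1 or 2 modulo 4. *)
    have hb : ((b ^ 2) %% 4 = 0 \/ (b ^ 2) %% 4 = 1)%N.
      rewrite -modnXm; have : (b %% 4 < 4)%N by rewrite ltn_pmod.
      by case: (b %% 4)%N => [|[|[|[|]]]] //= _; [left|right|left|right].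
    move: h; rewrite /qpoly mul0n addn0 /dvdn -modnDm (eqP p1).
    by case: hb => ->.
  have p2 : (p %| p ^ 2)%N by rewrite expnS dvdn_mulr.
  have h' : (p ^ 2 %| b ^ 2 + p)%N by move: h; rewrite /qpoly mul0n addn0.
  have pb : (p %| b ^ 2)%N by rewrite -(dvdn_addl _ (dvdnn p)) (dvdn_trans p2).
  have {}pb : (p %| b)%N by rewrite Euclid_dvdX // in pb; case/andP: pb.
  have : (p ^ 2 %| p)%N.
    by move: h; rewrite /qpoly mul0n addn0 (dvdn_addr _ (dvdn_exp2r 2 pb)).
  move/(dvdn_leq (prime_gt0 pp)).
  by rewrite leqNgt -{1}(expn1 p) ltn_exp2l ?prime_gt1.
move=> q pq /eqP; rewrite bad // negb_or => /andP[q2 qp] b qb.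
rewrite addn0; apply: contra qp; rewrite Euclid_dvdM // dvdn_prime2 // (negbTE q2) /= => qdb.
have qb2 : (q %| b ^ 2)%N by rewrite dvdn_exp.
by move: qb; rewrite /qpoly mul0n addn0 (dvdn_addr _ qb2) dvdn_prime2.
Qed.

End CaseOne.

(** * Fractional parts of squares *)

(** At [rat] this unfolds to [frac_part], so results about it apply to the trace by conversion. *)
Definition fracp (F : archiRealFieldType) (x : F) : F := x - (Num.floor x)%:~R.

Section FractionalPart.
Variable F : archiRealFieldType.
Implicit Types (x y z : F) (n : int).

Lemma fracp_ge0 x : 0 <= fracp x.
Proof. by rewrite subr_ge0 ge_floor. Qed.

Lemma fracp_lt1 x : fracp x < 1.
Proof. by have := floorD1_gt x; rewrite intrD /fracp; lra. Qed.

Lemma fracp_unique x n y : x = n%:~R + y -> 0 <= y < 1 -> fracp x = y.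
Proof.
move=> -> /andP[y0 y1]; rewrite /fracp (_ : Num.floor _ = n); first by rewrite addrAC subrr add0r.
by apply: floor_def; rewrite intrD; apply/andP; split; lra.
Qed.

Lemma fracpDz x n : fracp (x + n%:~R) = fracp x.
Proof.
apply: (@fracp_unique _ (Num.floor x + n)); last by rewrite fracp_ge0 fracp_lt1.
by rewrite /fracp intrD; ring.
Qed.

Lemma fracpN x : x \isn't a Num.int -> fracp (- x) = 1 - fracp x.
Proof.
move=> xi; apply: (@fracp_unique _ (- Num.floor x - 1)).
  by rewrite /fracp rmorphB rmorphN /=; ring.
have := fracp_lt1 x; have := fracp_ge0 x.
have : fracp x != 0.
  apply: contra xi; rewrite subr_eq0 => /eqP ->; exact: intr_int.
by move=> h1 h2 h3; apply/andP; split; lra.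
Qed.

Lemma fracp0 : fracp (0 : F) = 0.
Proof. by apply: (@fracp_unique _ 0); [rewrite addr0|rewrite lexx ltr01]. Qed.

Lemma fracp_int n : fracp (n%:~R : F) = 0.
Proof. by rewrite -[n%:~R]add0r fracpDz fracp0. Qed.

Lemma sum_id_nat (M : nat) : (\sum_(j < M) j%:R : F) = M%:R * (M%:R - 1) / 2.
Proof.
elim: M => [|M IH]; first by rewrite big_ord0 mul0r mul0r.
by rewrite big_ord_recr /= IH -natr1; field.
Qed.

Lemma fracp_sum_shift y (M : nat) : (0 < M)%N ->
  \sum_(j < M) fracp (y + M%:R^-1 + j%:R / M%:R) = \sum_(j < M) fracp (y + j%:R / M%:R).
Proof.
case: M => // M _.
have MR : (M.+1%:R : F) != 0 by rewrite pnatr_eq0.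
rewrite big_ord_recr [RHS]big_ord_recl /= mul0r addr0 addrC; congr (_ + _).
  have -> : y + M.+1%:R^-1 + M%:R / M.+1%:R = y + 1 by rewrite -natr1 in MR *; field.
  exact: (fracpDz y 1).
apply: eq_bigr => i _; congr fracp; rewrite /bump /= add1n -[i.+1%:R]natr1 mulrDl mul1r.
by rewrite -addrA [_^-1 + _]addrC.
Qed.

(* Shifting [z] by [1/M] permutes the summands, which reduces to [0 <= z < 1/M]. *)
Lemma fracp_distribution z (M : nat) : (0 < M)%N ->
  \sum_(j < M) fracp (z + j%:R / M%:R) = fracp (M%:R * z) + (M%:R - 1) / 2.
Proof.
move=> M0; have MR : (M%:R : F) != 0 by rewrite pnatr_eq0 -lt0n.
have MP : 0 < (M%:R : F) by rewrite ltr0n.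
pose S y := \sum_(j < M) fracp (y + j%:R / M%:R).
have shift y : S (y + M%:R^-1) = S y := fracp_sum_shift y M0.
have shiftn y (n : nat) : S (y + n%:R / M%:R) = S y.
  elim: n => [|n IH]; first by rewrite mul0r addr0.
  by rewrite -natr1 mulrDl mul1r addrA shift.
have shiftz y (n : int) : S (y + n%:~R / M%:R) = S y.
  case: n => n; first exact: shiftn.
  rewrite -(shiftn (y + _) n.+1); congr S.
  by rewrite NegzE mulrNz mulNr -[n.+1%:~R]/(n.+1%:R) subrK.
pose f := Num.floor (M%:R * z); pose y := fracp (M%:R * z) / M%:R.
have zE : z = y + f%:~R / M%:R.
  by rewrite /y /fracp -/f -mulrDl subrK mulrAC divff // mul1r.
rewrite -/(S z) {1}zE shiftz.
have y0 := fracp_ge0 (M%:R * z); have y1 := fracp_lt1 (M%:R * z).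
rewrite /S (eq_bigr (fun j : 'I_M => y + j%:R / M%:R)); last first.
  move=> j _; apply: (@fracp_unique _ 0); first by rewrite add0r.
  rewrite /y -mulrDl; apply/andP; split.
    by apply: divr_ge0; [apply: addr_ge0; [exact: y0|exact: ler0n]|exact: ler0n].
  rewrite ltr_pdivrMr // mul1r.
  apply: (@lt_le_trans _ _ (1 + j%:R)); first by rewrite ltrD2r.
  by rewrite addrC natr1 ler_nat ltn_ord.
rewrite big_split /= sumr_const card_ord -mulr_suml sum_id_nat /y.
by rewrite -mulr_natr; field.
Qed.

Lemma fracp_distributionN z (M : nat) : (0 < M)%N ->
  \sum_(j < M) fracp (z - j%:R / M%:R) = fracp (M%:R * z) + (M%:R - 1) / 2.
Proof.
move=> M0; have MR : (M%:R : F) != 0 by rewrite pnatr_eq0 -lt0n.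
rewrite (reindex_inj rev_ord_inj) /=.
have -> : fracp (M%:R * z) = fracp (M%:R * (z - (M%:R - 1) / M%:R)).
  have -> : M%:R * (z - (M%:R - 1) / M%:R) = M%:R * z + (1 - M%:Z)%:~R.
    by rewrite rmorphB /=; field.
  by rewrite fracpDz.
rewrite -fracp_distribution //; apply: eq_bigr => j _; congr fracp.
rewrite natrB ?ltn_ord // -[j.+1%:R]natr1; by field.
Qed.

End FractionalPart.

Lemma sum_shift_periodn (T : zmodType) (n k : nat) (g : nat -> T) :
  (forall i, g (i + n)%N = g i) -> \sum_(i < n) g (i + k)%N = \sum_(i < n) g i.
Proof.
move=> per; elim: k => [|k IH]; first by apply: eq_bigr => i _; rewrite addn0.
rewrite -IH -(@sum_shift_period _ n (fun i => g (i + k)%N)); last by rewrite add0n addnC per.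
by apply: eq_bigr => i _; rewrite addnS.
Qed.

Lemma sum_block (T : nmodType) (n q : nat) (g : nat -> T) :
  \sum_(y < n * q) g y = \sum_(j < n) \sum_(s < q) g (j * q + s)%N.
Proof.
elim: n => [|n IH]; first by rewrite mul0n !big_ord0.
by rewrite mulSnr big_split_ord big_ord_recr /= -IH.
Qed.

Lemma sum_block_eq (T : nmodType) (N n q : nat) (g : nat -> T) : N = (n * q)%N ->
  \sum_(y < N) g y = \sum_(j < n) \sum_(s < q) g (j * q + s)%N.
Proof. by move=> ->; exact: sum_block. Qed.

Lemma sum_periodic_block (T : zmodType) (n q : nat) (g : nat -> T) :
  (forall i, g (i + q)%N = g i) -> \sum_(y < n * q) g y = (\sum_(s < q) g s) *+ n.
Proof.
move=> per; rewrite sum_block (eq_bigr (fun=> \sum_(s < q) g s)) ?sumr_const ?card_ord //.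
move=> j _; apply: eq_bigr => s _; elim: (j : nat) => // j' IH.
by rewrite mulSn -addnA addnC per.
Qed.

Section SquareSums.
Variable F : archiRealFieldType.
Variable p : nat.
Hypotheses (pp : prime p) (op : odd p).
Let p0 : (0 < p)%N := prime_gt0 pp.
Let pF : (p%:R : F) != 0. Proof. by rewrite pnatr_eq0 -lt0n. Qed.
Local Notation chi s := ((qcharn p s)%:~R : F).

(** Square roots of [s] modulo [n] are roots of the polynomial with t = 0 and constant term [n - s].
    They are simple because [p] is odd and [s] is a unit, so their number is the one modulo [p]. *)
Lemma count_sqrt (r s : nat) : ~~ (p %| s)%N -> (s < p ^ r.+1)%N ->
  #|[set y : 'I_(p ^ r.+1) | (y ^ 2 %% p ^ r.+1 == s)%N]|%:Z = 1 + qcharn p s.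
Proof.
move=> ps sl; set n := (p ^ r.+1)%N in sl *.
have pn : (p %| n)%N by rewrite /n expnS dvdn_mulr.
have sn : (s + (n - s) = n)%N by rewrite subnKC // ltnW.
have -> : #|[set y : 'I_n | (y ^ 2 %% n == s)%N]| = rho 0 (n - s) n.
  apply: eq_card => y; rewrite !inE /qpoly mul0n addn0.
  have -> : (n %| y ^ 2 + (n - s))%N = (y ^ 2 + (n - s) == s + (n - s) %[mod n])%N.
    by rewrite sn modnn.
  by rewrite eqn_modDr (modn_small sl).
rewrite /n rho_pow // -/n.
  rewrite rho_qchar // expr0n /= sub0r; congr (_ + _).
  have two0 := Fp_two_neq0 pp op; have oF := odd_card_Fp pp op.
  rewrite /qcharn.
  have -> : (- (4 * (n - s)%N%:Z))%:~R = 2 ^+ 2 * s%:R :> 'F_p.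
    have e : ((n - s)%N%:R : 'F_p) = - s%:R.
      apply/eqP; rewrite -addr_eq0 -natrD subnK ?(ltnW sl) // Fp_nat_eq0 //.
    by rewrite rmorphN rmorphM /= -[(n - s)%N%:~R]/((n - s)%N%:R) e -[4%:~R]/(4%:R); ring.
  by rewrite qcharM // qchar_sqr // mul1r.
move=> b pb; rewrite addn0 Euclid_dvdM // dvdn_prime2 //.
have -> : (p == 2)%N = false by case: eqP op => // ->.
apply: contra ps => /= pdb; have : (p %| n - s)%N.
  by move: pb; rewrite /qpoly mul0n addn0 dvdn_addr // dvdn_exp.
by rewrite dvdn_subr // ltnW.
Qed.

Lemma sum_unit_squares (r : nat) (g : nat -> F) :
  \sum_(y < p ^ r.+1 | ~~ (p %| y)%N) g (y ^ 2 %% p ^ r.+1)%N =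
  \sum_(s < p ^ r.+1 | ~~ (p %| s)%N) (1 + chi s) * g s.
Proof.
set n := (p ^ r.+1)%N; have n0 : (0 < n)%N by rewrite expn_gt0 p0.
have pn : (p %| n)%N by rewrite /n expnS dvdn_mulr.
transitivity (\sum_(y < n | ~~ (p %| y)%N) \sum_(s < n | ~~ (p %| s)%N)
    (if (y ^ 2 %% n == s)%N then g s else 0)).
  apply: eq_bigr => y py.
  have h : (y ^ 2 %% n < n)%N by rewrite ltn_pmod.
  have py2 : ~~ (p %| y ^ 2 %% n)%N by rewrite /dvdn modn_dvdm // -/(dvdn p _) Euclid_dvdX // andbT.
  rewrite (bigD1 (Ordinal h)) //= eqxx big1 ?addr0 // => s /andP[_ sy].
  by case: eqP => // e; case/negP: sy; apply/eqP/val_inj; rewrite /= e.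
rewrite (exchange_big_dep (fun s : 'I_n => ~~ (p %| s)%N)) //=; apply: eq_bigr => s ps.
rewrite -[1 + chi s](_ : (1 + qcharn p s)%:~R = _); last by rewrite rmorphD.
rewrite -(count_sqrt ps (ltn_ord s)) -/n -[(_%:Z)%:~R]/(_%:R).
rewrite -sum1dep_card natr_sum mulr_suml big_mkcond [RHS]big_mkcond /=; apply: eq_bigr => y _.
case: (eqVneq (y ^ 2 %% n)%N (s : nat)) => [e|_]; last by rewrite if_same.
have py : ~~ (p %| y)%N.
  by apply: contra ps => h; rewrite -e /dvdn modn_dvdm // -/(dvdn p _) dvdn_exp.
by rewrite py /= ps mul1r.
Qed.

(** The shift [al] lets one sum serve both parities of [x]: even [x] give [al = 0], odd [x] give
    -p^r / 4 ([trace_sum_split]). *)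
Definition tsum (r : nat) (al : F) : F := \sum_(y < p ^ r) fracp (al - (y ^ 2)%:R / (p ^ r)%:R).

Definition fsum (z : F) : F := \sum_(s < p) chi s * fracp (z - s%:R / p%:R).

Lemma tsum0 al : tsum 0 al = fracp al.
Proof. by rewrite /tsum expn0 big_ord1 /= exp0n // mul0r subr0. Qed.

Lemma tsumDz r al (n : int) : tsum r (al + n%:~R) = tsum r al.
Proof. by apply: eq_bigr => y _; rewrite addrAC fracpDz. Qed.

Lemma fsumDz z (n : int) : fsum (z + n%:~R) = fsum z.
Proof. by apply: eq_bigr => y _; rewrite addrAC fracpDz. Qed.

Lemma fracp_mod (al : F) (n x : nat) : (0 < n)%N ->
  fracp (al - x%:R / n%:R) = fracp (al - (x %% n)%:R / n%:R).
Proof.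
move=> n0; have nF : (n%:R : F) != 0 by rewrite pnatr_eq0 -lt0n.
rewrite -[RHS](@fracpDz _ _ (- (x %/ n)%:Z)); congr fracp.
rewrite rmorphN /= -[((x %/ n)%N%:Z)%:~R]/((x %/ n)%:R) -addrA -opprD; congr (_ - _).
by rewrite {1}(divn_eq x n) natrD natrM mulrDl mulfK // addrC.
Qed.

Lemma sum_chi_units : \sum_(s < p | ~~ (p %| s)%N) (1 + chi s) = p%:R - 1.
Proof.
have z : \sum_(s < p) chi s = 0.
  have := qcharn_sum pp; rewrite sum_shift_period; last exact: (qcharn_per pp 0).
  by move/(congr1 (fun m : int => m%:~R : F)); rewrite rmorph_sum.
have : \sum_(s < p) (1 + chi s) = p%:R by rewrite big_split /= z addr0 sumr_const card_ord.
rewrite (bigD1 (Ordinal p0)) //= (_ : qcharn p 0 = 0); last first.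
  by apply/eqP; rewrite qcharn_eq0.
rewrite addr0 => <-; rewrite addrAC subrr add0r; apply: eq_bigl => s.
by rewrite -val_eqE /=; case: (s : nat) (ltn_ord s) => [|s'] sl; rewrite ?dvdn0 // gtnNdvd.
Qed.

(** Grouping by the value of the square introduces the weight 1 + chi. This weight depends only on
    the residue modulo [p], so within each residue class the distribution relation sums the
    fractional parts and leaves a sum over residues modulo [p]. *)
Lemma unit_tsum (r : nat) (al : F) :
  \sum_(y < p ^ r.+1 | ~~ (p %| y)%N) fracp (al - (y ^ 2)%:R / (p ^ r.+1)%:R) =
  (p%:R - 1) * (p ^ r)%:R / 2 + fracp ((p ^ r.+1)%:R * al) - fracp ((p ^ r)%:R * al)
   + fsum ((p ^ r)%:R * al).
Proof.
set n := (p ^ r.+1)%N; set M := (p ^ r)%N.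
have n0 : (0 < n)%N by rewrite expn_gt0 p0.
have M0 : (0 < M)%N by rewrite expn_gt0 p0.
have nE : n = (M * p)%N by rewrite /n expnSr.
have MF : (M%:R : F) != 0 by rewrite pnatr_eq0 -lt0n.
under eq_bigr do rewrite fracp_mod //.
rewrite (sum_unit_squares r (fun s => fracp (al - s%:R / n%:R))) -/n.
rewrite big_mkcond /= nE (@sum_block _ M p (fun s => if ~~ (p %| s)%N then (1 + chi s) * fracp (al - s%:R / (M * p)%:R) else 0)).
rewrite exchange_big /=.
transitivity (\sum_(s < p | ~~ (p %| s)%N) (1 + chi s) * (fracp (M%:R * al - s%:R / p%:R) + (M%:R - 1) / 2)).
  rewrite [RHS]big_mkcond /=; apply: eq_bigr => s _.
  have dvE j : (p %| j * p + s)%N = (p %| s)%N by rewrite dvdn_addr // dvdn_mull.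
  case: ifP => ps; last by rewrite big1 // => j _; rewrite dvE ps.
  have -> : M%:R * al - s%:R / p%:R = M%:R * (al - s%:R / (M * p)%:R).
    by rewrite natrM; field; rewrite pF MF.
  rewrite -fracp_distributionN // mulr_sumr; apply: eq_bigr => j _; rewrite dvE ps.
  have -> : qcharn p (j * p + s) = qcharn p s.
    by rewrite /qcharn natrD natrM pchar_Fp_0 // mulr0 add0r.
  by congr (_ * fracp _); rewrite natrD !natrM; field; rewrite pF MF.
under eq_bigr do rewrite mulrDr.
rewrite big_split /= -mulr_suml sum_chi_units.
have -> : \sum_(s < p | ~~ (p %| s)%N) (1 + chi s) * fracp (M%:R * al - s%:R / p%:R) =
   fracp ((M * p)%:R * al) + (p%:R - 1) / 2 - fracp (M%:R * al) + fsum (M%:R * al).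
  transitivity (\sum_(s < p) (1 + chi s) * fracp (M%:R * al - s%:R / p%:R) - fracp (M%:R * al)).
    rewrite [in RHS](bigD1 (Ordinal p0)) //= (_ : qcharn p 0 = 0); last first.
      by apply/eqP; rewrite qcharn_eq0.
    rewrite addr0 mul1r mul0r subr0 addrAC subrr add0r; apply: eq_bigl => s.
    by rewrite -val_eqE /=; case: (s : nat) (ltn_ord s) => [|s'] sl; rewrite ?dvdn0 // gtnNdvd.
  under eq_bigr do rewrite mulrDl mul1r.
  rewrite big_split /= -/(fsum _) fracp_distributionN // natrM mulrA [p%:R * _]mulrC.
  ring.
by field.
Qed.

Lemma tsum1 al : tsum 1 al = (p%:R - 1) / 2 + fracp (p%:R * al) + fsum al.
Proof.
rewrite /tsum (bigID (fun y : 'I_(p ^ 1) => (p %| y)%N)) /= (unit_tsum 0 al) expn0 expn1 !mul1r mulr1.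
have -> : \sum_(i < p ^ 1 | (p %| i)%N) fracp (al - (i ^ 2)%:R / p%:R) = fracp al.
  rewrite expn1 (big_pred1 (Ordinal p0)) /=; first by rewrite exp0n // mul0r subr0.
  move=> s; rewrite /= -val_eqE /=; case: (s : nat) (ltn_ord s) => [|s'] sl; rewrite ?dvdn0 //.
  by rewrite gtnNdvd.
ring.
Qed.

(** A multiple [j * p] contributes j ^ 2 / p ^ r, whose period in [j] is [p ^ r], while [j] runs
    over [p ^ r.+1] values: hence [p] copies of [tsum r]. *)
Lemma tsumSS r al : tsum r.+2 al =
  (p%:R - 1) * (p ^ r.+1)%:R / 2 + fracp ((p ^ r.+2)%:R * al) - fracp ((p ^ r.+1)%:R * al)
   + fsum ((p ^ r.+1)%:R * al) + p%:R * tsum r al.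
Proof.
rewrite /tsum (bigID (fun y : 'I_(p ^ r.+2) => (p %| y)%N)) /= (unit_tsum r.+1 al) addrC.
congr (_ + _).
pose g y : F := fracp (al - (y ^ 2)%:R / (p ^ r.+2)%:R).
have nE : (p ^ r.+2 = p ^ r.+1 * p)%N by rewrite expnSr.
rewrite big_mkcond /= (sum_block_eq (fun y => if (p %| y)%N then g y else 0) nE).
transitivity (\sum_(j < p ^ r.+1) fracp (al - (j ^ 2)%:R / (p ^ r)%:R)).
  apply: eq_bigr => j _; rewrite (bigD1 (Ordinal p0)) //= addn0 dvdn_mull // big1 ?addr0.
    have rF : ((p ^ r)%:R : F) != 0 by rewrite pnatr_eq0 -lt0n expn_gt0 p0.
    have p2F : ((p ^ 2)%:R : F) != 0 by rewrite pnatr_eq0 -lt0n expn_gt0 p0.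
    rewrite /g; congr (fracp (_ - _)).
    have -> : (p ^ r.+2 = p ^ r * p ^ 2)%N by rewrite -expnD addn2.
    by rewrite expnMn (natrM _ (j ^ 2)%N) (natrM _ (p ^ r)%N) -mulf_div divff // mulr1.
  move=> s; rewrite -val_eqE /= => s0; rewrite dvdn_addr ?dvdn_mull //.
  by rewrite gtnNdvd // lt0n.
rewrite expnS (@sum_periodic_block _ p (p ^ r) (fun j => fracp (al - (j ^ 2)%:R / (p ^ r)%:R))).
  by rewrite mulr_natl.
have r0 : (0 < p ^ r)%N by rewrite expn_gt0 p0.
by move=> i; rewrite fracp_mod // [RHS]fracp_mod // -modnXm modnDr modnXm.
Qed.

End SquareSums.

Lemma char_mean_linear (F : realFieldType) (chi : nat -> F) (P : nat) : (0 < P)%N ->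
  \sum_(i < P) chi i.+1 = 0 ->
  char_mean chi P = - (\sum_(i < P) chi i.+1 * i.+1%:R) / P%:R.
Proof.
move=> P0 s0; rewrite /char_mean; congr (_ / _).
rewrite (@abel_summation F P (fun i => chi i.+1) (fun i => i.+1%:R)) s0 mul0r addr0 -sumrN.
apply: eq_bigr => i _; rewrite -[i.+2%:R]natr1 opprD addrA subrr sub0r mulrN1 opprK //.
Qed.

(** * Relations between the weighted sums of fractional parts *)

Section Relations.
Variable F : archiRealFieldType.
Variable p : nat.
Hypotheses (pp : prime p) (op : odd p).
Let p0 : (0 < p)%N := prime_gt0 pp.
Let pF : (p%:R : F) != 0. Proof. by rewrite pnatr_eq0 -lt0n. Qed.
Local Notation chi s := ((qcharn p s)%:~R : F).
Local Notation f := (@fsum F p).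

Let two0 := Fp_two_neq0 pp op.
Let oF := odd_card_Fp pp op.

Lemma fsum_Fp z : f z = \sum_(x : 'F_p) (qchar x)%:~R * fracp (z - (x : nat)%:R / p%:R).
Proof.
rewrite sum_Fp //; apply: eq_bigr => s _; rewrite /qcharn.
by rewrite val_Fp_nat // modn_small.
Qed.

Lemma fracp_Fp (al : F) (n : nat) :
  fracp (al - ((n%:R : 'F_p) : nat)%:R / p%:R) = fracp (al - n%:R / p%:R).
Proof. by rewrite val_Fp_nat // -fracp_mod. Qed.

Lemma fracp_lift (y : 'F_p) (a : int) (z : F) : y = a%:~R ->
  fracp (z + (y : nat)%:R / p%:R) = fracp (z + a%:~R / p%:R).
Proof.
move=> ya; have [m mE] : exists m : int, (y : nat)%:Z = a + m * p%:Z.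
  have : (p%:Z %| (y : nat)%:Z - a)%Z.
    rewrite dvdzE /= -(intr_eq0_pchar _ (pchar_Fp pp)) rmorphB /=.
    by rewrite -[((_ : nat)%:Z)%:~R]/((y : nat)%:R) natr_Zp ya subrr.
  by case/dvdzP=> m h; exists m; rewrite -h; ring.
rewrite -[(y : nat)%:R]/((y : nat)%:Z%:~R) mE rmorphD rmorphM /= mulrDl mulfK // addrA.
by rewrite fracpDz.
Qed.

Lemma sum_qchar : \sum_(x : 'F_p) (qchar x)%:~R = 0 :> F.
Proof. by rewrite -rmorph_sum /= qchar_sum. Qed.

(** The distribution relation in [j] turns s / p into k s / p; the substitution of [k * s] for [s]
    then costs the factor chi(k). The constant (k - 1) / 2 is lost because chi sums to zero. *)
Lemma fsum_dilation (k : nat) z : (0 < k)%N -> ~~ (p %| k)%N ->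
  \sum_(j < k) f (z + j%:R / k%:R) = chi k * f (k%:R * z).
Proof.
move=> k0 pk; have kF : (k%:R : F) != 0 by rewrite pnatr_eq0 -lt0n.
have k0' : (k%:R : 'F_p) != 0 by rewrite Fp_nat_eq0.
transitivity (\sum_(s < p) chi s * (fracp (k%:R * z - (k * s)%:R / p%:R) + (k%:R - 1) / 2)).
  rewrite exchange_big /=; apply: eq_bigr => s _; rewrite -mulr_sumr; congr (_ * _).
  have -> : k%:R * z - (k * s)%:R / p%:R = k%:R * (z - s%:R / p%:R).
    by rewrite natrM mulrBr mulrA.
  by rewrite -fracp_distribution //; apply: eq_bigr => j _; rewrite addrAC.
under eq_bigr do rewrite mulrDr.
rewrite big_split /= -mulr_suml.
have -> : \sum_(s < p) chi s = 0 by have := sum_qchar; rewrite sum_Fp.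
rewrite mul0r addr0 fsum_Fp (reindex_inj (mulfI k0')) mulr_sumr sum_Fp //.
apply: eq_bigr => s _; cbv beta.
have -> : k%:R * s%:R = (k * s)%N%:R :> 'F_p by rewrite natrM.
rewrite fracp_Fp mulrA -rmorphM /=; congr (_%:~R * _).
rewrite -/(qcharn p k) -/(qcharn p (k * s)) qcharnM // mulrA.
have -> : qcharn p k * qcharn p k = 1 by rewrite -qcharnM // /qcharn natrM -expr2 qchar_sqr.
by rewrite mul1r.
Qed.

Lemma fsum_plus z : \sum_(x : 'F_p) (qchar x)%:~R * fracp (z + (x : nat)%:R / p%:R) =
  (qchar (-1 : 'F_p))%:~R * f z.
Proof.
rewrite fsum_Fp (reindex_inj (@oppr_inj 'F_p)) mulr_sumr /=; apply: eq_bigr => x _.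
rewrite mulrA -rmorphM -qcharM // mulN1r; congr (_ * _).
rewrite (@fracp_lift (- x) (- (x : nat)%:Z)).
  by rewrite rmorphN mulNr.
by rewrite rmorphN /= -[((_ : nat)%:Z)%:~R]/((x : nat)%:R) natr_Zp.
Qed.

(** The fractional part of -x is 1 minus that of x only for nonintegral x; the multiples of [p] may
    be exempted because chi vanishes there. *)
Lemma fsumN z : (forall s : nat, ~~ (p %| s)%N -> z - s%:R / p%:R \isn't a Num.int) ->
  f (- z) = - (qchar (-1 : 'F_p))%:~R * f z.
Proof.
move=> ni.
have h : \sum_(x : 'F_p) (qchar x)%:~R * fracp (- z + (x : nat)%:R / p%:R) = - f z.
  rewrite fsum_Fp -sumrN.
  rewrite (eq_bigr (fun x : 'F_p => (qchar x)%:~R - (qchar x)%:~R * fracp (z - (x : nat)%:R / p%:R))).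
    by rewrite sumrB sum_qchar sub0r sumrN.
  move=> x _; have [->|x0] := eqVneq x 0; first by rewrite qchar0 !mul0r subr0.
  rewrite -[- z + _]opprK opprD opprK fracpN ?mulrBr ?mulr1 //; apply: ni.
  by rewrite -(Fp_nat_eq0 pp) natr_Zp.
rewrite fsum_plus in h.
have e : (qchar (-1 : 'F_p))%:~R * (qchar (-1 : 'F_p))%:~R = 1 :> F.
  by rewrite -rmorphM -qcharM // mulrNN mulr1 qchar1.
by rewrite mulNr -[LHS]mul1r -{1}e -mulrA h mulrN.
Qed.

Lemma quarter_notint (a : nat) (s : nat) : (a %% 4 != 0)%N ->
  (a%:R / 4 - s%:R / p%:R : F) \isn't a Num.int.
Proof.
move=> a4; apply/negP => /intrP[n].
have four0 : (4 : F) != 0 by rewrite pnatr_eq0.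
move/(congr1 (fun x => x * (4 * p%:R))).
have -> : (a%:R / 4 - s%:R / p%:R) * (4 * p%:R) = (a * p)%:R - (4 * s)%:R :> F.
  by rewrite !natrM; field; rewrite pF.
have -> : n%:~R * (4 * p%:R) = (n * 4 * p%:Z)%:~R :> F by rewrite !rmorphM /= mulrA.
rewrite -[(a * p)%:R]/((a * p)%:Z%:~R) -[(4 * s)%:R]/((4 * s)%:Z%:~R) -rmorphB /= => /intr_inj e.
have : (4 %| a * p)%N.
  have -> : (4 %| a * p)%N = (4 %| (a * p)%:Z)%Z by [].
  apply/dvdzP; exists (n * p%:Z + s%:Z); rewrite -[LHS](subrK ((4 * s)%:Z)) e PoszM; ring.
rewrite Gauss_dvdl; last by rewrite (_ : 4 = 2 ^ 2)%N // coprimeXl // coprime2n.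
by rewrite /dvdn (negbTE a4).
Qed.

Lemma zero_notint (s : nat) : ~~ (p %| s)%N -> (0 - s%:R / p%:R : F) \isn't a Num.int.
Proof.
move=> ps; apply/negP; rewrite sub0r rpredN => /intrP[n] /(congr1 (fun x => x * p%:R)).
rewrite divfK // -[s%:R]/(s%:Z%:~R) -[p%:R]/(p%:Z%:~R) -rmorphM /= => /intr_inj e.
case/negP: ps; have -> : (p %| s)%N = (p%:Z %| s%:Z)%Z by [].
by apply/dvdzP; exists n.
Qed.

Lemma fsum_zero_mean : f 0 = char_mean (fun d => chi d) p.
Proof.
have sh : \sum_(i < p) chi i.+1 = 0 by rewrite -rmorph_sum qcharn_sum.
have zero : chi 0 = 0 by rewrite (_ : qcharn p 0 = 0) //; apply/eqP; rewrite qcharn_eq0.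
rewrite char_mean_linear // (@sum_shift_period _ p (fun i => chi i * i%:R)); last first.
  by rewrite (_ : qcharn p p = qcharn p 0) ?zero ?mul0r //; exact: (qcharn_per pp 0).
have s0 : \sum_(i < p) chi i = 0.
  rewrite -(@sum_shift_period _ p (fun i => chi i)) //=.
  by have := qcharn_per pp 0; rewrite add0n => ->.
transitivity (\sum_(s < p) chi s * (1 - s%:R / p%:R)); last first.
  under eq_bigr do rewrite mulrBr mulr1.
  rewrite sumrB s0 sub0r mulNr mulr_suml; congr (- _).
  by apply: eq_bigr => s _; rewrite mulrA.
apply: eq_bigr => s _; have [s00|s00] := posnP (s : nat).
  by rewrite s00 zero !mul0r.
congr (_ * _).
apply: (@fracp_unique _ _ (-1)); first by rewrite rmorphN1; ring.
have := ltn_ord s; rewrite -(ltr_nat F) => sp.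
have pP : 0 < (p%:R : F) by rewrite ltr0n.
have sP : 0 < (s%:R : F) by rewrite ltr0n.
have h1 : s%:R / p%:R < 1 :> F by rewrite ltr_pdivrMr // mul1r.
have h2 : 0 < s%:R / p%:R :> F by rewrite divr_gt0.
by apply/andP; split; lra.
Qed.

(** Here -p/4 is 1/4 modulo 1. Dilation by 2 at 0 gives f(1/2) = (chi(2) - 1) f(0), dilation by 4
    gives f(1/4) + f(1/2) + f(3/4) = 0, and chi being odd gives f(3/4) = f(1/4). *)
Lemma fsum_case3 : (p %% 4 == 3)%N ->
  f (- p%:R / 4) = (1 - chi 2) / 2 * f 0.
Proof.
move=> p3.
have qN : qchar (-1 : 'F_p) = -1 by rewrite qcharN1_mod4 // (eqP p3).
have p2 : ~~ (p %| 2)%N by rewrite dvdn_prime2 //; case: eqP op => // ->.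
have p4 : ~~ (p %| 4)%N by rewrite (_ : 4 = 2 ^ 2)%N // Euclid_dvdX // negb_and p2.
have chi4' : chi 4 = 1.
  suff -> : qcharn p 4 = 1 by [].
  rewrite (_ : 4 = 2 * 2)%N // qcharnM //.
  have : qcharn p 2 != 0 by rewrite qcharn_eq0.
  have := qcharn_le1 pp op 2; move: (qcharn p 2) => c c1 c0.
  have [->|->] : c = 1 \/ c = -1 by lia.
    by rewrite mulr1.
  by rewrite mulrNN mulr1.
have d2 := @fsum_dilation 2 0 isT p2; have d4 := @fsum_dilation 4 0 isT p4.
rewrite !big_ord_recr !big_ord0 /= !mulr0 !add0r !mul0r in d2 d4.
have e34 : f (3 / 4) = f (1 / 4).
  have -> : 3 / 4 = - (1 / 4) + 1%:~R :> F by field.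
  rewrite fsumDz fsumN ?qN ?rmorphN1 ?opprK ?mul1r //.
  by move=> s _; have := @quarter_notint 1 s isT; rewrite ?mul1r.
have -> : - p%:R / 4 = 1 / 4 + (- ((p %/ 4)%:Z) - 1)%:~R :> F.
  have -> : p%:R = 4 * (p %/ 4)%:R + 3 :> F.
    by rewrite {1}(divn_eq p 4) (eqP p3) natrD natrM mulrC.
  by rewrite rmorphB rmorphN /= -[(_%:Z)%:~R]/((p %/ 4)%:R); field.
rewrite fsumDz.
have h24 : 2 / 4 = 1 / 2 :> F by field.
rewrite h24 e34 chi4' in d4.
have : 2 * f (1 / 4) = f 0 - chi 2 * f 0 by lra.
have t0 : (2 : F) != 0 by rewrite pnatr_eq0.
by move=> h; apply: (mulfI t0); rewrite h; field.
Qed.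

(** chi is even, so f(0) = 0 and f(-1/4) = -f(1/4). Sorting the residues modulo 4 p by their class
    [u] modulo 4 makes each block a multiple of f(u/4), and the factor modulo 4 keeps only u = 1 and
    u = 3, with opposite signs. *)
Lemma fsum_case1 : (p %% 4 == 1)%N ->
  f 0 = 0 /\ 2 * f (- p%:R / 4) = char_mean (fun d => (chi_four p d)%:~R : F) (4 * p).
Proof.
move=> p1.
have qN : qchar (-1 : 'F_p) = 1 by rewrite qcharN1_mod4 // p1.
split.
  have := @fsumN 0 (@zero_notint); rewrite oppr0 qN rmorph1 mulN1r => h.
  by lra.
have -> : - p%:R / 4 = - (1 / 4) + (- ((p %/ 4)%:Z))%:~R :> F.
  have -> : p%:R = 4 * (p %/ 4)%:R + 1 :> F.
    by rewrite {1}(divn_eq p 4) (eqP p1) natrD natrM mulrC.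
  by rewrite rmorphN /= -[(_%:Z)%:~R]/((p %/ 4)%:R); field.
rewrite fsumDz.
have e34 : f (3 / 4) = f (- (1 / 4)).
  have -> : 3 / 4 = - (1 / 4) + 1%:~R :> F by field.
  by rewrite fsumDz.
have eN : f (- (1 / 4)) = - f (1 / 4).
  by rewrite fsumN ?qN ?rmorph1 ?mulN1r // => s _; have := @quarter_notint 1 s isT; rewrite ?mul1r.
have pP4 : (0 < 4 * p)%N by rewrite muln_gt0.
have sh : \sum_(i < 4 * p) ((chi_four p i.+1)%:~R : F) = 0.
  by rewrite -rmorph_sum chi_four_sum.
rewrite char_mean_linear // (@sum_shift_period _ (4 * p) (fun i => (chi_four p i)%:~R * i%:R)); last first.
  have -> : chi_four p (4 * p) = 0 by rewrite /chi_four /chi4 oddM mul0r.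
  by rewrite mul0r mulr0.
have blk : \sum_(i < 4 * p) ((chi_four p i)%:~R * i%:R : F) =
    \sum_(u < 4) (chi4 u)%:~R * (4 * p)%:R * f (u%:R / 4).
  rewrite mulnC (@sum_block _ p 4 (fun i => (chi_four p i)%:~R * i%:R : F)) exchange_big /=.
  apply: eq_bigr => u _.
  pose k := (p %/ 4)%N.
  have pE : p = (4 * k + 1)%N by rewrite {1}(divn_eq p 4) (eqP p1) mulnC.
  have -> : f (u%:R / 4) = \sum_(x : 'F_p) (qchar x)%:~R * fracp (u%:R / 4 + (x : nat)%:R / p%:R).
    by rewrite fsum_plus qN rmorph1 mul1r.
  (* With p = 4 k + 1 one has 4 k = -1 modulo [p], so 4 (i - u k) is 4 i + u there, and u/4 + (i - u
     k)/p is exactly (4 i + u) / (4 p). *)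
  rewrite (reindex_inj (addIr (- (u * k)%:R : 'F_p))) /= sum_Fp // mulr_sumr.
  apply: eq_bigr => i _.
  have il := ltn_ord i; have ul := ltn_ord u.
  have -> : qchar (i%:R - (u * k)%:R : 'F_p) = qcharn p (i * 4 + u).
    rewrite /qcharn (_ : (i * 4 + u)%:R = 2 ^+ 2 * (i%:R - (u * k)%:R) :> 'F_p).
      by rewrite [RHS]qcharM // qchar_sqr // mul1r.
    apply/eqP; rewrite -subr_eq0.
    have -> : (i * 4 + u)%:R - 2 ^+ 2 * (i%:R - (u * k)%:R) = (u * (4 * k + 1))%:R :> 'F_p.
      by rewrite !(natrD, natrM); ring.
    by rewrite -pE Fp_nat_eq0 // dvdn_mull.
  have -> : chi_four p (i * 4 + u) = chi4 u * qcharn p (i * 4 + u).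
    rewrite /chi_four; congr (_ * _).
    by rewrite /chi4 oddD oddM andbF /= modnMDl.
  rewrite rmorphM /= -!mulrA; congr (_ * _); rewrite [RHS]mulrCA; congr (_ * _).
  pose x : 'F_p := i%:R - (u * k)%:R.
  suff -> : fracp (u%:R / 4 + (x : nat)%:R / p%:R) = (i * 4 + u)%:R / (4 * p)%:R :> F.
    by rewrite [(p * 4)%N]mulnC mulrC divfK // pnatr_eq0 -lt0n.
  have kF : (k%:R : F) = (p%:R - 1) / 4.
    by rewrite {1}pE natrD natrM; field.
  rewrite (@fracp_lift _ (i%:Z - (u * k)%:Z)); last by rewrite /x rmorphB.
  apply: (@fracp_unique _ _ 0).
    rewrite rmorphB /= -[(i%:Z)%:~R]/(i%:R) -[((u * k)%:Z)%:~R]/((u * k)%:R).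
    by rewrite !(natrD, natrM) kF; field; rewrite pF.
  have P4 : 0 < ((4 * p)%:R : F) by rewrite ltr0n.
  rewrite divr_ge0 //= ltr_pdivrMr // mul1r ltr_nat.
  by clear -il ul; lia.
have E : \sum_(u < 4) (chi4 u)%:~R * (4 * p)%:R * f (u%:R / 4) = (4 * p)%:R * (f (1 / 4) - f (3 / 4)).
  have c0 : chi4 0 = 0 by [].
  have c1 : chi4 1 = 1 by [].
  have c2 : chi4 2 = 0 by [].
  have c3 : chi4 3 = -1 by [].
  rewrite !big_ord_recr big_ord0 /= c0 c1 c2 c3 rmorphN1.
  move: (f (1 / 4)) (f (3 / 4)) (f (0 / 4)) (f (2 / 4)) => a b c d.
  by rewrite -[0%:~R]/(0 : F) -[1%:~R]/(1 : F); ring.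
rewrite blk E e34 eN.
have PF : ((4 * p)%:R : F) != 0 by rewrite pnatr_eq0 -lt0n.
by move: ((4 * p)%:R : F) (f (1 / 4)) PF => P a PF; field.
Qed.

End Relations.

(** * The recursion for the trace sum *)

Section TraceFormula.
Variable F : archiRealFieldType.
Variable p : nat.
Hypotheses (pp : prime p) (op : odd p).
Let p0 : (0 < p)%N := prime_gt0 pp.
Let pF : (p%:R : F) != 0. Proof. by rewrite pnatr_eq0 -lt0n. Qed.
Let p1F : (p%:R - 1 : F) != 0.
Proof. by rewrite subr_eq0 pnatr_eq1; case: eqP pp => // ->. Qed.
Local Notation f := (@fsum F p).
Let al (r : nat) : F := - (p ^ r)%:R / 4.

Lemma fracp_quarter (a b : nat) : (a = b %[mod 4])%N ->
  exists m : int, - a%:R / 4 = - b%:R / 4 + m%:~R :> F.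
Proof.
move=> ab; exists ((b %/ 4)%:Z - (a %/ 4)%:Z).
rewrite {1}(divn_eq a 4) {1}(divn_eq b 4) ab rmorphB /= !natrD !natrM.
by rewrite -[((b %/ 4)%N%:Z)%:~R]/((b %/ 4)%:R) -[((a %/ 4)%N%:Z)%:~R]/((a %/ 4)%:R); field.
Qed.

Lemma sqr_mod4 : (p ^ 2 = 1 %[mod 4])%N.
Proof.
have : ((p %% 4 = 1) \/ (p %% 4 = 3))%N by lia.
by rewrite -modnXm => -[->|->].
Qed.

Lemma pow_mod4 (r : nat) : (p ^ r.+2 = p ^ r %[mod 4])%N.
Proof. by rewrite -addn2 expnD -modnMmr sqr_mod4 modnMmr muln1. Qed.

Lemma pow_even_mod4 (r : nat) : (p ^ r.*2 = 1 %[mod 4])%N.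
Proof. by elim: r => [|r IH] //; rewrite doubleS pow_mod4. Qed.

Lemma pow_odd_mod4 (r : nat) : (p ^ (r.*2).+1 = p %[mod 4])%N.
Proof. by rewrite expnS -modnMmr pow_even_mod4 modnMmr muln1. Qed.

Lemma pow_al (i r : nat) : (p ^ i)%:R * al r = - (p ^ (i + r))%:R / 4.
Proof. by rewrite /al expnD natrM mulrA mulrN. Qed.

(** The inhomogeneous term of the recursion in steps of two. It does not depend on [r] because p^(2
    i) is 1 modulo 4: up to integers, the products p^i [al] that occur are -1/4 and -p/4. *)
Definition trace_const : F := 3 / 4 - fracp (- p%:R / 4) + (f 0 + f (- p%:R / 4)).

Lemma fracp_al0 (i r : nat) : (i + r)%N = (i.*2)%N -> fracp ((p ^ i)%:R * al r) = 3 / 4.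
Proof.
move=> e; rewrite pow_al e.
have [m ->] := fracp_quarter (pow_even_mod4 i).
rewrite fracpDz; apply: (@fracp_unique _ _ (-1)); first by rewrite rmorphN1; field.
by apply/andP; split; lra.
Qed.

Lemma al_odd (i : nat) : exists m : int, (p ^ i)%:R * al i.+1 = - p%:R / 4 + m%:~R.
Proof.
rewrite pow_al addnS addnn; exact: (fracp_quarter (pow_odd_mod4 i)).
Qed.

(** The two sums together satisfy T(r + 2) = (p - 1) p^(r + 1) + [trace_const] + p T(r). The
    constant accumulates to a geometric sum of ratio [p], and the fractional part of p^r / 4 depends
    only on the parity of [r]; the values r = 0 and r = 1 start the two chains. *)
Lemma trace_sum_formula (r : nat) :
  tsum p r 0 + tsum p r (al r) =
  (p ^ r)%:R - fracp ((p ^ r)%:R / 4) * (p ^ (r %/ 2))%:R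
  + ((p ^ ((r + 1) %/ 2))%:R - 1) / (p%:R - 1) * trace_const.
Proof.
have fr (x : nat) : odd x -> fracp (- x%:R / 4 : F) = 1 - fracp (x%:R / 4 : F).
  move=> ox; rewrite mulNr fracpN //; apply/negP => /intrP[n].
  move/(congr1 (fun y => y * 4)); rewrite divfK ?pnatr_eq0 // => e.
  have : x%:Z = n * 4 by apply/eqP; rewrite -(eqr_int F) rmorphM /=; apply/eqP.
  by lia.
elim/ltn_ind: r => -[|[|r]] IH.
- have E1 : (p ^ (0 %/ 2) = 1)%N by [].
  have E2 : (p ^ ((0 + 1) %/ 2) = 1)%N by [].
  rewrite !tsum0 /al fracp0 fr // ?E1 ?E2 ?expn0.
  by move: (fracp (1%:R / 4 : F)) trace_const => a b; field.
- have E1 : (p ^ (1 %/ 2) = 1)%N by [].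
  have E2 : (p ^ ((1 + 1) %/ 2) = p)%N by rewrite expn1.
  have e3 : fracp (p%:R * (- p%:R / 4)) = 3 / 4 :> F.
    by rewrite -(@fracp_al0 1 1) // /al expn1.
  rewrite !tsum1 // mulr0 fracp0 /al ?expn1 e3 /trace_const fr // ?E1 ?E2.
  by move: (fracp (p%:R / 4 : F)) (f 0) (f (- p%:R / 4)) => a b c; field.
have rr : (r < r.+2)%N by [].
have := IH r rr; rewrite !tsumSS // !mulr0 !fracp0 addr0 subr0.
rewrite (fracp_al0 (i := r.+2)) ?addnn //.
have [m ->] := al_odd r.+1; rewrite !fracpDz !fsumDz.
have [m' alE] : exists m : int, al r.+2 = al r + m%:~R by exact: (fracp_quarter (pow_mod4 r)).
rewrite alE tsumDz => {}IH.
have qE : fracp ((p ^ r.+2)%:R / 4 : F) = fracp ((p ^ r)%:R / 4).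
  have o i : odd (p ^ i) by rewrite oddX op orbT.
  have : fracp (al r.+2) = fracp (al r) by rewrite alE fracpDz.
  by rewrite /al !fr //; lra.
rewrite qE (_ : r.+2 %/ 2 = (r %/ 2).+1)%N; last by lia.
rewrite (_ : (r.+2 + 1) %/ 2 = ((r + 1) %/ 2).+1)%N; last by lia.
move: IH; set t0 := tsum p r 0; set t1 := tsum p r (al r) => IH.
have {IH} -> : t1 = (p ^ r)%:R - fracp ((p ^ r)%:R / 4) * (p ^ (r %/ 2))%:R +
   ((p ^ ((r + 1) %/ 2))%:R - 1) / (p%:R - 1) * trace_const - t0 by rewrite -IH addrAC subrr add0r.
rewrite /trace_const !expnS !natrM.
move: (fracp ((p ^ r)%:R / 4 : F)) (fracp (- p%:R / 4 : F)) (f 0) (f (- p%:R / 4)) t0 => a b c d t0.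
by move: ((p ^ r)%:R : F) ((p ^ (r %/ 2))%:R : F) ((p ^ ((r + 1) %/ 2))%:R : F) => x y z; field.
Qed.

(** The summand has period 2 n with n = p^r. Since n is odd, odd [x] may be written 2 y + n, and (2
    y + n)^2 / (4 n) = y^2 / n + y + n / 4. *)
Lemma trace_sum_split (r : nat) :
  \sum_(1 <= x < (2 * p ^ r).+1) fracp (- ((x ^ 2)%N%:R / (4 * p ^ r)%N%:R) : F) =
  tsum p r 0 + tsum p r (al r).
Proof.
set n := (p ^ r)%N.
have n0 : (0 < n)%N by rewrite expn_gt0 p0.
have nF : (n%:R : F) != 0 by rewrite pnatr_eq0 -lt0n.
have on : odd n by rewrite oddX op orbT.
pose g x : F := fracp (- ((x ^ 2)%N%:R / (4 * n)%N%:R)).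
have gper x : g (x + 2 * n)%N = g x.
  rewrite /g -[RHS](@fracpDz _ _ (- (x + n)%:Z)); congr fracp.
  rewrite rmorphN /= -[(_%:Z)%:~R]/((x + n)%:R) -opprD; congr (- _).
  have -> : ((x + 2 * n) ^ 2 = x ^ 2 + (4 * n) * (x + n))%N by ring.
  by rewrite natrD natrM mulrDl [_ * (x + n)%:R]mulrC mulfK // natrM mulf_neq0 // pnatr_eq0.
rewrite big_add1 /= big_mkord (@sum_shift_period _ (2 * n) g); last by rewrite -[(2 * n)%N]add0n gper.
rewrite mulnC (@sum_block _ n 2 g).
under eq_bigr do rewrite !big_ord_recr big_ord0 /= add0r addn0.
rewrite big_split /=; congr (_ + _).
  apply: eq_bigr => y _; rewrite /g sub0r; congr fracp; congr (- _).
  by rewrite expnMn !natrM; field.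
pose h y := g (2 * y + 1)%N.
have -> : \sum_(i < n) g (i * 2 + 1)%N = \sum_(i < n) h i by apply: eq_bigr => i _; rewrite mulnC.
have hper y : h (y + n)%N = h y by rewrite /h mulnDr addnAC gper.
(* The shift by (n - 1) / 2 turns 2 y + 1 into 2 y + n. *)
rewrite -(@sum_shift_periodn _ n (n.-1)./2 h hper); apply: eq_bigr => y _.
rewrite /h (_ : 2 * (y + n.-1./2) + 1 = 2 * y + n)%N; last by clear -on n0; lia.
rewrite /g -[RHS](@fracpDz _ _ (- y%:Z)); congr fracp.
rewrite rmorphN /= -[(y%:Z)%:~R]/(y%:R) /al -/n.
have -> : ((2 * y + n) ^ 2 = 4 * y ^ 2 + 4 * (y * n) + n ^ 2)%N by ring.
have -> : (4 * y ^ 2 + 4 * (y * n) + n ^ 2)%N%:R = 4 * y%:R ^+ 2 + 4 * (y%:R * n%:R) + n%:R ^+ 2 :> F.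
  rewrite (natrD _ (4 * y ^ 2 + 4 * (y * n))%N (n ^ 2)%N) (natrD _ (4 * y ^ 2)%N (4 * (y * n))%N).
  by rewrite (natrM _ 4 (y ^ 2)%N) (natrM _ 4 (y * n)%N) (natrM _ y n) (natrX _ y 2) (natrX _ n 2).
rewrite (natrM _ 4 n) (natrX _ y 2).
by move: (n%:R : F) nF => u u0; field.
Qed.

End TraceFormula.

(** The field of discriminant -3 has six units, and the sum gives 2 h / 6; this is the origin of the
    exceptional value 1/3. *)
Lemma fsum_three (F : archiRealFieldType) : fsum 3 (0 : F) = 3^-1.
Proof.
rewrite fsum_zero_mean // /char_mean !big_ord_recr !big_ord0 /=.
have -> : qcharn 3 3 = 0 by apply/eqP; rewrite qcharn_eq0.
by rewrite qcharn1 // qchar_two //= mulrN1z mulr1z mulr0z; field.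
Qed.

Section TraceConstant.
Variable F : archiRealFieldType.
Variable p : nat.
Hypotheses (pp : prime p) (op : odd p).

Lemma fracp_negquarter : fracp (- p%:R / 4 : F) = if (p %% 4 == 1)%N then 3 / 4 else 1 / 4.
Proof.
have {1}-> : p = (p %/ 4 * 4 + p %% 4)%N by exact: divn_eq.
have : (p %% 4 = 1 \/ p %% 4 = 3)%N by lia.
case=> -> /=; apply: (@fracp_unique _ _ (- (p %/ 4)%:Z - 1)); lra.
Qed.

Lemma trace_const_case1 : (p %% 4 == 1)%N ->
  2 * trace_const F p = char_mean (fun d => (chi_four p d)%:~R : F) (4 * p).
Proof.
move=> p1; have [f0 <-] := fsum_case1 F pp op p1.
by rewrite /trace_const fracp_negquarter p1 f0 subrr !add0r.
Qed.

(** The coefficient 4 or 2 is 3 - chi(2), and the 1 is twice 3/4 - 1/4. *)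
Lemma trace_const_case3 : (p %% 4 == 3)%N ->
  2 * trace_const F p = (if (p %% 8 == 3)%N then 4 else 2) * fsum p 0 + 1.
Proof.
move=> p3; rewrite /trace_const fracp_negquarter (eqP p3) /= fsum_case3 // qchar_two //.
by case: ifP => _; rewrite ?mulrN1z ?mulr1z; field.
Qed.

Lemma trace_sum_value (r : nat) :
  \sum_(1 <= x < (2 * p ^ r).+1) fracp (- ((x ^ 2)%N%:R / (4 * p ^ r)%N%:R)) =
  (p ^ r)%:R - fracp ((p ^ r)%:R / 4) * (p ^ (r %/ 2))%:R
  + ((p ^ ((r + 1) %/ 2))%:R - 1) / (2 * (p%:R - 1)) * (2 * trace_const F p).
Proof.
rewrite trace_sum_split // trace_sum_formula //; congr (_ + _).
have p1 : (p%:R - 1 : F) != 0.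
  by rewrite subr_eq0 (eqr_nat _ p 1) neq_ltn prime_gt1 // orbT.
by field.
Qed.

End TraceConstant.

(** The ranges differ only in 0 and m, where the arguments are the integers 0 and -q. *)
Lemma square_sum_range (F : archiRealFieldType) (m q : nat) : (0 < q)%N -> m = (2 * q)%N ->
  \sum_(x < m) fracp (- ((x ^ 2)%N%:R / (2 * m)%N%:R)) =
  \sum_(1 <= x < m.+1) fracp (- ((x ^ 2)%N%:R / (4 * q)%N%:R)) :> F.
Proof.
move=> q0 ->; have -> : (2 * (2 * q) = 4 * q)%N by lia.
have q1 : (q%:R : F) != 0 by rewrite pnatr_eq0 -lt0n.
rewrite big_add1 /= big_mkord.
rewrite (@sum_shift_period _ _ (fun i => fracp (- ((i ^ 2)%N%:R / (4 * q)%N%:R)))) //.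
rewrite [(0 ^ 2)%N]/= mul0r oppr0 fracp0.
have -> : - (((2 * q) ^ 2)%N%:R / (4 * q)%N%:R) = (- q%:Z)%:~R :> F.
  by rewrite rmorphN /= -[(q%:Z)%:~R]/(q%:R) natrX !natrM; field.
exact: fracp_int.
Qed.

Require Import Defs.
From mathcomp Require Import complex spectral finmap.
From mathcomp Require Import all_classical all_reals all_analysis.

Import numFieldNormedType.Exports.
Local Open Scope classical_set_scope.
Local Open Scope complex_scope.

(** * Exponents of the Weil representation *)

Lemma cvg_near_product (K : numFieldType) (u v w : nat -> K) (a b : K) :
  u @ \oo --> a -> v @ \oo --> b -> (fun N => u N * v N - w N) @ \oo --> (0 : K) ->
  w @ \oo --> a * b.
Proof.
move=> ua vb d; rewrite (_ : w = (fun N => u N * v N) \- (fun N => u N * v N - w N)).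
  by rewrite -[a * b]subr0; exact: cvgB (cvgM ua vb) d.
by apply/funext => N /=; rewrite opprB addrC subrK.
Qed.

Section ComplexExponential.
Variable R : realType.
Local Notation C := (R[i] : numFieldType).

Definition exp_partial (K : numFieldType) (N : nat) (w : K) : K :=
  \sum_(k < N) (k`!%:R)^-1 * w ^+ k.

Lemma exp_partial_mulE (K : numFieldType) (N : nat) (x y : K) :
  exp_partial N x * exp_partial N y - exp_partial N (x + y) =
  \sum_(i < N) \sum_(j < N | (N <= i + j)%N) ((i`!%:R)^-1 * x ^+ i) * ((j`!%:R)^-1 * y ^+ j).
Proof.
have -> : exp_partial N x * exp_partial N y =
    \sum_(i < N) \sum_(j < N) ((i`!%:R)^-1 * x ^+ i) * ((j`!%:R)^-1 * y ^+ j).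
  by rewrite /exp_partial mulr_suml; apply: eq_bigr => i _; rewrite mulr_sumr.
apply/eqP; rewrite subr_eq addrC; apply/eqP.
have -> : exp_partial N (x + y) =
    \sum_(i < N) \sum_(j < N | ~~ (N <= i + j)%N) ((i`!%:R)^-1 * x ^+ i) * ((j`!%:R)^-1 * y ^+ j).
  rewrite /exp_partial.
  transitivity (\sum_(k < N) \sum_(i < N) \sum_(j < N | (i + j == k)%N)
      ((i`!%:R)^-1 * x ^+ i) * ((j`!%:R)^-1 * y ^+ j)).
    apply: eq_bigr => k _.
    rewrite exprDn mulr_sumr.
    have kN : (k.+1 <= N)%N by exact: ltn_ord.
    rewrite (big_ord_widen N (fun i => (k`!%:R)^-1 * ((x ^+ (k - i) * y ^+ i) *+ 'C(k, i))) kN).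
    rewrite [RHS](exchange_big_dep xpredT) //= big_mkcond /=; apply: eq_bigr => i _.
    case: ifP => ik; last first.
      by rewrite big1 // => j /eqP jk; exfalso; lia.
    have kiN : (k - i < N)%N by lia.
    rewrite (big_pred1 (Ordinal kiN)) /=; last by move=> j; rewrite /= -val_eqE /=; lia.
    have ik' : (i <= k)%N by lia.
    have := bin_fact ik'; move/(congr1 (fun n => n%:R : K)); rewrite !natrM => bf.
    have f0 n : (n`!%:R : K) != 0 by rewrite pnatr_eq0 -lt0n fact_gt0.
    rewrite -[_ *+ 'C(k, i)]mulr_natl.
    have -> : ('C(k, i)%:R : K) = k`!%:R / (i`!%:R * (k - i)`!%:R).
      by rewrite -bf mulfK // mulf_neq0.
    by field; rewrite !f0.
  rewrite exchange_big /=; apply: eq_bigr => i _.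
  rewrite (exchange_big_dep xpredT) //= [RHS]big_mkcond /=; apply: eq_bigr => j _.
  case: ifP => h.
    have ijN : (i + j < N)%N by lia.
    by rewrite (big_pred1 (Ordinal ijN)) // => k; rewrite /= -val_eqE /= eq_sym.
  by rewrite big1 // => k /eqP ijk; have := ltn_ord k; lia.
rewrite -big_split /=; apply: eq_bigr => i _.
by rewrite addrC [LHS](bigID (fun j : 'I_N => (N <= i + j)%N)).
Qed.

(** The terms with i + j >= N are dominated by those for the moduli. This reduces the functional
    equation of the complex exponential to the real one, where [expRD] makes the bound tend to 0. *)
Lemma exp_partial_mul_bound (N : nat) (x y : R[i]) :
  `|exp_partial N x * exp_partial N y - exp_partial N (x + y)| <=
  (exp_partial N (complex.Re `|x|) * exp_partial N (complex.Re `|y|)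
     - exp_partial N (complex.Re `|x| + complex.Re `|y|))%:C.
Proof.
rewrite !exp_partial_mulE.
apply: le_trans (ler_norm_sum _ _ _) _.
rewrite (rmorph_sum (real_complex R)) /=; apply: ler_sum => i _.
apply: le_trans (ler_norm_sum _ _ _) _.
rewrite (rmorph_sum (real_complex R)) /=; apply: ler_sum => j _.
rewrite !normrM !normrX !normfV !normr_nat.
have nE (w : R[i]) : `|w| = (complex.Re `|w|)%:C.
  by rewrite RRe_real // normr_real.
by rewrite [in leLHS](nE x) [in leLHS](nE y) !rmorphM !fmorphV !rmorphXn /= !rmorph_nat.
Qed.

Lemma exp_partial_cvg (x : R) : (fun N => exp_partial N x) @ \oo --> expR x.
Proof.
have := is_cvg_series_exp_coeff x; rewrite /expR.
rewrite (_ : (fun N => exp_partial N x) = series (exp_coeff x)) //.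
by apply/funext => N; rewrite /series /= big_mkord; apply: eq_bigr => i _; rewrite /exp_coeff /= mulrC.
Qed.

Lemma exp_partial_cvgC (x y : R) :
  ((fun N => exp_partial N (Complex x y)) : nat -> C) @ \oo --> ((expR x)%:C * expi y : C).
Proof.
have cx : ((fun N => exp_partial N (x%:C)) : nat -> C) @ \oo --> ((expR x)%:C : C).
  rewrite (_ : (fun N => _) = (fun N => Complex (exp_partial N x) 0)).
    by apply: cvg_C; [exact: exp_partial_cvg|exact: cvg_cst].
  apply/funext => N; rewrite -[Complex _ 0]/((exp_partial N x)%:C) /exp_partial.
  rewrite (rmorph_sum (real_complex R)) /=; apply: eq_bigr => i _.
  by rewrite rmorphM fmorphV rmorphXn /= rmorph_nat.
have cy : ((fun N => exp_partial N (Complex 0 y)) : nat -> C) @ \oo --> (expi y : C).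
  exact: expi_series.
have xyE : Complex x y = x%:C + Complex 0 y by rewrite /GRing.add /= addr0 add0r.
pose a := complex.Re `|x%:C|; pose b := complex.Re `|Complex 0 y|.
have d0 : (fun N => exp_partial N a * exp_partial N b - exp_partial N (a + b)) @ \oo --> (0 : R).
  rewrite -[0](subrr (expR (a + b))) {1}expRD.
  by apply: cvgB; [apply: cvgM|]; exact: exp_partial_cvg.
have diff0 : ((fun N => exp_partial N (x%:C) * exp_partial N (Complex 0 y) - exp_partial N (Complex x y)) : nat -> C)
    @ \oo --> (0 : C).
  apply/(@cvgrPdist_lt C C) => e e0.
  have eE : e = (complex.Re e)%:C by rewrite RRe_real // gtr0_real.
  have re0 : 0 < complex.Re e by move: e0; rewrite eE ltcR.
  move/cvgrPdist_lt : d0 => /(_ _ re0); apply: filterS => N /=.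
  rewrite !sub0r !normrN => h; rewrite xyE.
  apply: le_lt_trans (exp_partial_mul_bound _ _ _) _.
  by rewrite [e]eE ltcR; apply: le_lt_trans h; exact: ler_norm.
exact: (cvg_near_product cx cy diff0).
Qed.

End ComplexExponential.

Lemma char_poly_conj (F : comUnitRingType) (n : nat) (P A : 'M[F]_n) : P \in unitmx ->
  char_poly (P *m A *m invmx P) = char_poly A.
Proof.
move=> Pu; rewrite /char_poly /char_poly_mx !map_mxM /=.
set P' := map_mx polyC P; set Q' := map_mx polyC (invmx P); set A' := map_mx polyC A.
have PQ : P' *m Q' = 1%:M by rewrite -map_mxM mulmxV // map_mx1.
have -> : 'X%:M - P' *m A' *m Q' = P' *m ('X%:M - A') *m Q'.
  rewrite mulmxBr mulmxBl; congr (_ - _).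
  by rewrite scalar_mxC -mulmxA PQ mulmx1.
rewrite !det_mulmx mulrAC -det_mulmx PQ det1 mul1r //.
Qed.

Lemma trig_mx_mul (F : comNzRingType) (n : nat) (A B : 'M[F]_n) :
  is_trig_mx A -> is_trig_mx B ->
  is_trig_mx (A *m B) /\ (forall i, (A *m B) i i = A i i * B i i).
Proof.
move=> /is_trig_mxP tA /is_trig_mxP tB; split.
  apply/is_trig_mxP => i j ij; rewrite mxE big1 // => k _.
  have [ik|ki] := ltnP i k; first by rewrite tA // mul0r.
  by rewrite tB ?mulr0 //; exact: leq_ltn_trans ij.
move=> i; rewrite mxE (bigD1 i) //= big1 ?addr0 // => k ki.
have [ik|ki'] := ltnP i k; first by rewrite tA // mul0r.
by rewrite tB ?mulr0 // ltn_neqAle ki' andbT.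
Qed.

Lemma trig_mx_exp (F : comNzRingType) (n : nat) (A : 'M[F]_n) (k : nat) : is_trig_mx A ->
  is_trig_mx (A ^+ k) /\ (forall i, (A ^+ k) i i = A i i ^+ k).
Proof.
move=> tA; elim: k => [|k [IH1 IH2]].
  by rewrite expr0; split=> [|i]; [exact: scalar_mx_is_trig|rewrite mxE eqxx].
rewrite exprS; have [h1 h2] := trig_mx_mul tA IH1; split=> // i.
by rewrite -[(A * _) i i]/((A *m _) i i) h2 IH2 exprS.
Qed.

Lemma conj_mx_exp (F : comUnitRingType) (n : nat) (P A : 'M[F]_n) k : P \in unitmx ->
  P *m A ^+ k *m invmx P = (P *m A *m invmx P) ^+ k.
Proof.
move=> Pu; elim: k => [|k IH]; first by rewrite !expr0 mulmx1 mulmxV.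
rewrite [in RHS]exprS -IH exprS -[A * _]/(A *m _) -[RHS]/(_ *m _).
by rewrite !mulmxA mulmxKV.
Qed.

Lemma cvg_mulmx_entry (C : numFieldType) (n : nat) (P Q : 'M[C]_n) (u : nat -> 'M[C]_n) (T : 'M[C]_n) i j :
  u @ \oo --> T -> (fun N => (P *m u N *m Q) i j) @ \oo --> (P *m T *m Q) i j.
Proof.
move=> uT.
have ent a b : (fun N => u N a b) @ \oo --> T a b.
  exact: (cvg_comp _ _ uT (@coord_continuous C n n a b T)).
have expand (M : 'M[C]_n) : (P *m M *m Q) i j = \sum_b \sum_a (P i a * M a b) * Q b j.
  by rewrite mxE; apply: eq_bigr => b _; rewrite mxE mulr_suml.
rewrite expand (_ : (fun N => _) = (fun N => \sum_b \sum_a (P i a * u N a b) * Q b j)); last first.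
  by apply/funext => N; rewrite expand.
apply: cvg_big => [|b _]; first exact: add_continuous.
apply: cvg_big => [|a _]; first exact: add_continuous.
by apply: cvgMl; apply: cvgMr.
Qed.

Lemma numField_cvg_unique (K : numFieldType) (u : nat -> K) (a b : K) :
  u @ \oo --> a -> u @ \oo --> b -> a = b.
Proof. by move=> h1 h2; exact: (@cvg_unique K (@norm_hausdorff K K) _ _ a b h1 h2). Qed.

(** Schur's theorem makes L triangular, and the diagonal of its exponential has the same multiset of
    entries as [d], by characteristic polynomials. On [good] numbers the exponential is injective,
    so the diagonal of L and the entries of [r] arise from these multisets by one and the same
    function, and their sums agree. *)
Lemma exponents_trace (K : numClosedFieldType) (c : K) (good : K -> Prop) :
  (forall a b e : K, good a -> good b ->
     ((fun N => exp_partial N (c * a)) : nat -> (K : numFieldType)) @ \oo --> (e : (K : numFieldType)) ->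
     ((fun N => exp_partial N (c * b)) : nat -> (K : numFieldType)) @ \oo --> (e : (K : numFieldType)) ->
     a = b) ->
  forall (n : nat) (d r : 'rV[K]_n) (L : 'M[K]_n), (0 < n)%N ->
  is_expmx (c *: diag_mx r) (diag_mx d) -> (forall a, eigenvalue (diag_mx r) a -> good a) ->
  is_expmx (c *: L) (diag_mx d) -> (forall a, eigenvalue L a -> good a) ->
  \tr L = \sum_i r 0 i.
Proof.
move=> uniq_exp n d r L n0 er vr eL vL.
have [P Pu] := Schur L n0; have {}Pu := unitarymx_unit Pu.
rewrite /similar_to /= conjumx // => trigU.
set U := P *m L *m invmx P in trigU.
have trL : \tr L = \sum_i U i i.
  by rewrite -[RHS]/(\tr U) /U mxtrace_mulC mulmxA mulVmx // mul1mx.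
pose V := P *m diag_mx d *m invmx P.
have conjsum N : P *m (\sum_(k < N) (k`!%:R)^-1 *: (c *: L) ^+ k) *m invmx P
    = \sum_(k < N) (k`!%:R)^-1 *: (c *: U) ^+ k.
  rewrite mulmx_sumr mulmx_suml; apply: eq_bigr => k _.
  by rewrite -scalemxAr -scalemxAl conj_mx_exp // -scalemxAr -scalemxAl.
have trigcU : is_trig_mx (c *: U).
  by apply/is_trig_mxP => i j ij; rewrite mxE (is_trig_mxP trigU) // mulr0.
have entry i j : ((fun N => (\sum_(k < N) (k`!%:R)^-1 *: (c *: U) ^+ k) i j) : nat -> (K : numFieldType)) @ \oo --> (V i j : (K : numFieldType)).
  have := @cvg_mulmx_entry (K : numFieldType) n P (invmx P) _ _ i j eL.
  by under eq_fun do rewrite conjsum.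
have trigV : is_trig_mx V.
  apply/is_trig_mxP => i j ij.
  apply: (numField_cvg_unique (entry i j)).
  rewrite (_ : (fun N => _) = (fun=> 0)); first exact: cvg_cst.
  apply/funext => N; rewrite summxE big1 // => k _.
  by rewrite mxE (is_trig_mxP (trig_mx_exp k trigcU).1) // mulr0.
have diagV i : ((fun N => exp_partial N (c * U i i)) : nat -> (K : numFieldType)) @ \oo --> (V i i : (K : numFieldType)).
  have := entry i i; under eq_fun do rewrite summxE.
  rewrite (_ : (fun N => exp_partial N _) = (fun N : nat => \sum_(k < N) ((k`!%:R)^-1 *: (c *: U) ^+ k) i i)) //.
  apply/funext => N; apply: eq_bigr => k _.
  by rewrite [RHS]mxE (trig_mx_exp k trigcU).2 [(c *: U) i i]mxE.
have diagD i : ((fun N => exp_partial N (c * r 0 i)) : nat -> (K : numFieldType)) @ \oo --> (d 0 i : (K : numFieldType)).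
  have := @cvg_mulmx_entry (K : numFieldType) n 1%:M 1%:M _ _ i i er.
  rewrite mul1mx mulmx1 mxE eqxx mulr1n.
  have trigr : is_trig_mx (c *: diag_mx r).
    by apply/is_trig_mxP => a b ab; rewrite !mxE -val_eqE (ltn_eqF ab) mulr0n mulr0.
  rewrite (_ : (fun N => exp_partial N _) = (fun N : nat => (1%:M *m (\sum_(k < N) (k`!%:R)^-1 *: (c *: diag_mx r) ^+ k) *m 1%:M) i i)) //.
  apply/funext => N; rewrite mul1mx mulmx1 summxE; apply: eq_bigr => k _.
  by rewrite [RHS]mxE (trig_mx_exp k trigr).2 [(c *: diag_mx r) i i]mxE [diag_mx r i i]mxE eqxx mulr1n.
have reU i : good (U i i).
  apply: vL; rewrite eigenvalue_root_char -(char_poly_conj L Pu) -/U char_poly_trig //.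
  rewrite -(big_map (fun j => U j j) xpredT (fun x => 'X - x%:P)) root_prod_XsubC.
  by apply: map_f; rewrite mem_index_enum.
have reR i : good (r 0 i).
  apply: vr; rewrite eigenvalue_root_char char_poly_trig ?diag_mx_is_trig //.
  rewrite -(big_map (fun j => diag_mx r j j) xpredT (fun x => 'X - x%:P)) root_prod_XsubC.
  by apply/mapP; exists i; rewrite ?mem_index_enum // mxE eqxx mulr1n.
pose sv i := V i i; pose sd i := d 0 i.
have perm : perm_eq (map sv (index_enum 'I_n)) (map sd (index_enum 'I_n)).
  apply: prod_XsubC_eq; rewrite !big_map -(char_poly_trig trigV) /V char_poly_conj //.
  rewrite char_poly_trig ?diag_mx_is_trig //; apply: eq_bigr => i _.
  by rewrite mxE eqxx mulr1n.
(* The logarithm with values in [good]; the default 0 never matters, since [g] is only applied to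
   exponentials of good numbers. *)
pose g (e : K) : K := xget 0 [set a | good a /\
   ((fun N => exp_partial N (c * a)) : nat -> (K : numFieldType)) @ \oo --> (e : (K : numFieldType))].
have gE a e : good a ->
    ((fun N => exp_partial N (c * a)) : nat -> (K : numFieldType)) @ \oo --> (e : (K : numFieldType)) -> g e = a.
  move=> ha ca; have [|h1 h2] := @xgetPex _ 0 [set a | good a /\
   ((fun N => exp_partial N (c * a)) : nat -> (K : numFieldType)) @ \oo --> (e : (K : numFieldType))]; first by exists a.
  exact: uniq_exp h1 ha h2 ca.
have s1 : \sum_i U i i = \sum_i g (sv i).
  by apply: eq_bigr => i _; symmetry; apply: gE; [apply: reU|apply: diagV].
have s2 : \sum_i r 0 i = \sum_i g (sd i).
  by apply: eq_bigr => i _; symmetry; apply: gE; [apply: reR|apply: diagD].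
rewrite trL s1 s2.
rewrite -(big_map sv xpredT g) -(big_map sd xpredT g).
exact: perm_big.
Qed.

Section Uniqueness.
Variable R : realType.
Local Notation C := (R[i] : numFieldType).

Lemma cos_eq1_lt2pi (t : R) : 0 <= t -> t < 2 * pi -> cos t = 1 -> t = 0.
Proof.
move=> t0 t2 ct; have pi0 := pi_gt0 R.
have [tp|pt] := leP t pi.
  by apply: cos_inj; rewrite ?in_itv /= ?t0 ?tp ?lexx ?(ltW pi0) // cos0.
have e : 2 * pi - t = 0.
  apply: cos_inj; rewrite ?in_itv /= ?lexx ?(ltW pi0) //; first by apply/andP; split; lra.
  have -> : 2 * pi - t = - t + pi *+ 2 by rewrite -mulr_natl; lra.
  by rewrite cosD2pi cosN cos0.
lra.
Qed.

Lemma expi_eq (x x' : R) : 0 <= x < 1 -> 0 <= x' < 1 ->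
  expi (2 * pi * x) = expi (2 * pi * x') -> x = x'.
Proof.
wlog xx : x x' / x <= x'.
  by move=> H h h' e; have [l|l] := leP x x'; [exact: H|symmetry; apply: H => //; exact: ltW].
move=> /andP[x0 x1] /andP[x0' x1'] [ec es]; have pi0 := pi_gt0 R.
have : 2 * pi * x' - 2 * pi * x = 0.
  apply: cos_eq1_lt2pi.
  - by rewrite -mulrBr mulr_ge0 //; lra.
  - by rewrite -mulrBr -[ltRHS]mulr1 ltr_pM2l; lra.
  - by rewrite cosB ec es -!expr2 cos2Dsin2.
rewrite -mulrBr => /eqP; rewrite mulf_eq0 => /orP[/eqP|/eqP]; lra.
Qed.

Lemma exp_limit_unique (x y x' y' : R) :
  (expR x)%:C * expi y = (expR x')%:C * expi y' -> x = x' /\ expi y = expi y'.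
Proof.
have E (a b : R) : (expR a)%:C * expi b = Complex (expR a * cos b) (expR a * sin b).
  by rewrite /expi /GRing.mul /= !mul0r subr0 addr0.
move=> e; have := e; rewrite !E => -[e1 e2].
have sq (a b : R) : (expR a * cos b) ^+ 2 + (expR a * sin b) ^+ 2 = expR a ^+ 2.
  by rewrite !exprMn -mulrDr cos2Dsin2 mulr1.
have : expR x ^+ 2 = expR x' ^+ 2 by rewrite -(sq x y) -(sq x' y') e1 e2.
move/eqP; rewrite eqrXn2 ?expR_ge0 // => /eqP /expR_inj xx; split=> //.
move: e; rewrite xx; apply: mulfI.
by rewrite fmorph_eq0 gt_eqF // expR_gt0.
Qed.

(** The modulus of the exponential determines the imaginary part of the exponent; the argument
    determines its real part modulo 1, hence completely in [0, 1). *)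
Lemma exponent_unique (a b e : R[i]) :
  0 <= complex.Re a < 1 -> 0 <= complex.Re b < 1 ->
  ((fun N => exp_partial N (Complex 0 (2 * pi) * a)) : nat -> C) @ \oo --> (e : C) ->
  ((fun N => exp_partial N (Complex 0 (2 * pi) * b)) : nat -> C) @ \oo --> (e : C) ->
  a = b.
Proof.
case: a => a1 a2; case: b => b1 b2 /= ha hb.
have E (u v : R) : Complex 0 (2 * pi) * Complex u v = Complex (- (2 * pi * v)) (2 * pi * u).
  by rewrite /GRing.mul /= !mul0r sub0r add0r.
rewrite !E => ca cb.
have ua := numField_cvg_unique ca (@exp_partial_cvgC R _ _).
have ub := numField_cvg_unique cb (@exp_partial_cvgC R _ _).
have [h1 h2] := exp_limit_unique (etrans (esym ua) ub).
have pi0 := pi_gt0 R.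
congr Complex; first exact: expi_eq.
have /eqP : 2 * pi * (a2 - b2) = 0 by lra.
rewrite mulf_eq0 => /orP[/eqP|/eqP]; lra.
Qed.

Lemma standard_exponents_trace (n : nat) (d r : 'rV[R[i]]_n) (L : 'M[R[i]]_n) :
  (0 < n)%N ->
  standard_choice_of_exponents (diag_mx d) (diag_mx r) ->
  standard_choice_of_exponents (diag_mx d) L -> \tr L = \sum_i r 0 i.
Proof.
move=> n0 [er vr] [eL vL].
exact: (@exponents_trace (R[i]) (Complex 0 (2 * pi)) (fun a => 0 <= complex.Re a < 1)
  exponent_unique n d r L n0 er vr eL vL).
Qed.

Lemma weil_trace (D : finZmodType) (q : D -> rat) (L : 'M[R[i]]_#|D|) :
  standard_choice_of_exponents (weil_T R q) L ->
  \tr L = ratr (\sum_(x : D) frac_part (- q x)).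
Proof.
move=> hL.
have D0 : (0 < #|D|)%N by apply/card_gt0P; exists 0.
rewrite (standard_exponents_trace D0 (weil_T_std R D q) hL) rmorph_sum /=.
rewrite [RHS](reindex (@enum_val D predT)) /=; last first.
  by exists enum_rank => x _; rewrite ?enum_valK ?enum_rankK.
by apply: eq_bigr => i _; rewrite mxE.
Qed.

End Uniqueness.

(** * Ideal classes and binary quadratic forms *)

Local Close Scope complex_scope.

Section QuadraticOrder.
Variables (t m : nat) (om : algC).
Hypothesis om_trace : om + om^* = t%:R.
Hypothesis om_norm : om * om^* = m%:R.
Hypothesis disc_neg : (4 < 4 * m - t ^ 2)%N.

Definition elt (u v : int) : algC := u%:~R + v%:~R * om.
Definition ord : set algC := [set z | exists u v : int, z = elt u v].

Lemma om_conj : om^* = t%:R - om.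
Proof. by rewrite -om_trace addrAC subrr add0r. Qed.

Lemma om_sqr : om * om = t%:R * om - m%:R.
Proof. by rewrite -om_norm om_conj mulrBr -[om * t%:R]mulrC opprB addrC subrK. Qed.

Lemma conj_int (u : int) : (u%:~R : algC)^* = u%:~R.
Proof. by rewrite rmorph_int. Qed.

Lemma elt_conj (u v : int) : (elt u v)^* = elt (u + v * t%:Z) (- v).
Proof.
rewrite /elt rmorphD /= rmorphM /= !conj_int om_conj rmorphD rmorphN rmorphM /=.
by rewrite -[(t%:Z)%:~R]/(t%:R); ring.
Qed.

Lemma eltD a b c d : elt a b + elt c d = elt (a + c) (b + d).
Proof. by rewrite /elt !rmorphD /=; ring. Qed.

Lemma eltM a b c d : elt a b * elt c d = elt (a * c - b * d * m%:Z) (a * d + b * c + b * d * t%:Z).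
Proof.
rewrite /elt !(rmorphD, rmorphN, rmorphM) /= -[(t%:Z)%:~R]/(t%:R) -[(m%:Z)%:~R]/(m%:R).
have -> : (a%:~R + b%:~R * om) * (c%:~R + d%:~R * om) =
  a%:~R * c%:~R + (a%:~R * d%:~R + b%:~R * c%:~R) * om + b%:~R * d%:~R * (om * om) by ring.
by rewrite om_sqr; ring.
Qed.

Lemma elt_int (u : int) : elt u 0 = u%:~R.
Proof. by rewrite /elt mul0r addr0. Qed.

Definition nrm (u v : int) : int := u ^+ 2 + t%:Z * u * v + m%:Z * v ^+ 2.

Lemma elt_norm u v : elt u v * (elt u v)^* = (nrm u v)%:~R.
Proof.
rewrite elt_conj eltM -elt_int; congr elt; rewrite /nrm; ring.
Qed.

Let disc0 : t%:Z ^+ 2 + 4 < 4 * m%:Z.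
Proof. by move: disc_neg; nia. Qed.

Lemma nrm_eq (u v : int) : 4 * nrm u v = (2 * u + t%:Z * v) ^+ 2 + (4 * m%:Z - t%:Z ^+ 2) * v ^+ 2.
Proof. by rewrite /nrm; ring. Qed.

Lemma nrm_ge0 u v : 0 <= nrm u v.
Proof.
rewrite -(@pmulr_rge0 _ 4) // nrm_eq addr_ge0 ?sqr_ge0 // mulr_ge0 ?sqr_ge0 //.
by rewrite subr_ge0; move: disc0; move: (t%:Z ^+ 2) (4 * m%:Z) => x y; lia.
Qed.

Lemma nrm_eq0 u v : nrm u v = 0 -> u = 0 /\ v = 0.
Proof.
move=> n0; have := nrm_eq u v; rewrite n0 mulr0 => /esym/eqP.
have d : 0 < 4 * m%:Z - t%:Z ^+ 2.
  by rewrite subr_gt0; move: disc0; move: (t%:Z ^+ 2) (4 * m%:Z) => x y; lia.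
rewrite paddr_eq0 ?sqr_ge0 //; last by rewrite mulr_ge0 ?sqr_ge0 // ltW.
case/andP=> h1; rewrite mulf_eq0 (gt_eqF d) /= sqrf_eq0 => /eqP v0.
by move: h1; rewrite sqrf_eq0 v0 mulr0 addr0 => /eqP h; split=> //; lia.
Qed.

Lemma elt_eq0 u v : elt u v = 0 -> u = 0 /\ v = 0.
Proof.
move=> e; apply: nrm_eq0; apply/eqP; rewrite -(eqr_int algC) -elt_norm e mul0r.
exact/eqP.
Qed.

Lemma elt_inj u v u' v' : elt u v = elt u' v' -> u = u' /\ v = v'.
Proof.
move=> e; have : elt (u - u') (v - v') = 0.
  by rewrite -eltD -[elt (- u') _](_ : - elt u' v' = _) ?e ?subrr // /elt !rmorphN /=; ring.
by move=> /elt_eq0 [h1 h2]; split; lia.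
Qed.

(** A discriminant below -4 leaves only the units 1 and -1: for nonzero [v], four times the norm is
    at least 4 m - t^2 > 4. *)
Lemma unit_nrm (u v : int) : nrm u v = 1 -> v = 0 /\ (u = 1 \/ u = -1).
Proof.
move=> n1; have := nrm_eq u v; rewrite n1.
have : 4 < 4 * m%:Z - t%:Z ^+ 2.
  by rewrite ltrBrDl; move: disc0; move: (t%:Z ^+ 2) (4 * m%:Z) => x y; lia.
move: (4 * m%:Z - t%:Z ^+ 2) => d d4 e.
have v0 : v = 0.
  apply/eqP; apply/negPn/negP => v0.
  have v1 : 1 <= v ^+ 2 by have : 0 < v ^+ 2; [rewrite exprn_even_gt0|lia].
  have := sqr_ge0 (2 * u + t%:Z * v); move: e; move: (v ^+ 2) ((2 * u + _) ^+ 2) v1 => x y x1; nia.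
rewrite v0 expr0n /= mulr0 mulr0 !addr0 in e; split=> //.
have /eqP : (u - 1) * (u + 1) = 0 by move: e; rewrite exprMn; lia.
by rewrite mulf_eq0 subr_eq0 addr_eq0 => /orP[] /eqP; [left|right].
Qed.

Lemma ord1 : ord 1.
Proof. by exists 1, 0; rewrite elt_int. Qed.

Lemma ord_int (u : int) : ord u%:~R.
Proof. by exists u, 0; rewrite elt_int. Qed.

Lemma ordD x y : ord x -> ord y -> ord (x + y).
Proof. by move=> [a [b ->]] [c [d ->]]; rewrite eltD; do 2 eexists. Qed.

Lemma ordM x y : ord x -> ord y -> ord (x * y).
Proof. by move=> [a [b ->]] [c [d ->]]; rewrite eltM; do 2 eexists. Qed.

Lemma ord_conj x : ord x -> ord x^*.
Proof. by move=> [a [b ->]]; rewrite elt_conj; do 2 eexists. Qed.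

Lemma ord_om : ord om.
Proof. by exists 0, 1; rewrite /elt mul1r add0r. Qed.

Definition qfrm (b : int) : int := b ^+ 2 + t%:Z * b + m%:Z.

(* [std k a b] is the ideal [k (Z a + Z (b + om))]. *)
Definition std (k a b : int) : set algC :=
  [set z | exists x y : int, z = elt (k * (a * x + b * y)) (k * y)].

(** That [a] divides the norm of b + om is what makes the lattice stable under om. *)
Definition good (k a b : int) : Prop := [/\ 0 < k, 0 < a & exists c : int, qfrm b = a * c].

Lemma std_ideal k a b : good k a b -> nonzero_ideal ord (std k a b).
Proof.
move=> [k0 a0 [c cE]]; split.
- by move=> z [x [y ->]]; do 2 eexists.
- exists (elt (k * a) 0); first by exists 1, 0; rewrite !mulr0 addr0 mulr1.
  apply/eqP => /elt_eq0 [/eqP]; rewrite mulf_eq0 (gt_eqF k0) (gt_eqF a0) //.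
- move=> z z' [x [y ->]] [x' [y' ->]]; exists (x + x'), (y + y').
  by rewrite eltD; congr elt; ring.
move=> z z' [u [v ->]] [x [y ->]].
(* Read off from om a = a (b + om) - b a and om (b + om) = (b + t) (b + om) - c a, where a c is the
   norm of b + om. *)
exists (u * x - v * b * x - v * c * y), (u * y + v * a * x + v * (b + t%:Z) * y).
rewrite eltM; congr elt; last by ring.
apply/eqP; rewrite -subr_eq0; apply/eqP.
transitivity (k * v * y * (a * c - qfrm b)); last by rewrite cE subrr mulr0.
by rewrite /qfrm; ring.
Qed.

Lemma int_subgroup (G : int -> Prop) (g0 : int) : G g0 -> g0 != 0 ->
  (forall x y, G x -> G y -> G (x + y)) -> (forall x, G x -> G (- x)) ->
  exists2 g : int, 0 < g & G g /\ forall x, G x -> exists y, x = g * y.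
Proof.
move=> G0 g00 GD GN.
have ex : exists n : nat, (0 < n)%N && `[< G n%:Z >].
  exists `|g0|%N; rewrite absz_gt0 g00 /=; apply/asboolP.
  have [->|->] : `|g0|%N%:Z = g0 \/ `|g0|%N%:Z = - g0 by lia.
    exact: G0.
  exact: GN.
case: (ex_minnP ex) => g /andP[g1 /asboolP Gg] gmin.
exists g%:Z; [lia|split=> //] => x Gx.
have GM (z : nat) : G (z%:Z * g%:Z).
  elim: z => [|z IH]; first by rewrite mul0r -(subrr g%:Z); apply: GD => //; exact: GN.
  have -> : z.+1%:Z = z%:Z + 1 by lia.
  by rewrite mulrDl mul1r; exact: GD.
have GMz (z : int) : G (z * g%:Z).
  by case: z => z; [exact: GM|rewrite NegzE mulNr; apply: GN; exact: GM].
have Gr : G (x %% g)%Z.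
  have -> : (x %% g)%Z = x + (- (x %/ g)%Z) * g%:Z by rewrite {2}(divz_eq x g); ring.
  by apply: GD.
have r0 : 0 <= (x %% g)%Z by apply: modz_ge0; lia.
have rl : (x %% g)%Z < g%:Z by apply: ltz_pmod; lia.
exists (x %/ g)%Z; rewrite {1}(divz_eq x g) mulrC.
suff -> : (x %% g)%Z = 0 by rewrite addr0.
apply/eqP/negPn/negP => rn; have : (g <= `|(x %% g)%Z|)%N.
  by apply: gmin; rewrite absz_gt0 rn /=; apply/asboolP; rewrite gez0_abs.
by lia.
Qed.

(** The Hermite normal form: [g] generates the integers of I, and [k] the coefficients of om in I.
    Multiplying by om elements that realize [g] and [k] shows that [k] divides [g] and [u1];
    multiplying by the conjugate of b' + om shows that [a] divides the norm. *)
Lemma ideal_std I : nonzero_ideal ord I -> exists k a b : int, good k a b /\ I = std k a b.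
Proof.
move=> [IO [x0 Ix0 x00] ID IM].
have IN x : I x -> I (- x) by move=> Ix; rewrite -mulN1r -(rmorphN1 intr); apply: IM => //; exact: ord_int.
have Iom x : I x -> I (om * x) by move=> Ix; apply: IM => //; exact: ord_om.
have [u0 [v0 xE]] := IO _ Ix0.
have In : I ((nrm u0 v0)%:~R).
  by rewrite -elt_norm -xE mulrC; apply: IM => //; apply: ord_conj; exact: IO.
have n0 : nrm u0 v0 != 0.
  by apply/eqP => /nrm_eq0 [e1 e2]; move: x00; rewrite xE e1 e2 elt_int eqxx.
have [g g0 [Ig gP]] := @int_subgroup (fun u => I u%:~R) _ In n0
  (fun x y hx hy => eq_ind_r I (ID _ _ hx hy) (rmorphD intr x y))
  (fun x hx => eq_ind_r I (IN _ hx) (rmorphN intr x)).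
have hv : exists u : int, I (elt u (nrm u0 v0)).
  exists 0; have -> : elt 0 (nrm u0 v0) = om * (nrm u0 v0)%:~R by rewrite /elt add0r mulrC.
  exact: Iom.
have GD x y : (exists u : int, I (elt u x)) -> (exists u : int, I (elt u y)) ->
    exists u : int, I (elt u (x + y)).
  by move=> [a ha] [b hb]; exists (a + b); rewrite -eltD; exact: ID.
have GN x : (exists u : int, I (elt u x)) -> exists u : int, I (elt u (- x)).
  move=> [a ha]; exists (- a).
  have -> : elt (- a) (- x) = - elt a x by rewrite /elt !rmorphN /=; ring.
  exact: IN.
have [k k0 [[u1 Ik] kP]] := @int_subgroup (fun v => exists u : int, I (elt u v)) _ hv n0 GD GN.
have [a gE] : exists a, g = k * a.
  apply: kP; exists 0; have -> : elt 0 g = om * g%:~R by rewrite /elt add0r mulrC.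
  exact: Iom.
have [b uE] : exists b, u1 + k * t%:Z = k * b.
  apply: kP; exists (- (k * m%:Z)); have -> : elt (- (k * m%:Z)) (u1 + k * t%:Z) = om * elt u1 k.
    have -> : om = elt 0 1 by rewrite /elt mul1r add0r.
    by rewrite eltM; congr elt; ring.
  exact: Iom.
pose b' := b - t%:Z; have uE' : u1 = k * b' by rewrite /b' mulrBr -uE addrK.
have a0 : 0 < a by move: g0; rewrite gE pmulr_rgt0.
exists k, a, b'; split.
  split=> //.
  have : I ((k * qfrm b')%:~R).
    have -> : (k * qfrm b')%:~R = elt (b' + t%:Z) (-1) * elt u1 k.
      by rewrite eltM -elt_int uE'; congr elt; rewrite /qfrm; ring.
    by apply: IM => //; do 2 eexists.
  case/gP => y; rewrite gE -mulrA => /(mulfI (lt0r_neq0 k0)) ->; by exists y.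
apply/seteqP; split=> z.
  move=> Iz; have [u [v zE]] := IO _ Iz.
  have [y vE] : exists y, v = k * y by apply: kP; exists u; rewrite -zE.
  have : I ((u - u1 * y)%:~R).
    have -> : (u - u1 * y)%:~R = z + (- y)%:~R * elt u1 k.
      by rewrite zE -elt_int -(elt_int (- y)) eltM eltD; congr elt; rewrite ?vE; ring.
    by apply: ID => //; apply: IM => //; exact: ord_int.
  case/gP => x xE'; exists x, y; rewrite zE vE; congr elt.
  by rewrite mulrDr mulrA -gE mulrA -uE' -xE' subrK.
move=> [x [y ->]].
have -> : elt (k * (a * x + b' * y)) (k * y) = x%:~R * g%:~R + y%:~R * elt u1 k.
  rewrite -!(elt_int x) -(elt_int g) -(elt_int y) !eltM eltD gE uE'; congr elt; ring.
by apply: ID; apply: IM => //; exact: ord_int.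
Qed.

Hypothesis bezout : forall a b c : int, 0 < a -> qfrm b = a * c ->
  exists e1 e2 e3 : int, e1 * a + e2 * (2 * b + t%:Z) + e3 * c = 1.

(** Says that J times its conjugate is the principal ideal (n): the product lies in (n), and [n] is
    a finite sum of products. The explicit sum takes the place of a product of ideals. *)
Definition isnorm (J : set algC) (n : int) : Prop :=
  [/\ 0 < n, forall y z, J y -> J z -> exists2 o, ord o & y * z^* = n%:~R * o
    & exists2 l : seq (algC * algC), (forall w, w \in l -> J w.1 /\ J w.2)
        & \sum_(w <- l) w.1 * w.2^* = n%:~R].

Lemma isnorm_sum J n l : isnorm J n -> (forall w, w \in l -> J w.1 /\ J w.2) ->
  exists2 o, ord o & \sum_(w <- l) w.1 * w.2^* = n%:~R * o.
Proof.
move=> [_ h _]; elim: l => [|w l IH] hl.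
  by exists 0; [exact: (ord_int 0)|rewrite big_nil mulr0].
have [ o oo oE] := IH (fun w' h' => hl w' (mem_behead (s := w :: l) h')).
have [w1 w2] := hl w (mem_head _ _); have [ o' oo' oE'] := h _ _ w1 w2.
by exists (o' + o); [exact: ordD|rewrite big_cons oE oE' mulrDr].
Qed.

Lemma int_ord_dvd (n n' : int) o : n != 0 -> ord o -> n'%:~R = n%:~R * o -> exists u, n' = n * u.
Proof.
move=> n0 [u [v ->]]; rewrite -!elt_int eltM => /elt_inj [-> _].
by exists u; ring.
Qed.

Lemma isnorm_uniq J n n' : isnorm J n -> isnorm J n' -> n = n'.
Proof.
move=> h h'; have [n0 _ [l lJ lE]] := h; have [n0' _ [l' lJ' lE']] := h'.
have [ o oo oE] := isnorm_sum h lJ'; have [ o' oo' oE'] := isnorm_sum h' lJ.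
rewrite lE' in oE; rewrite lE in oE'.
have [u uE] := int_ord_dvd (lt0r_neq0 n0) oo oE.
have [u' uE'] := int_ord_dvd (lt0r_neq0 n0') oo' oE'.
have u0 : 0 < u by move: n0'; rewrite uE pmulr_rgt0.
have u0' : 0 < u' by move: n0; rewrite uE' pmulr_rgt0.
have l1 : n <= n' by rewrite uE ler_peMr; lia.
have l2 : n' <= n by rewrite uE' ler_peMr; lia.
by apply/eqP; rewrite eq_le l1 l2.
Qed.

(** Up to [k ^+ 2 * a], the products of the generators with their conjugates are a, b + om, its
    conjugate, and c. They generate a, 2 b + t and c, hence 1 by [bezout]; the primitivity of the
    form is the invertibility of the ideal. *)
Lemma std_isnorm k a b : good k a b -> isnorm (std k a b) (k ^+ 2 * a).
Proof.
move=> [k0 a0 [c cE]]; split; first by rewrite mulr_gt0 // exprn_gt0.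
  move=> y z [x1 [y1 ->]] [x2 [y2 ->]].
  exists (elt (a * x1 * x2 + b * (x1 * y2 + x2 * y1) + t%:Z * x1 * y2 + c * y1 * y2) (y1 * x2 - x1 * y2)).
    by do 2 eexists.
  rewrite elt_conj -elt_int !eltM; congr elt; last by ring.
  apply/eqP; rewrite -subr_eq0; apply/eqP.
  transitivity (k ^+ 2 * y1 * y2 * (qfrm b - a * c)); last by rewrite cE subrr mulr0.
  by rewrite /qfrm; ring.
have [e1 [e2 [e3 eE]]] := bezout a0 cE.
have sx (x : int) : std k a b (elt (k * (a * x)) 0) by exists x, 0; rewrite !mulr0 addr0.
have sy (y : int) : std k a b (elt (k * (b * y)) (k * y)) by exists 0, y; rewrite mulr0 add0r.
(* The two mixed pairs share the coefficient [e2], so that om and its conjugate combine to the trace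
   2 b + t. *)
exists [:: (elt (k * (a * e1)) 0, elt (k * (a * 1)) 0);
           (elt (k * (a * e2)) 0, elt (k * (b * 1)) (k * 1));
           (elt (k * (b * e2)) (k * e2), elt (k * (a * 1)) 0);
           (elt (k * (b * e3)) (k * e3), elt (k * (b * 1)) (k * 1))].
  by move=> w; rewrite !inE => /or4P[] /eqP -> /=; split; first [exact: sx|exact: sy].
rewrite !big_cons big_nil addr0 /= !elt_conj !eltM !eltD -elt_int; congr elt; last by ring.
apply/eqP; rewrite -subr_eq0; apply/eqP.
transitivity (k ^+ 2 * (a * (e1 * a + e2 * (2 * b + t%:Z) + e3 * c - 1) + e3 * (qfrm b - a * c))).
  by rewrite /qfrm; ring.
by rewrite cE eE; ring.
Qed.

(** The ideal al I^-1 for I = [std 1 a b], since the inverse of I is its conjugate divided by [a].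
    An element of I of norm a n thus yields an ideal of norm n in the inverse class. *)
Definition quot (a b : int) (al : algC) : set algC :=
  [set z | exists2 be, std 1 a b be & a%:~R * z = al * be^*].

Section Quotient.
Variables (a b : int).
Hypothesis gab : good 1 a b.
Let a0 : 0 < a. Proof. by case: gab. Qed.
Let aC : (a%:~R : algC) != 0. Proof. by rewrite intr_eq0 gt_eqF. Qed.
Let nI : isnorm (std 1 a b) a.
Proof. by have := std_isnorm gab; rewrite expr1n mul1r. Qed.

Lemma quot_ideal al : std 1 a b al -> al != 0 -> nonzero_ideal ord (quot a b al).
Proof.
move=> Ial al0; have [_ prod _] := nI; have [_ _ ID IM] := std_ideal gab; split.
- move=> z [be Ibe e]; have [ o oo oE] := prod _ _ Ial Ibe.
  by move: e; rewrite oE => /(mulfI aC) ->.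
- have [ o oo oE] := prod _ _ Ial Ial; exists o; first by exists al.
  apply: contra_neq al0 => o0; move: oE; rewrite o0 mulr0 => /eqP.
  by rewrite mulf_eq0 conjC_eq0 orbb => /eqP.
- move=> z z' [be Ibe e] [be' Ibe' e']; exists (be + be'); first exact: ID.
  by rewrite mulrDr e e' rmorphD mulrDr.
move=> o z oo [be Ibe e]; exists (o^* * be); first by apply: IM => //; exact: ord_conj.
by rewrite mulrCA e rmorphM /= conjCK mulrCA.
Qed.

Lemma quot_isnorm al (n : int) : std 1 a b al -> 0 < n -> al * al^* = (a * n)%:~R ->
  isnorm (quot a b al) n.
Proof.
move=> Ial n0 nE; have [_ prod [l lI lE]] := nI; split=> //.
  move=> z z' [be Ibe e] [be' Ibe' e']; have [ o oo oE] := prod _ _ Ibe' Ibe.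
  exists o => //; apply: (mulfI aC); apply: (mulfI aC).
  have -> : a%:~R * (a%:~R * (z * z'^*)) = (a%:~R * z) * (a%:~R * z')^*.
    by rewrite rmorphM /= conj_int; ring.
  rewrite e e' rmorphM /= conjCK.
  have -> : al * be^* * (al^* * be') = (al * al^*) * (be' * be^*) by ring.
  by rewrite nE oE rmorphM /=; ring.
exists [seq (al * w.2^* / a%:~R, al * w.1^* / a%:~R) | w <- l].
  move=> _ /mapP[w wl ->] /=; have [w1 w2] := lI w wl.
  by split; [exists w.2|exists w.1] => //; rewrite mulrC divfK.
rewrite big_map /= (eq_bigr (fun w => (n%:~R / a%:~R) * (w.1 * w.2^*))).
  by rewrite -mulr_sumr lE divfK.
move=> w _; rewrite !rmorphM /= fmorphV /= conj_int conjCK.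
have -> : al * w.2^* / a%:~R * (al^* * w.1 / a%:~R) = (al * al^*) * (w.1 * w.2^*) / (a%:~R * a%:~R).
  by field.
by rewrite nE rmorphM /=; field.
Qed.

(** The inclusion is multiplied by I: the finite sum that expresses [a] through I and its conjugate
    is pushed through the inclusion term by term. *)
Lemma quot_sub al al' : (forall z, quot a b al z -> quot a b al' z) ->
  exists2 o, ord o & al = al' * o.
Proof.
move=> sub; have [_ prod [l lI lE]] := nI.
suff [ o oo oE] : exists2 o, ord o & al * (\sum_(w <- l) w.1 * w.2^*) = al' * (a%:~R * o).
  exists o => //; apply: (mulfI aC); rewrite mulrC -lE oE lE; ring.
elim: l lI {lE} => [|w l IH] lI.
  by exists 0; [exact: (ord_int 0)|rewrite big_nil !mulr0].
have [ o oo oE] := IH (fun w' h' => lI w' (mem_behead (s := w :: l) h')).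
have [w1 w2] := lI w (mem_head _ _).
have [be Ibe e] : quot a b al' (al * w.2^* / a%:~R).
  by apply: sub; exists w.2 => //; rewrite mulrC divfK.
have [ o' oo' oE'] := prod _ _ w1 Ibe.
exists (o' + o); first exact: ordD.
rewrite big_cons mulrDr oE [in RHS]mulrDr [RHS]mulrDr; congr (_ + _).
rewrite -oE' mulrCA -[al * w.2^*](divfK aC) [_ / _ * _]mulrC e; ring.
Qed.

(** The generators divide each other, so their ratio has norm 1 and is a unit. This is the source of
    the factor 2 in the count of representations. *)
Lemma quot_eq al al' : al != 0 -> quot a b al = quot a b al' -> al' = al \/ al' = - al.
Proof.
move=> al0 e.
have [ o [u [v ->]] h] : exists2 o, ord o & al = al' * o by apply: quot_sub => z; rewrite e.
have [ o' [u' [v' ->]] h'] : exists2 o, ord o & al' = al * o by apply: quot_sub => z; rewrite e.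
have : elt u' v' * elt u v = 1.
  by apply: (mulfI al0); rewrite mulrA -h' -h mulr1.
move=> oo; have : (nrm u' v' * nrm u v)%:~R = 1 :> algC.
  by rewrite rmorphM /= -!elt_norm mulrACA -rmorphM /= oo mul1r rmorph1.
move/eqP; rewrite -[1]/(1%:~R) eqr_int => /eqP nn.
have n1 : nrm u' v' = 1.
  have := nrm_ge0 u' v'; have := nrm_ge0 u v; move: nn; move: (nrm u' v') (nrm u v) => x y nn y0 x0.
  have [yz|y1] : y = 0 \/ 1 <= y by lia.
    by rewrite yz mulr0 in nn.
  have : x <= x * y by rewrite ler_peMr.
  rewrite nn => x1; have [xz|//] : x = 0 \/ x = 1 by lia.
  by rewrite xz mul0r in nn.
have [v0 [u1|u1]] := unit_nrm n1; rewrite h' v0 u1 elt_int ?rmorph1 ?mulr1; first by left.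
by right; rewrite rmorphN1 mulrN1.
Qed.

(** Conjugating q I = p conj(J) gives J = (q/p)^conj conj(I), which is al I^-1 for
    [al = a * (q^* / p^* )]; what remains is that [al] lies in I and has norm a n. *)
Lemma quot_surj J n : nonzero_ideal ord J -> isnorm J n ->
  ideal_equiv ord (std 1 a b) [set z | J z^*] ->
  exists2 al, std 1 a b al & J = quot a b al /\ al * al^* = (a * n)%:~R.
Proof.
move=> idJ nJ [q [p [oq q0 opp p0 e]]]; have [_ prod [l lI lE]] := nI.
pose al := a%:~R * (q^* / p^*).
have p0' : p^* != 0 by rewrite conjC_eq0.
have q0' : q^* != 0 by rewrite conjC_eq0.
have JE : J = quot a b al.
  apply/seteqP; split=> z.
    move=> Jz; have : ( *%R p @` [set z | J z^*]) (p * z^*) by exists z^* => //=; rewrite conjCK.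
    rewrite -e => -[be Ibe /(congr1 Num.conj)]; rewrite !rmorphM /= conjCK => h.
    exists be => //; rewrite /al; apply: (mulfI p0').
    by rewrite mulrCA -h; field.
  move=> [be Ibe h].
  have : ( *%R q @` std 1 a b) (q * be) by exists be.
  rewrite e => -[w /= Jw hw].
  suff -> : z = w^* by [].
  apply: (mulfI aC); rewrite h /al; apply: (mulfI p0').
  have := congr1 Num.conj hw; rewrite !rmorphM /= => hw'.
  by rewrite [RHS]mulrCA hw'; field.
have [JO _ _ _] := idJ; have [_ _ ID IM] := std_ideal gab.
(* [al] is written as al times the sum of the w.1 conj(w.2), divided by [a]; each al conj(w.2) / a
   lies in J, hence in the order, and I absorbs it. *)
have Ial : std 1 a b al.
  suff : std 1 a b ((al * \sum_(w <- l) w.1 * w.2^*) / a%:~R) by rewrite lE mulfK.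
  elim: l lI {lE} => [|w l IH] lI.
    by rewrite big_nil mulr0 mul0r; exists 0, 0; rewrite -[LHS](elt_int 0); congr elt; ring.
  have [w1 w2] := lI w (mem_head _ _).
  rewrite big_cons mulrDr mulrDl; apply: ID.
    have -> : al * (w.1 * w.2^*) / a%:~R = (al * w.2^* / a%:~R) * w.1 by ring.
    apply: IM => //; apply: JO; rewrite JE; exists w.2 => //.
    by rewrite mulrC divfK.
  exact: IH (fun w' h' => lI w' (mem_behead (s := w :: l) h')).
exists al => //; split=> //.
have al0 : al != 0 by rewrite !mulf_neq0 // invr_neq0.
have [ o [u [v oE]] aE] := prod _ _ Ial Ial.
have [x [y alE]] := Ial.
have vE : v = 0.
  have : a%:~R * o = (nrm (1 * (a * x + b * y)) (1 * y))%:~R by rewrite -aE alE elt_norm.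
  rewrite oE -!elt_int eltM => /elt_inj [_]; rewrite !mul0r !addr0 => /eqP.
  by rewrite mulf_eq0 gt_eqF //= => /eqP.
have nE : al * al^* = (a * u)%:~R by rewrite aE oE vE elt_int rmorphM.
have u0 : 0 < u.
  have : 0 < al * al^* by rewrite lt_def mulf_neq0 ?conjC_eq0 //= mul_conjC_ge0.
  by rewrite nE ltr0z pmulr_rgt0.
have := quot_isnorm Ial u0 nE; rewrite -JE => nJ'.
by rewrite nE (isnorm_uniq nJ nJ').
Qed.

End Quotient.

Lemma equiv_refl I : ideal_equiv ord I I.
Proof. by exists 1, 1; split=> //; exact: ord1. Qed.

Lemma equiv_sym I J : ideal_equiv ord I J -> ideal_equiv ord J I.
Proof. by move=> [a [b [? ? ? ? e]]]; exists b, a. Qed.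

Lemma equiv_trans I J K : ideal_equiv ord I J -> ideal_equiv ord J K -> ideal_equiv ord I K.
Proof.
move=> [a [b [oa a0 ob b0 e]]] [c [d [oc c0 od d0 e']]].
have step (x y z w : algC) (A B C : set algC) : *%R x @` A = *%R y @` B ->
    *%R z @` B = *%R w @` C -> *%R (x * z) @` A `<=` *%R (y * w) @` C.
  move=> h h' _ [u Au <-]; have : ( *%R x @` A) (x * u) by exists u.
  rewrite h => -[v Bv hv]; have : ( *%R z @` B) (z * v) by exists v.
  rewrite h' => -[k Ck hk]; exists k => //.
  by rewrite -mulrA hk mulrCA hv mulrCA mulrA.
exists (a * c), (b * d); split; rewrite ?mulf_neq0 //; [exact: ordM|exact: ordM|].
apply/seteqP; split; first exact: step e e'.
by rewrite [b * d]mulrC [a * c]mulrC; exact: step (esym e') (esym e).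
Qed.

Lemma class_eqP I J : nonzero_ideal ord J ->
  ideal_class ord I = ideal_class ord J <-> ideal_equiv ord I J.
Proof.
move=> nJ; split=> [e|e].
  have : ideal_class ord J J by split=> //; exact: equiv_refl.
  by rewrite -e => -[].
apply/seteqP; split=> K [nK eK]; split=> //.
  exact: equiv_trans (equiv_sym e) eK.
exact: equiv_trans e eK.
Qed.

Lemma std_shift a b z : std 1 a (b + a * z) = std 1 a b.
Proof.
apply/seteqP; split=> _ [x [y ->]].
  by exists (x + z * y), y; congr elt; ring.
by exists (x - z * y), y; congr elt; ring.
Qed.

Lemma good_shift a b z : good 1 a b -> good 1 a (b + a * z).
Proof.
move=> [k0 a0 [c cE]]; split=> //; exists (c + 2 * b * z + a * z ^+ 2 + t%:Z * z).
have -> : qfrm (b + a * z) = qfrm b + a * (2 * b * z + a * z ^+ 2 + t%:Z * z) by rewrite /qfrm; ring.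
by rewrite cE; ring.
Qed.

Lemma std_scale k a b : good k a b -> ideal_equiv ord (std k a b) (std 1 a b).
Proof.
move=> [k0 a0 _]; exists 1, k%:~R; split; [exact: ord1|exact: oner_neq0|exact: ord_int| |].
  by rewrite intr_eq0 gt_eqF.
apply/seteqP; split=> _ [_ [x [y ->]] <-].
  exists (elt (1 * (a * x + b * y)) (1 * y)); first by exists x, y.
  by rewrite [RHS]mul1r -(elt_int k) eltM; congr elt; ring.
exists (elt (k * (a * x + b * y)) (k * y)); first by exists x, y.
by rewrite [LHS]mul1r -(elt_int k) eltM; congr elt; ring.
Qed.

Lemma qfrm_gt0 b : 0 < qfrm b.
Proof.
have : nrm b 1 != 0 by apply/eqP => /nrm_eq0 [_].
have := nrm_ge0 b 1; rewrite /nrm /qfrm expr1n !mulr1; lia.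
Qed.

(** Multiplication by the conjugate of b + om sends [a] to -a ((-b - t) + om) and b + om to a c. *)
Lemma std_flip a b c : good 1 a b -> qfrm b = a * c ->
  good 1 c (- b - t%:Z) /\ ideal_equiv ord (std 1 a b) (std 1 c (- b - t%:Z)).
Proof.
move=> [_ a0 _] cE.
have c0 : 0 < c by have := qfrm_gt0 b; rewrite cE pmulr_rgt0.
split; first by split=> //; exists a; rewrite mulrC -cE /qfrm; ring.
exists (elt (b + t%:Z) (-1)), a%:~R; split.
- by do 2 eexists.
- by apply/eqP => /elt_eq0 [].
- exact: ord_int.
- by rewrite intr_eq0 gt_eqF.
have fix1 (x y : int) : elt (b + t%:Z) (-1) * elt (1 * (a * x + b * y)) (1 * y) =
    a%:~R * elt (1 * (c * y + (- b - t%:Z) * (- x))) (1 * - x).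
  rewrite -(elt_int a) !eltM; congr elt; last by ring.
  apply/eqP; rewrite -subr_eq0; apply/eqP.
  transitivity (y * (qfrm b - a * c)); last by rewrite cE subrr mulr0.
  by rewrite /qfrm; ring.
apply/seteqP; split=> _ [_ [x [y ->]] <-].
  exists (elt (1 * (c * y + (- b - t%:Z) * (- x))) (1 * - x)); first by exists y, (- x).
  by rewrite fix1.
exists (elt (1 * (a * (- y) + b * x)) (1 * x)); first by exists (- y), x.
by rewrite fix1 opprK.
Qed.

Let D : nat := (4 * m - t ^ 2)%N.
Let DE : D%:Z = 4 * m%:Z - t%:Z ^+ 2.
Proof. by rewrite /D; move: disc_neg; clear; nia. Qed.

(** Gauss reduction: [b] is translated until -a <= 2 b + t < a, and the ideal is flipped while c <
    a. When a <= c, 4 a c = (2 b + t)^2 + D gives 3 a^2 <= D; the weaker bound by [D] suffices for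
    finiteness. *)
Lemma std_reduce (n : nat) (a b : int) : (`|a| <= n)%N -> good 1 a b ->
  exists a' b' : nat, [/\ good 1 a'%:Z b'%:Z, (a' <= D)%N, (b' < a')%N
    & ideal_equiv ord (std 1 a b) (std 1 a'%:Z b'%:Z)].
Proof.
elim: n a b => [|n IH] a b an g; have [_ a0 [c0 _]] := g; first by lia.
pose z := - ((2 * b + t%:Z + a) %/ (2 * a))%Z; pose b1 := b + a * z.
have g1 : good 1 a b1 by exact: good_shift.
have sE : std 1 a b1 = std 1 a b by exact: std_shift.
have bnd : - a <= 2 * b1 + t%:Z < a.
  have := modz_ge0 (2 * b + t%:Z + a) (_ : 2 * a != 0).
  have := ltz_pmod (2 * b + t%:Z + a) (_ : 0 < 2 * a).
  have := divz_eq (2 * b + t%:Z + a) (2 * a).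
  rewrite /b1 /z; move: ((2 * b + t%:Z + a) %/ (2 * a))%Z ((2 * b + t%:Z + a) %% (2 * a))%Z => q r e h1 h2.
  have {}h1 := h1 ltac:(lia); have {}h2 := h2 ltac:(lia).
  have e2 : a * - q * 2 = - (q * (2 * a)) by ring.
  by apply/andP; split; lia.
have [_ _ [c cE]] := g1.
have [ca|ac] := ltP c a.
  have [g2 eq2] := std_flip g1 cE.
  have cpos : 0 < c by case: g2.
  have cn : (`|c| <= n)%N by lia.
  have [a' [b' [h1 h2 h3 h4]]] := IH _ _ cn g2.
  by exists a', b'; split=> //; rewrite -sE; exact: equiv_trans eq2 h4.
exists `|a|%N, `|(b1 %% a)%Z|%N.
have an0 : a != 0 by rewrite gt_eqF.
have r0 := modz_ge0 b1 an0; have rl := ltz_pmod b1 a0.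
have aE : `|a|%N%:Z = a by lia.
have rE : `|(b1 %% a)%Z|%N%:Z = b1 + a * - (b1 %/ a)%Z.
  by rewrite gez0_abs // {2}(divz_eq b1 a); ring.
split.
- by rewrite aE rE; exact: good_shift.
- have e4 : 4 * (a * c) = (2 * b1 + t%:Z) ^+ 2 + D%:Z by rewrite -cE DE /qfrm; ring.
  have sq : (2 * b1 + t%:Z) ^+ 2 <= a ^+ 2.
    rewrite -[_ ^+ 2]real_normK ?num_real // ler_pXn2r ?nnegrE ?(ltW a0) //.
    by case/andP: bnd => ? ?; rewrite ler_norml; apply/andP; split; lia.
  have aac : a * a <= a * c by rewrite ler_pM2l.
  have aaa : a <= a * a by rewrite ler_peMl; lia.
  by rewrite expr2 in sq; lia.
- by lia.
by rewrite aE rE std_shift sE; exact: equiv_refl.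
Qed.

Lemma ideal_reduce I : nonzero_ideal ord I ->
  exists a' b' : nat, [/\ good 1 a'%:Z b'%:Z, (a' <= D)%N, (b' < a')%N
    & ideal_equiv ord I (std 1 a'%:Z b'%:Z)].
Proof.
move=> /ideal_std [k [a [b [g ->]]]].
have g1 : good 1 a b by case: g.
have [a' [b' [h1 h2 h3 h4]]] := std_reduce (leqnn _) g1.
by exists a', b'; split=> //; exact: equiv_trans (std_scale g) h4.
Qed.

Lemma choose_reps (T U : eqType) (f : T -> U) (s : seq T) :
  exists2 s', {subset s' <= s} & uniq (map f s') /\ map f s' =i map f s.
Proof.
elim: s => [|x s [s' sub [un e]]]; first by exists [::].
have [h|h] := boolP (f x \in map f s).
  exists s'; first by move=> y /sub ys; rewrite inE ys orbT.
  split=> // y; rewrite e /= inE; case: eqP => // ->; by rewrite h.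
exists (x :: s').
  by move=> y; rewrite !inE => /orP[->//|/sub ->]; rewrite orbT.
split; first by rewrite /= e h.
by move=> y; rewrite /= !inE e.
Qed.

Definition data_ok (d : nat * nat) : Prop := good 1 d.1%:Z d.2%:Z.
Definition dideal (d : nat * nat) : set algC := std 1 d.1%:Z d.2%:Z.

(** Reduction leaves a finite list of candidates, from which one representative of each class is
    kept; equality of classes, being an equality of sets, is decided classically. *)
Lemma class_reps : exists reps : seq (nat * nat),
  [/\ uniq reps, forall d, d \in reps -> data_ok d,
      size reps = #|` fset_set (ideal_classes ord)|,
      forall J, nonzero_ideal ord J -> exists2 d, d \in reps & ideal_equiv ord (dideal d) J
    & forall d d', d \in reps -> d' \in reps -> ideal_equiv ord (dideal d) (dideal d') -> d = d'].
Proof.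
pose dl := [seq d <- [seq (a, b) | a <- iota 0 D.+1, b <- iota 0 D.+1] | `[< data_ok d >]].
pose cls (d : nat * nat) : set (set algC) := ideal_class ord (dideal d).
have dlP d : d \in dl -> data_ok d by rewrite mem_filter => /andP[/asboolP].
have [reps sub [un e]] := @choose_reps _ (set (set algC)) cls dl.
have full J : nonzero_ideal ord J -> exists2 d, d \in reps & cls d = ideal_class ord J.
  move=> nJ; have [a [b [g aD ba eq]]] := ideal_reduce nJ.
  have : cls (a, b) \in map cls reps.
    rewrite e; apply: map_f; rewrite mem_filter; apply/andP; split; first exact/asboolP.
    by apply/allpairsP; exists (a, b); rewrite !mem_iota /=; split=> //; lia.
  case/mapP => d dr dE; exists d => //; rewrite -dE; apply/class_eqP => //.
  exact: equiv_sym.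
exists reps; split.
- exact: map_uniq un.
- by move=> d /sub /dlP.
- have -> : ideal_classes ord = [set` map cls reps].
    apply/seteqP; split=> K.
      by move=> [J nJ <-]; have [d dr <-] := full J nJ; apply: map_f.
    move=> /mapP[d dr ->]; exists (dideal d) => //.
    exact: std_ideal (dlP d (sub d dr)).
  (* Finiteness of the set of classes is essential here, [fset_set] being empty on infinite sets. *)
  have -> : fset_set [set` map cls reps] = [fset x in map cls reps]%fset.
    apply/fsetP => x; rewrite in_fset_set; last exact: finite_seq.
    apply/idP/imfsetP => [/set_mem /= h|[y /= h ->]]; first by exists x.
    exact/mem_set.
  by rewrite card_fseq undup_id // size_map.
- move=> J nJ; have [d dr dE] := full J nJ; exists d => //.
  exact/class_eqP.
move=> d d' dr dr' eq.
have : cls d = cls d' by apply/class_eqP => //; exact: std_ideal (dlP d' (sub d' dr')).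
have := un; move: dr dr'; elim: (reps) => [//|x s IH]; rewrite !inE /= => + + /andP[nx us].
move=> /orP[/eqP->|ds] /orP[/eqP->|ds'] // h.
- by case/negP: nx; rewrite h; exact: map_f.
- by case/negP: nx; rewrite -h; exact: map_f.
exact: IH.
Qed.

Lemma std_shiftk k a b z : std k a (b + a * z) = std k a b.
Proof.
apply/seteqP; split=> _ [x [y ->]].
  by exists (x + z * y), y; congr elt; ring.
by exists (x - z * y), y; congr elt; ring.
Qed.

Lemma pos_dvd_eq (x y u v : int) : 0 < x -> 0 < y -> x = y * u -> y = x * v -> x = y.
Proof.
move=> x0 y0 e1 e2.
have u0 : 0 < u by move: x0; rewrite e1 pmulr_rgt0.
have v0 : 0 < v by move: y0; rewrite e2 pmulr_rgt0.
have l1 : y <= x by rewrite e1 ler_peMr; lia.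
have l2 : x <= y by rewrite e2 ler_peMr; lia.
by apply/eqP; rewrite eq_le l1 l2.
Qed.

Lemma std_inj k a b k' a' b' : good k a b -> good k' a' b' -> 0 <= b < a -> 0 <= b' < a' ->
  std k a b = std k' a' b' -> [/\ k = k', a = a' & b = b'].
Proof.
move=> [k0 a0 _] [k0' a0' _] hb hb' e.
have m1 : std k' a' b' (elt (k * (a * 0 + b * 1)) (k * 1)) by rewrite -e; exists 0, 1.
have m1' : std k a b (elt (k' * (a' * 0 + b' * 1)) (k' * 1)) by rewrite e; exists 0, 1.
have m2 : std k' a' b' (elt (k * (a * 1 + b * 0)) (k * 0)) by rewrite -e; exists 1, 0.
have m2' : std k a b (elt (k' * (a' * 1 + b' * 0)) (k' * 0)) by rewrite e; exists 1, 0.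
have [x1 [y1 /elt_inj [p1 q1]]] := m1; have [x1' [y1' /elt_inj [p1' q1']]] := m1'.
have kk : k = k' by apply: (@pos_dvd_eq k k' y1 y1') => //; rewrite -?q1 -?q1' mulr1.
rewrite -kk in p1 q1 p1' q1' m2 m2' *.
have [x2 [y2 /elt_inj [p2 q2]]] := m2; have [x2' [y2' /elt_inj [p2' q2']]] := m2'.
have kn : k != 0 by rewrite gt_eqF.
have y20 : y2 = 0 by apply: (mulfI kn); rewrite -q2.
have y20' : y2' = 0 by apply: (mulfI kn); rewrite -q2'.
move: p2 p2'; rewrite y20 y20' !mulr0 !addr0 !mulr1 => /(mulfI kn) p2 /(mulfI kn) p2'.
have aa : a = a' by apply: (pos_dvd_eq a0 a0' p2 p2').
split=> //; move: p1; rewrite mulr0 add0r mulr1 => /(mulfI kn).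
have -> : y1 = 1 by apply: (mulfI kn); rewrite -q1.
rewrite mulr1 -aa => bE; rewrite -aa in hb'.
have : b - b' = a * x1 by rewrite bE; ring.
case/andP: hb => b1 b2; case/andP: hb' => b3 b4.
have [->|[x|x]] : x1 = 0 \/ (1 <= x1 \/ x1 <= -1) by lia.
- by rewrite mulr0; lia.
- by have : a <= a * x1; [rewrite ler_peMr; lia|lia].
- by have : a * x1 <= a * -1; [rewrite ler_pM2l|lia].
Qed.

Definition alt (d : nat * nat) (x y : int) : algC := elt (1 * (d.1%:Z * x + d.2%:Z * y)) (1 * y).

(** The norm of a x + (b + om) y divided by [a], as [alt_norm] shows; the natural division is exact
    by [dform_c]. *)
Definition dform (d : nat * nat) : int * int * int :=
  (d.1%:Z, 2 * d.2%:Z + t%:Z, (qpoly t m d.2 %/ d.1)%N%:Z).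

Lemma dform_c d : data_ok d -> qfrm d.2%:Z = d.1%:Z * (qpoly t m d.2 %/ d.1)%N%:Z.
Proof.
move=> [_ a0 [c cE]].
have qE : (qpoly t m d.2)%:Z = qfrm d.2%:Z by rewrite /qpoly /qfrm; lia.
have : (d.1 %| qpoly t m d.2)%N.
  have -> : (d.1 %| qpoly t m d.2)%N = (d.1%:Z %| (qpoly t m d.2)%:Z)%Z by [].
  by apply/dvdzP; exists c; rewrite qE cE mulrC.
by move=> dv; rewrite -qE -PoszM mulnC divnK.
Qed.

Lemma dform_posdef d : data_ok d -> posdef (dform d).
Proof.
move=> ok; have cE := dform_c ok; have [_ a0 _] := ok.
have c0 : 0 < (qpoly t m d.2 %/ d.1)%N%:Z by have := qfrm_gt0 d.2%:Z; rewrite cE pmulr_rgt0.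
split=> //=; rewrite -mulrA -cE -subr_gt0.
have -> : 4 * qfrm d.2%:Z - (2 * d.2%:Z + t%:Z) ^+ 2 = 4 * m%:Z - t%:Z ^+ 2 by rewrite /qfrm; ring.
by rewrite subr_gt0; move: disc0; move: (t%:Z ^+ 2) (4 * m%:Z) => x y; lia.
Qed.

Lemma alt_norm d x y : data_ok d -> alt d x y * (alt d x y)^* = (d.1%:Z * bqf (dform d) x y)%:~R.
Proof.
move=> ok; rewrite /alt elt_norm; congr (_%:~R).
have cE := dform_c ok; rewrite /bqf /=; move: cE; set c := (_ %/ _)%N%:Z => cE.
apply/eqP; rewrite -subr_eq0; apply/eqP.
transitivity (y ^+ 2 * (qfrm d.2%:Z - d.1%:Z * c)); last by rewrite cE subrr mulr0.
by rewrite /nrm /qfrm; ring.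
Qed.

Lemma alt_in d x y : dideal d (alt d x y).
Proof. by exists x, y. Qed.

Lemma alt_inj d x y x' y' : data_ok d -> alt d x y = alt d x' y' -> x = x' /\ y = y'.
Proof.
move=> [_ a0 _] /elt_inj [p]; rewrite !mul1r in p * => yE; split=> //.
move: p; rewrite yE => /addIr; apply: mulfI; by rewrite gt_eqF.
Qed.

Lemma altN d x y : alt d (- x) (- y) = - alt d x y.
Proof. by rewrite /alt /elt !(rmorphD, rmorphN, rmorphM) /=; ring. Qed.

Lemma quotN d al : data_ok d -> quot d.1%:Z d.2%:Z (- al) = quot d.1%:Z d.2%:Z al.
Proof.
move=> ok; have [_ _ _ IM] := std_ideal ok.
have N be : std 1 d.1%:Z d.2%:Z be -> std 1 d.1%:Z d.2%:Z (- be).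
  by move=> h; rewrite -mulN1r -(rmorphN1 intr); apply: IM => //; exact: ord_int.
apply/seteqP; split=> z [be Ibe e]; exists (- be); rewrite ?e ?rmorphN ?mulNr ?mulrN ?opprK //; exact: N.
Qed.

(** Conjugating al conj(I) / a = al' conj(I') / a' and clearing denominators gives the two
    multipliers. *)
Lemma quot_class d d' al al' : data_ok d -> data_ok d' -> dideal d al -> dideal d' al' ->
  al != 0 -> al' != 0 ->
  quot d.1%:Z d.2%:Z al = quot d'.1%:Z d'.2%:Z al' -> ideal_equiv ord (dideal d) (dideal d').
Proof.
move=> ok ok' Ial Ial' al0 al0' e.
have [_ a0 _] := ok; have [_ a0' _] := ok'.
have aC : (d.1%:Z%:~R : algC) != 0 by rewrite intr_eq0 gt_eqF.
have aC' : (d'.1%:Z%:~R : algC) != 0 by rewrite intr_eq0 gt_eqF.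
have [IO _ _ _] := std_ideal ok; have [IO' _ _ _] := std_ideal ok'.
have half (A A' : int) (B B' : int) (be be' : algC) : (A%:~R : algC) != 0 ->
    (forall z, quot A B be z -> quot A' B' be' z) ->
    *%R (be^* * A'%:~R) @` std 1 A B `<=` *%R (be'^* * A%:~R) @` std 1 A' B'.
  move=> AC sub _ [g Ig <-].
  have [g' Ig' h] : quot A' B' be' (be * g^* / A%:~R).
    by apply: sub; exists g => //; rewrite mulrC divfK.
  exists g' => //; have := congr1 (fun z => (A%:~R * z)^*) h.
  have -> : A%:~R * (A'%:~R * (be * g^* / A%:~R)) = A'%:~R * (be * g^*) by field.
  by rewrite !rmorphM /= !conjCK !conj_int => h'; rewrite -!mulrA [in RHS]mulrCA h'; ring.
exists (al^* * d'.1%:Z%:~R), (al'^* * d.1%:Z%:~R); split.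
- by apply: ordM; [apply: ord_conj; exact: IO|exact: ord_int].
- by rewrite mulf_neq0 // conjC_eq0.
- by apply: ordM; [apply: ord_conj; exact: IO'|exact: ord_int].
- by rewrite mulf_neq0 // conjC_eq0.
by apply/seteqP; split; apply: half => // z; rewrite e.
Qed.

Lemma conj_ideal J : nonzero_ideal ord J -> nonzero_ideal ord [set z | J z^*].
Proof.
move=> [JO [x Jx x0] JD JM]; split.
- by move=> z /= /JO /ord_conj; rewrite conjCK.
- by exists x^*; rewrite /= ?conjCK // conjC_eq0.
- by move=> x' y /= hx hy; rewrite rmorphD; exact: JD.
by move=> o x' oo /= hx; rewrite rmorphM /=; apply: JM => //; exact: ord_conj.
Qed.

Lemma count_uniq_perm (T : eqType) (P : pred T) (s s' : seq T) : uniq s -> uniq s' ->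
  (forall x, (x \in s) && P x = (x \in s')) -> count P s = size s'.
Proof.
move=> us us' h; rewrite -size_filter; apply/perm_size/uniq_perm => //; first exact: filter_uniq.
by move=> x; rewrite mem_filter andbC h.
Qed.

(** Normal forms of the ideals of norm [n]: since the norm is [k ^ 2 * a], the pair (k, b)
    determines the ideal. *)
Definition ideal_data (n : nat) : seq (nat * nat) :=
  [seq (k, b) | k <- [seq k <- iota 1 n | (k ^ 2 %| n)%N],
     b <- [seq b <- iota 0 (n %/ k ^ 2) | (n %/ k ^ 2 %| qpoly t m b)%N]].

Lemma size_ideal_data n : size (ideal_data n) = nideal t m n.
Proof.
rewrite /ideal_data size_allpairs_dep /nideal sumnE big_map; apply: eq_bigr => k _.
rewrite size_filter /rho -sum1dep_card -sum1_count.
by rewrite (_ : iota 0 _ = index_iota 0 (n %/ k ^ 2)) ?big_mkord // /index_iota subn0.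
Qed.

(** Double counting of the pairs formed by a representation [w] of [n] and the ideal al I^-1 of norm
    [n] attached to it, in normal form. *)
Lemma rep_count (reps : seq (nat * nat)) (n X : nat) : uniq reps ->
  (forall d, d \in reps -> data_ok d) ->
  (forall J, nonzero_ideal ord J -> exists2 d, d \in reps & ideal_equiv ord (dideal d) J) ->
  (forall d d', d \in reps -> d' \in reps -> ideal_equiv ord (dideal d) (dideal d') -> d = d') ->
  (0 < n)%N ->
  (forall d x y, d \in reps -> bqf (dform d) x y = n%:Z -> `|x| <= X%:Z /\ `|y| <= X%:Z) ->
  (\sum_(d <- reps) rep_number X (dform d) n = 2 * nideal t m n)%N.
Proof.
move=> ur ok full sep n0 box.
have [N2 N2E] : exists N2, N2 = iota 0 X.*2.+1 by exists (iota 0 X.*2.+1).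
pose cx (i : nat) : int := i%:Z - X%:Z.
pose P (w : (nat * nat) * (nat * nat)) := bqf (dform w.1) (cx w.2.1) (cx w.2.2) == n%:Z.
pose all := [seq (d, ij) | d <- reps, ij <- [seq (i, j) | i <- N2, j <- N2]].
pose T := [seq w <- all | P w].
have uT : uniq T.
  rewrite filter_uniq // allpairs_uniq //; last by move=> [? ?] [? ?] _ _ [-> ->].
  by rewrite allpairs_uniq ?N2E ?iota_uniq // => -[? ?] [? ?] _ _ [-> ->].
have sT : (\sum_(d <- reps) rep_number X (dform d) n = size T)%N.
  rewrite /T size_filter -sum1_count /all [RHS]big_mkcond [RHS]big_allpairs_dep; apply: eq_bigr => d _.
  rewrite [RHS]big_allpairs_dep /rep_number /symsum.
  rewrite -(big_mkord xpredT (fun i => \sum_(j < X.*2.+1) ((bqf (dform d) (i%:Z - X%:Z) (j%:Z - X%:Z) == n%:Z) : nat))).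
  rewrite /index_iota subn0 -N2E; apply: eq_bigr => i _.
  rewrite -(big_mkord xpredT (fun j => ((bqf (dform d) (i%:Z - X%:Z) (j%:Z - X%:Z) == n%:Z) : nat))).
  by rewrite /index_iota subn0 -N2E; apply: eq_bigr => j _; rewrite /P /cx /=; case: (_ == _).
have TP w : w \in T -> [/\ w.1 \in reps, (w.2.1 <= X.*2)%N, (w.2.2 <= X.*2)%N & P w].
  rewrite mem_filter => /andP[Pw /allpairsP[[d ij] [/= dr ijr wE]]].
  case/allpairsP: ijr => -[i j] [/= iN jN ijE].
  move: Pw; rewrite wE ijE => Pw; move: iN jN; rewrite N2E !mem_iota !add0n.
  by case/andP=> _ iN /andP[_ jN]; split.
have inT d x y : d \in reps -> bqf (dform d) x y = n%:Z ->
    (d, ((absz (x + X%:Z)%R), (absz (y + X%:Z)%R))) \in T /\ cx (absz (x + X%:Z)%R) = x /\ cx (absz (y + X%:Z)%R) = y.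
  move=> dr fxy; have [bx bz] := box d x y dr fxy.
  have ex : cx (absz (x + X%:Z)%R) = x by rewrite /cx; lia.
  have ey : cx (absz (y + X%:Z)%R) = y by rewrite /cx; lia.
  split=> //; rewrite mem_filter /P /= ex ey fxy eqxx /=.
  apply/allpairsP; exists (d, ((absz (x + X%:Z)%R), (absz (y + X%:Z)%R))); split=> //=.
  by apply/allpairsP; exists ((absz (x + X%:Z)%R), (absz (y + X%:Z)%R)); split=> //=; rewrite N2E mem_iota; lia.
pose J (w : (nat * nat) * (nat * nat)) := quot w.1.1%:Z w.1.2%:Z (alt w.1 (cx w.2.1) (cx w.2.2)).
pose S (d : nat * nat) := std d.1%:Z (n %/ d.1 ^ 2)%N%:Z d.2%:Z.
pose Dt := ideal_data n.
have uD : uniq Dt.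
  apply: allpairs_uniq_dep; first by rewrite filter_uniq // iota_uniq.
    by move=> k _; rewrite filter_uniq // iota_uniq.
  by move=> [? ?] [? ?] _ _ /= [-> ->].
have DtP d : d \in Dt -> [/\ good d.1%:Z (n %/ d.1 ^ 2)%N%:Z d.2%:Z, (d.2 < n %/ d.1 ^ 2)%N
    & (d.1 ^ 2 * (n %/ d.1 ^ 2))%N = n].
  case/allpairsPdep => k [b [kS bS ->]] /=.
  move: kS bS; rewrite !mem_filter !mem_iota => /andP[kn /andP[k0 _]] /andP[bd /andP[_ bl]].
  have e : (k ^ 2 * (n %/ k ^ 2) = n)%N by rewrite mulnC divnK.
  have a0 : (0 < n %/ k ^ 2)%N by move: bl; case: (n %/ k ^ 2)%N.
  split=> //; split; [by []|by []|].
  have /dvdnP[c cE] := bd; exists c%:Z.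
  have -> : qfrm b%:Z = (qpoly t m b)%:Z by rewrite /qpoly /qfrm; lia.
  by rewrite cE PoszM mulrC.
have Dtin k a b : (0 < k)%N -> (b < a)%N -> (k ^ 2 * a)%N = n -> good k%:Z a%:Z b%:Z ->
    (k, b) \in Dt /\ (n %/ k ^ 2)%N = a.
  move=> k0 ba nE [_ a0 [c cE]].
  have aE : (n %/ k ^ 2)%N = a by rewrite -nE mulKn // expn_gt0 k0.
  split=> //; apply/allpairsPdep; exists k, b; split=> //.
    rewrite mem_filter mem_iota k0 -nE dvdn_mulr //= add1n ltnS.
    by rewrite -{1}[k]muln1 -mulnn -mulnA leq_mul2l; apply/orP; right; nia.
  rewrite mem_filter aE mem_iota leq0n add0n ba !andbT.
  have -> : (a %| qpoly t m b)%N = (a%:Z %| (qpoly t m b)%:Z)%Z by [].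
  apply/dvdzP; exists c; have -> : (qpoly t m b)%:Z = qfrm b%:Z by rewrite /qpoly /qfrm; lia.
  by rewrite cE mulrC.
pose Rel w d := `[< J w = S d >].
have nz : 0 < n%:Z by [].
have Tnorm w : w \in T -> alt w.1 (cx w.2.1) (cx w.2.2) != 0 /\ isnorm (J w) n%:Z /\ nonzero_ideal ord (J w).
  case/TP => wr _ _ /eqP Pw; have okw := ok _ wr; have [_ a0 _] := okw.
  have nE := alt_norm (cx w.2.1) (cx w.2.2) okw; rewrite Pw in nE.
  have al0 : alt w.1 (cx w.2.1) (cx w.2.2) != 0.
    apply/eqP => e; move: nE; rewrite e mul0r => /esym/eqP.
    by rewrite intr_eq0 mulf_eq0 !gt_eqF.
  split=> //; split; first exact: quot_isnorm (alt_in _ _ _) nz nE.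
  exact: quot_ideal (alt_in _ _ _) al0.
(* Existence and uniqueness of the normal form with b in [0, a). *)
have one w : w \in T -> count (Rel w) Dt = 1%N.
  move=> wT; have [_ [nJ iJ]] := Tnorm w wT.
  have [k [a [b [g JE]]]] := ideal_std iJ; have [k0 a0 _] := g.
  pose b' := (b %% a)%Z; have an : a != 0 by rewrite gt_eqF.
  have b0 : 0 <= b' by exact: modz_ge0.
  have bl : b' < a by exact: ltz_pmod.
  have bE : b' = b + a * - (b %/ a)%Z by rewrite /b' {2}(divz_eq b a); ring.
  have JE' : J w = std k a b' by rewrite bE std_shiftk.
  have g' : good k a b'.
    have g1 : good 1 a b by case: g => _ a1 h1; split.
    have [_ _ h2] := good_shift (- (b %/ a)%Z) g1.
    by split=> //; rewrite bE.
  have nE : k ^+ 2 * a = n%:Z.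
    by apply: (@isnorm_uniq (J w)) => //; rewrite JE'; exact: std_isnorm.
  have kE : `|k|%N%:Z = k by lia.
  have aE : `|a|%N%:Z = a by lia.
  have b'E : `|b'|%N%:Z = b' by lia.
  have [dD dE] := @Dtin `|k|%N `|a|%N `|b'|%N ltac:(lia) ltac:(lia)
     ltac:(by apply/eqP; rewrite -eqz_nat PoszM -mulnn PoszM kE aE -expr2 nE)
     ltac:(by rewrite kE aE b'E).
  rewrite (@count_uniq_perm _ _ _ [:: (`|k|%N, `|b'|%N)]) // => d.
  rewrite inE; apply/idP/eqP => [/andP[dDt /asboolP re]|->].
    have [gd dl dn] := DtP d dDt.
    have [] := std_inj g' gd _ _ (etrans (esym JE') re); first by rewrite b0 bl.
      by apply/andP; split; lia.
    by case: d {dDt re gd dl dn} => d1 d2 /= e1 _ e2; congr pair; lia.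
  by rewrite dD /=; apply/asboolP; rewrite /S /= dE kE aE b'E.
(* An ideal determines the class of I, hence the form, and then al up to sign; the two signs differ
   because [n] is not 0. *)
have two d : d \in Dt -> count (fun w => Rel w d) T = 2%N.
  move=> dD; have [gd dl dn] := DtP d dD.
  have idS := std_ideal gd; have nS : isnorm (S d) n%:Z.
    have := std_isnorm gd; rewrite (_ : _ * _ = n%:Z) //.
    by rewrite -{2}dn PoszM -mulnn PoszM -expr2.
  (* al I^-1 lies in the class of the conjugate of I, so the representative is sought in the class
     of the conjugate ideal. *)
  have [r rr eqr] := full _ (conj_ideal idS).
  have okr := ok _ rr; have [_ a0 _] := okr.
  have [al [x [y alE]] [SE nE]] := quot_surj okr idS nS eqr.
  have {}alE : al = alt r x y by [].
  rewrite alE in SE nE.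
  have fxy : bqf (dform r) x y = n%:Z.
    move: nE; rewrite alt_norm // => /intr_inj; apply: mulfI; by rewrite gt_eqF.
  have fNxy : bqf (dform r) (- x) (- y) = n%:Z by rewrite -fxy /bqf; ring.
  have [t1 [ex ey]] := inT r x y rr fxy; have [t2 [ex' ey']] := inT r _ _ rr fNxy.
  set w1 := (r, _) in t1; set w2 := (r, _) in t2.
  have J1 : J w1 = S d by rewrite /J /= ex ey -SE.
  have J2 : J w2 = S d by rewrite /J /= ex' ey' altN quotN // -SE.
  rewrite (@count_uniq_perm _ _ _ [:: w1; w2]) //.
    rewrite /= inE andbT; apply/eqP => -[e1 e2].
    have hx : x = - x by rewrite -{1}ex -ex' e1.
    have hy : y = - y by rewrite -{1}ey -ey' e2.
    have x0 : x = 0 by lia.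
    have y0 : y = 0 by lia.
    by move: fxy; rewrite x0 y0 /bqf expr0n /= !mulr0 !addr0; lia.
  move=> w; rewrite !inE; apply/andP/orP => [[wT /asboolP Jw]|].
    have [wr w1l w2l /eqP Pw] := TP w wT; have [alw0 _] := Tnorm w wT; have [al0 _] := Tnorm w1 t1.
    have okw := ok _ wr.
    have wE : w.1 = r.
      apply: sep => //; apply: (quot_class okw okr (alt_in _ _ _) (alt_in _ (cx w1.2.1) (cx w1.2.2)) alw0 al0).
      by rewrite -/(J w) -/(J w1) Jw J1.
    have := @quot_eq _ _ okr (alt r x y) (alt r (cx w.2.1) (cx w.2.2)).
    rewrite -{1}ex -{1}ey => /(_ al0).
    have -> : quot r.1%:Z r.2%:Z (alt r x y) = quot r.1%:Z r.2%:Z (alt r (cx w.2.1) (cx w.2.2)).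
      by rewrite -SE -[LHS]/(S d) -Jw /J wE.
    move=> /(_ erefl) [|].
      move=> /(alt_inj okr) [h1 h2]; left; apply/eqP.
      by case: w h1 h2 wE {wT Jw wr w1l w2l Pw alw0 okw} => w' [i j] /= h1 h2 ->; congr (_, (_, _)); rewrite -?h1 -?h2 /cx; lia.
    rewrite -altN => /(alt_inj okr) [h1 h2]; right; apply/eqP.
    by case: w h1 h2 wE {wT Jw wr w1l w2l Pw alw0 okw} => w' [i j] /= h1 h2 ->; congr (_, (_, _)); rewrite -?h1 -?h2 /cx; lia.
  by move=> [/eqP ->|/eqP ->]; split=> //; apply/asboolP.
rewrite sT -size_ideal_data -/Dt.
transitivity (\sum_(w <- T) count (Rel w) Dt)%N.
  by rewrite big_seq (eq_bigr (fun=> 1%N)) -?big_seq ?sum1_size.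
transitivity (\sum_(d <- Dt) count (fun w => Rel w d) T)%N.
  under eq_bigr do rewrite -sum1_count big_mkcond.
  by rewrite exchange_big /=; apply: eq_bigr => d _; rewrite -sum1_count [RHS]big_mkcond.
rewrite big_seq (eq_bigr (fun=> 2%N)) // -big_seq big_const_seq count_predT iter_addn_0 mulnC //.
Qed.

End QuadraticOrder.

(** * Integers of an imaginary quadratic field *)

Lemma Aint_quadratic (om : algC) (t m : nat) :
  om + om^* = t%:R -> om * om^* = m%:R -> om \in Aint.
Proof.
move=> ht hm; apply: (@root_monic_Aint (('X - om%:P) * ('X - (om^*)%:P))).
- by rewrite rootM root_XsubC eqxx.
- by rewrite rpredM ?monicXsubC.
have -> : ('X - om%:P) * ('X - (om^*)%:P) = 'X ^+ 2 - t%:R%:P * 'X + m%:R%:P :> {poly algC}.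
  rewrite -ht -hm rmorphD rmorphM /=; ring.
apply/polyOverP => i; rewrite coefD coefB coefXn coefCM coefX coefC.
have -> : (i == 2%N)%:R - t%:R * (i == 1%N)%:R + (if i == 0%N then m%:R else 0) =
   ((i == 2%N)%:Z - t%:Z * (i == 1%N)%:Z + (if i == 0%N then m%:Z else 0))%:~R :> algC.
  by rewrite rmorphD rmorphB rmorphM /=; case: ifP.
exact: intr_int.
Qed.

Section ImaginaryQuadratic.
Variable p : nat.
Hypotheses (pp : prime p) (op : odd p).
Let s : algC := sqrtC ((- p%:Z)%:~R).

Let s2 : s * s = - p%:R.
Proof. by rewrite -expr2 sqrtCK rmorphN. Qed.

(** Conjugation fixes or negates [s]. If it fixed [s], the negative number s s = -p would be the
    product of [s] with its conjugate. *)
Lemma sqrtN_conj : s^* = - s.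
Proof.
have : s^* ^+ 2 == s ^+ 2 by rewrite -rmorphXn /= !expr2 s2 rmorphN rmorph_nat.
rewrite eqf_sqr => /orP[/eqP e|/eqP //].
have : 0 <= s * s^* by exact: mul_conjC_ge0.
by rewrite e s2 oppr_ge0 lern0 => /eqP p0; move: pp; rewrite p0.
Qed.

Let sAint : s \in Aint.
Proof.
apply: (@Aint_quadratic _ 0 p); rewrite sqrtN_conj ?subrr //.
by rewrite mulrN s2 opprK.
Qed.

Lemma ratr_Aint (x : rat) : ratr x \in Aint -> exists n : int, x = n%:~R.
Proof.
move=> h; have /intrP[n e] := Cint_rat_Aint (Crat_rat x) h.
by exists n; apply: (@fmorph_inj _ _ (@ratr algC)); rewrite /= ratr_int -e.
Qed.

(* A half-integral pair is forced by the trace and by [sqrt(-p)] times the difference of conjugates. *)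
Lemma quadratic_integer (z : algC) : ring_of_integers (quadratic_field (- p%:Z)) z ->
  exists A B N : int, 2 * z = A%:~R + B%:~R * s /\ A ^+ 2 + p%:Z * B ^+ 2 = 4 * N.
Proof.
case=> -[a [b zE]] zA; rewrite -/s in zE.
have zcE : z^* = ratr a - ratr b * s.
  have cr (x : rat) : (ratr x : algC)^* = ratr x by exact: conj_Crat (Crat_rat x).
  by rewrite zE rmorphD /= cr rmorphM /= cr sqrtN_conj mulrN.
have zcA : z^* \in Aint by rewrite (Aint_aut (@Num.conj_op algC)).
have [A AE] : exists A : int, 2 * a = A%:~R.
  apply: ratr_Aint; have -> : ratr (2 * a) = z + z^*.
    by rewrite rmorphM /= ratr_nat zcE zE; ring.
  by rewrite rpredD.
have [C CE] : exists C : int, p%:R * (2 * b) = C%:~R.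
  apply: ratr_Aint; have -> : ratr (p%:R * (2 * b)) = (z^* - z) * s.
    rewrite rmorphM rmorphM /= !ratr_nat zcE zE.
    have -> : (ratr a - ratr b * s - (ratr a + ratr b * s)) * s = - (2 * ratr b) * (s * s) by ring.
    by rewrite s2; ring.
  by rewrite rpredM ?rpredB.
have [N NE] : exists N : int, a ^+ 2 + p%:R * b ^+ 2 = N%:~R.
  apply: ratr_Aint; have -> : ratr (a ^+ 2 + p%:R * b ^+ 2) = z * z^*.
    have -> : ratr (a ^+ 2 + p%:R * b ^+ 2) = ratr a ^+ 2 + p%:R * ratr b ^+ 2 :> algC.
      by rewrite rmorphD rmorphM !rmorphXn rmorph_nat.
    rewrite zcE zE.
    have -> : (ratr a + ratr b * s) * (ratr a - ratr b * s) = ratr a ^+ 2 - ratr b ^+ 2 * (s * s) by ring.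
    by rewrite s2; ring.
  by rewrite rpredM.
have CN : C ^+ 2 = p%:Z * (4 * N - A ^+ 2).
  apply/eqP; rewrite -(eqr_int rat) !(rmorphXn, rmorphM, rmorphB) /= -[(p%:Z)%:~R]/(p%:R).
  rewrite -CE -NE -AE; apply/eqP; move: (p%:R : rat) => P; ring.
have /dvdzP[B BE] : (p%:Z %| C)%Z.
  have : (p %| `|C| ^ 2)%N by rewrite -abszX CN abszM absz_nat dvdn_mulr.
  by rewrite Euclid_dvdX // => /andP[].
have p0 : (p%:R : rat) != 0 by rewrite pnatr_eq0 -lt0n prime_gt0.
have bE : 2 * b = B%:~R.
  by apply: (mulfI p0); rewrite CE BE rmorphM mulrC.
exists A, B, N; split.
  have rA : A%:~R = 2 * ratr a :> algC by rewrite -(ratr_int algC) -AE rmorphM rmorph_nat.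
  have rB : B%:~R = 2 * ratr b :> algC by rewrite -(ratr_int algC) -bE rmorphM rmorph_nat.
  by rewrite zE rA rB; ring.
apply/eqP; rewrite -(eqr_int rat) !(rmorphXn, rmorphM, rmorphD) /= -[(p%:Z)%:~R]/(p%:R).
rewrite -NE -AE -bE; apply/eqP; move: (p%:R : rat) => P; ring.
Qed.

Let intA (n : int) : (n%:~R : algC) \in Aint.
Proof. by apply: Aint_Cint; exact: intr_int. Qed.

Let om3 : algC := (1 + s) / 2.

Lemma om3_trace : om3 + om3^* = 1%:R.
Proof.
rewrite /om3 fmorph_div rmorphD rmorph1 /= sqrtN_conj rmorph_nat; by field.
Qed.

Lemma om3_norm : (p %% 4 == 3)%N -> om3 * om3^* = ((p + 1) %/ 4)%:R.
Proof.
move=> p3; rewrite /om3 fmorph_div rmorphD rmorph1 /= sqrtN_conj rmorph_nat.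
have -> : (1 + s) / 2 * ((1 - s) / 2) = (1 - s * s) / 4 by field.
have : (p + 1 = 4 * ((p + 1) %/ 4))%N by lia.
move: ((p + 1) %/ 4)%N => k e.
by rewrite s2 opprK addrC natr1 -addn1 e natrM mulrC mulKf ?pnatr_eq0.
Qed.

Lemma om1_trace : s + s^* = 0%:R.
Proof. by rewrite sqrtN_conj subrr. Qed.

Lemma om1_norm : s * s^* = p%:R.
Proof. by rewrite sqrtN_conj mulrN s2 opprK. Qed.

(** A^2 + p B^2 is A^2 + B^2 modulo 4, and it is divisible by 4 only if both are even. *)
Lemma integers_case1 : (p %% 4 == 1)%N ->
  ring_of_integers (quadratic_field (- p%:Z)) = ord s.
Proof.
move=> p1; apply/seteqP; split=> z.
  move=> /quadratic_integer[A [B [N [zE nE]]]].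
  have [u [v [Au Bv]]] : exists u v : int, A = 2 * u /\ B = 2 * v.
    exists (A %/ 2)%Z, (B %/ 2)%Z.
    have hp : p%:Z = 4 * (p %/ 4)%N%:Z + 1 by lia.
    rewrite {}hp in nE; move: (p %/ 4)%N%:Z nE => k.
    move: (divz_eq A 2) (divz_eq B 2) (modz_ge0 A (isT : 2 != 0 :> int)) (modz_ge0 B (isT : 2 != 0 :> int))
       (ltz_pmod A (isT : 0 < 2 :> int)) (ltz_pmod B (isT : 0 < 2 :> int)).
    move: (A %/ 2)%Z (A %% 2)%Z (B %/ 2)%Z (B %% 2)%Z => u e v f -> -> e0 f0 e1 f1 h.
    have {h} h : e ^+ 2 + f ^+ 2 = 4 * (N - u ^+ 2 - u * e - v ^+ 2 - v * f - k * (v * 2 + f) ^+ 2).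
      transitivity ((u * 2 + e) ^+ 2 + (4 * k + 1) * (v * 2 + f) ^+ 2
        - 4 * (u ^+ 2 + u * e + v ^+ 2 + v * f + k * (v * 2 + f) ^+ 2)); first by ring.
      by rewrite h; ring.
    have : e = 0 \/ e = 1 by lia.
    have : f = 0 \/ f = 1 by lia.
    by move=> [f_|f_] [e_|e_]; move: h; rewrite f_ e_; lia.
  exists u, v; have two : (2 : algC) != 0 by rewrite pnatr_eq0.
  by apply: (mulfI two); rewrite zE Au Bv /elt !rmorphM /=; ring.
case=> u [v ->]; split.
  by exists u%:~R, v%:~R; rewrite !ratr_int.
by rewrite /= /elt rpredD ?rpredM ?intA ?sAint.
Qed.

(** A^2 + p B^2 is now A^2 - B^2 modulo 4, which forces only A = B modulo 2; hence the generator (1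
    + s) / 2. *)
Lemma integers_case3 : (p %% 4 == 3)%N ->
  ring_of_integers (quadratic_field (- p%:Z)) = ord om3.
Proof.
move=> p3; have two : (2 : algC) != 0 by rewrite pnatr_eq0.
apply/seteqP; split=> z.
  move=> /quadratic_integer[A [B [N [zE nE]]]].
  have [u Au] : exists u : int, A = B + 2 * u.
    exists ((A - B) %/ 2)%Z.
    have hp : p%:Z = 4 * (p %/ 4)%N%:Z + 3 by lia.
    rewrite {}hp in nE; move: (p %/ 4)%N%:Z nE => k.
    move: (divz_eq (A - B) 2) (modz_ge0 (A - B) (isT : 2 != 0 :> int)) (ltz_pmod (A - B) (isT : 0 < 2 :> int)).
    move: ((A - B) %/ 2)%Z ((A - B) %% 2)%Z => u e h e0 e1.
    have -> : A = B + u * 2 + e by rewrite -addrA -h addrC subrK.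
    move=> nE.
    have {nE} : e ^+ 2 = 2 * (2 * (N - u ^+ 2 - B ^+ 2 - B * u - u * e - k * B ^+ 2) - B * e).
      transitivity ((B + u * 2 + e) ^+ 2 + (4 * k + 3) * B ^+ 2
        - 4 * (u ^+ 2 + B ^+ 2 + B * u + u * e + k * B ^+ 2) - 2 * B * e); first by ring.
      by rewrite nE; ring.
    have : e = 0 \/ e = 1 by lia.
    by move=> [->|->]; lia.
  exists u, B; apply: (mulfI two); rewrite zE Au /elt /om3 rmorphD rmorphM /=; by field.
have omA := Aint_quadratic om3_trace (om3_norm p3).
case=> u [v ->]; split.
  exists (u%:~R + v%:~R / 2), (v%:~R / 2).
  by rewrite rmorphD !fmorph_div /= !ratr_int ratr_nat /elt /om3 -/s; field.
suff : elt om3 u v \in Aint by [].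
by apply: rpredD; [exact: intA|apply: rpredM; [exact: intA|exact: omA]].
Qed.

End ImaginaryQuadratic.

(** * The class number as a mean of partial character sums *)

Lemma Bezoutz3 (a b c : int) :
  (forall g : nat, (g %| `|a|)%N -> (g %| `|b|)%N -> (g %| `|c|)%N -> g = 1%N) ->
  exists e1 e2 e3 : int, e1 * a + e2 * b + e3 * c = 1.
Proof.
move=> h; have [u [v uv]] := Bezoutz a b; have [x [y xy]] := Bezoutz (gcdz a b) c.
exists (x * u), (x * v), y.
have -> : 1 = gcdz (gcdz a b) c.
  rewrite /gcdz /= (h (gcdn (gcdn `|a| `|b|) `|c|)) ?dvdn_gcdr //.
    by rewrite (dvdn_trans (dvdn_gcdl _ _)) // dvdn_gcdl.
  by rewrite (dvdn_trans (dvdn_gcdl _ _)) // dvdn_gcdr.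
by rewrite -xy -uv; ring.
Qed.

(** The square of a common divisor of the three coefficients divides the discriminant -p. *)
Lemma bezout_case3 (p : nat) (a b c : int) : prime p -> (p %% 4 == 3)%N ->
  qfrm 1 ((p + 1) %/ 4) b = a * c ->
  exists e1 e2 e3 : int, e1 * a + e2 * (2 * b + 1%N%:Z) + e3 * c = 1.
Proof.
move=> pp p3 h; apply: Bezoutz3 => g; rewrite -[g]absz_nat -!dvdzE => ga gb gc; rewrite absz_nat.
have E : p%:Z = 4 * (a * c) - (2 * b + 1%N%:Z) ^+ 2 by rewrite -h /qfrm; lia.
have gp : (g ^ 2 %| p)%N.
  have : (g%:Z ^+ 2 %| p%:Z)%Z.
    by rewrite E rpredB ?dvdz_exp2r // dvdz_mull // expr2 dvdz_mul.
  by rewrite dvdzE abszX !absz_nat.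
have g1 : (g %| p)%N by apply: dvdn_trans gp; rewrite dvdn_exp.
have /primeP[_ /(_ g g1)/orP[/eqP //|/eqP ge]] := pp.
have p2 := prime_gt1 pp; have := dvdn_leq (prime_gt0 pp) gp.
by rewrite ge -mulnn leqNgt -{1}[p]muln1 ltn_pmul2l ?p2 // ltnW.
Qed.

(** The square of a common divisor divides 4 p, which leaves only the divisor 2 to exclude; with [a]
    and [c] even, b^2 + p would be divisible by 4, impossible for [p] = 1 modulo 4. *)
Lemma bezout_case1 (p : nat) (a b c : int) : prime p -> (p %% 4 == 1)%N ->
  qfrm 0 p b = a * c ->
  exists e1 e2 e3 : int, e1 * a + e2 * (2 * b + 0%N%:Z) + e3 * c = 1.
Proof.
move=> pp p1 h; apply: Bezoutz3 => g; rewrite -[g]absz_nat -!dvdzE => ga gb gc; rewrite absz_nat.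
have E : b ^+ 2 + p%:Z = a * c by rewrite -h /qfrm; lia.
have E4 : (4 * p)%N%:Z = 4 * (a * c) - (2 * b + 0%N%:Z) ^+ 2 by rewrite -E; lia.
have gp : (g ^ 2 %| 4 * p)%N.
  have : (g%:Z ^+ 2 %| (4 * p)%N%:Z)%Z.
    by rewrite E4 rpredB ?dvdz_exp2r // dvdz_mull // expr2 dvdz_mul.
  by rewrite dvdzE abszX !absz_nat.
have npg : ~~ (p %| g)%N.
  apply/negP => pg; have : (p * p %| 4 * p)%N.
    by apply: dvdn_trans gp; rewrite -mulnn dvdn_mul.
  rewrite dvdn_pmul2r ?prime_gt0 // -[4%N]/(2 ^ 2)%N Euclid_dvdX // dvdn_prime2 //.
  by move=> /andP[/eqP p2 _]; move: p1; rewrite p2.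
have cop : coprime (g ^ 2) p by rewrite coprime_sym coprimeXr // prime_coprime.
move: gp; rewrite Gauss_dvdl // => gp; have g4 := dvdn_leq (isT : (0 < 4)%N) gp.
have g0 : (0 < g)%N by case: (g) npg => //; rewrite dvdn0.
have g_le2 : (g <= 2)%N by rewrite -leq_sqr.
have : g = 1%N \/ g = 2%N by lia.
case=> // g2; rewrite g2 in ga gc; exfalso.
have /dvdzP[a' a2] := ga; have /dvdzP[c' c2] := gc.
have hp : p%:Z = 4 * (p %/ 4)%N%:Z + 1 by clear -p1; lia.
move: E; rewrite a2 c2 hp; move: (p %/ 4)%N%:Z => k.
move: (divz_eq b 2) (modz_ge0 b (isT : 2 != 0 :> int)) (ltz_pmod b (isT : 0 < 2 :> int)).
move: (b %/ 2)%Z (b %% 2)%Z => u e -> e0 e1 E.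
have {}E : e ^+ 2 + 1 = 4 * (a' * c' - u ^+ 2 - u * e - k).
  transitivity ((u * 2 + e) ^+ 2 + (4 * k + 1) - 4 * (u ^+ 2 + u * e + k)); first by ring.
  by rewrite E; ring.
have : e = 0 \/ e = 1 by lia.
by move=> [e_|e_]; clear -E e_; move: E; rewrite e_; lia.
Qed.

Lemma class_number_mean (F : archiRealFieldType) (t m : nat) (om : algC) (chi : nat -> int) (P : nat) :
  om + om^* = t%:R -> om * om^* = m%:R -> (4 < 4 * m - t ^ 2)%N ->
  (forall a b c : int, 0 < a -> qfrm t m b = a * c ->
     exists e1 e2 e3 : int, e1 * a + e2 * (2 * b + t%:Z) + e3 * c = 1) ->
  (2 < P)%N -> (forall d, chi (d + P)%N = chi d) -> (forall d, `|chi d| <= 1) ->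
  \sum_(i < P) chi i.+1 = 0 ->
  (forall n, (0 < n)%N -> (nideal t m n)%:Z = \sum_(d <- divisors n) chi d) ->
  (#|` fset_set (ideal_classes (ord om))|)%:R = char_mean (fun d => (chi d)%:~R : F) P.
Proof.
move=> om_t om_n disc bez P2 per le1 sum0 cnt.
have [reps [ur ok <- full sep]] := class_reps om_t om_n disc.
rewrite -(size_map (dform t m)); apply: mean_of_representations => //.
  by move=> f /mapP[d dr ->]; have := dform_posdef disc (ok d dr).
move=> n X n0 box; rewrite big_map.
have e := rep_count om_t om_n disc bez ur ok full sep n0
  (fun d x y dr => box (dform t m d) x y (map_f _ dr)).
by transitivity ((2 * nideal t m n)%N%:Z); [rewrite -e|rewrite PoszM cnt].
Qed.

Lemma class_number_case1 (F : archiRealFieldType) (p : nat) : prime p -> (p %% 4 == 1)%N ->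
  (class_number_sqrtN p)%:R = char_mean (fun d => (chi_four p d)%:~R : F) (4 * p).
Proof.
move=> pp p1; have op : odd p by lia.
have p_gt1 := prime_gt1 pp.
rewrite /class_number_sqrtN /class_number integers_case1 //.
apply: (@class_number_mean F 0 p _ (chi_four p) (4 * p) (om1_trace pp) (om1_norm pp)).
- by lia.
- by move=> a b c _; exact: bezout_case1 pp p1.
- by lia.
- exact: chi_four_per.
- exact: chi_four_le1.
- exact: chi_four_sum.
by move=> n n0; exact: nideal_case1.
Qed.

(** The discriminant is -p, so [3 < p] is what keeps it below -4 and the units down to 1 and -1. *)
Lemma class_number_case3 (F : archiRealFieldType) (p : nat) : prime p -> (p %% 4 == 3)%N ->
  (3 < p)%N -> (class_number_sqrtN p)%:R = fsum p 0 :> F.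
Proof.
move=> pp p3 p_gt3; have op : odd p by lia.
rewrite fsum_zero_mean // /class_number_sqrtN /class_number integers_case3 //.
apply: (@class_number_mean F 1 ((p + 1) %/ 4) _ (qcharn p) p (om3_trace pp) (om3_norm pp op p3)).
- by lia.
- by move=> a b c _; exact: bezout_case3 pp p3.
- by lia.
- exact: qcharn_per.
- exact: qcharn_le1.
- exact: qcharn_sum.
by move=> n n0; exact: nideal_case3.
Qed.

Theorem theorem4p5 (R : realType) (p r : nat)
  (p_prime : prime p) (p_odd : odd p) (r_ge1 : (1 <= r)%N)
  (L : 'M[R[i]]_#|'Z_(2 * p ^ r)|)
  (L_std : standard_choice_of_exponents
             (@weil_T R ('Z_(2 * p ^ r)) (@cyclic_form (2 * p ^ r))) L) :
  \tr L = ratr (\sum_(1 <= x < (2 * p ^ r).+1)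
                  frac_part (- ((x ^ 2)%N%:R / (4 * p ^ r)%N%:R)))
  /\
  \tr L = ratr
    ((p ^ r)%N%:R - frac_part ((p ^ r)%N%:R / 4) * (p ^ (r %/ 2))%N%:R
     + ((p ^ ((r + 1) %/ 2))%N%:R - 1) / (2 * (p%:R - 1)) *
       (if (p %% 4 == 1)%N then (class_number_sqrtN p)%:R
        else if (p %% 8 == 3)%N then 4 * class_number_sqrtN_star p + 1
        else (* p = 7 mod 8 *) 2 * (class_number_sqrtN p)%:R + 1)).
Proof.
have q0 : (0 < p ^ r)%N by rewrite expn_gt0 prime_gt0.
have trE : \tr L = ratr (\sum_(1 <= x < (2 * p ^ r).+1)
    frac_part (- ((x ^ 2)%N%:R / (4 * p ^ r)%N%:R))).
  rewrite (weil_trace L_std); congr ratr.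
  rewrite -(@square_sum_range rat _ _ q0 (erefl _)).
  have m1 : (1 < 2 * p ^ r)%N by lia.
  rewrite -[LHS](big_mkord xpredT (fun x => fracp (- ((x ^ 2)%N%:R / (2 * (2 * p ^ r))%N%:R)))).
  by rewrite (Zp_cast m1) big_mkord.
split=> //; rewrite {1}trE; congr ratr.
(* The factor 1/2 in the coefficient is absorbed by [2 * trace_const], the quantity that is
   evaluated case by case. *)
rewrite [LHS](trace_sum_value rat p_prime p_odd r); congr (_ + _ * _).
have [p1|p1] := boolP (p %% 4 == 1)%N.
  by rewrite trace_const_case1 // class_number_case1.
have p3 : (p %% 4 == 3)%N by lia.
rewrite trace_const_case3 // /class_number_sqrtN_star.
case: ifP => p8; last by rewrite class_number_case3 //; lia.
(* The prime 3 is 3 modulo 8, so the exceptional value occurs in this branch only. *)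
case: eqP => [p_eq3|p_neq3]; first by rewrite p_eq3 fsum_three.
by rewrite class_number_case3 //; lia.
Qed.
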